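(* Let $\alpha: C^\infty(M)\to C^\infty(M,\mathcal{Q})$ be a smooth action of a compact quantum group $\mathcal{Q}$ on a compact smooth manifold $M$ (possibly with boundary). The following are equivalent: (i) There is a well-defined Fréchet continuous linear map $\beta:\Omega^1(C^\infty(M))\to\Omega^1(C^\infty(M))\bar{\otimes}\mathcal{Q}$ which is a $C^\infty(M)$-bimodule morphism, i.e. $\beta(f\omega)=\alpha(f)\beta(\omega)$ and $\beta(\omega f)=\beta(\omega)\alpha(f)$ for all $\omega\in\Omega^1(C^\infty(M))$ and $f\in C^\infty(M)$, and which satisfies $\beta(df)=(d\otimes\mathrm{id})(\alpha(f))$ for all $f\in C^\infty(M)$. (ii) For all $f,g\in C^\infty(M)$ and all smooth vector fields $\nu$ on $M$, $$(\nu\otimes\mathrm{id})(\alpha(f))\,\alpha(g)=\alpha(g)\,(\nu\otimes\mathrm{id})(\alpha(f)).$$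
   Context: A compact quantum group (CQG) is a unital $C^*$-algebra $\mathcal{Q}$ with a coassociative unital $*$-homomorphism $\Delta:\mathcal{Q}\to\mathcal{Q}\hat{\otimes}\mathcal{Q}$ (minimal tensor product) such that the linear spans of $\Delta(\mathcal{Q})(\mathcal{Q}\otimes 1)$ and $\Delta(\mathcal{Q})(1\otimes\mathcal{Q})$ are norm-dense in $\mathcal{Q}\hat{\otimes}\mathcal{Q}$. $C^\infty(M)$ is the algebra of complex-valued smooth functions with its usual Fréchet topology (uniform convergence of all partial derivatives on compact subsets of charts); $C^\infty(M)\hat{\otimes}\mathcal{Q}=C^\infty(M,\mathcal{Q})$ is the Fréchet algebra of smooth $\mathcal{Q}$-valued functions. A smooth action of $\mathcal{Q}$ on $M$ is a continuous $*$-homomorphism $\alpha:C^\infty(M)\to C^\infty(M,\mathcal{Q})$ with $(\alpha\otimes\mathrm{id})\alpha=(\mathrm{id}\otimes\Delta)\alpha$ and with the span of $\alpha(C^\infty(M))(1\otimes\mathcal{Q})$ Fréchet dense in $C^\infty(M,\mathcal{Q})$; if $M$ has boundary it is also assumed that the closed ideal $\{f\in C^\infty(M): f|_{\partial M}=0\}$ is invariant under $\alpha$. $\Omega^1(C^\infty(M))$ is the space of smooth complex one-forms on $M$ with its Fréchet topology (uniform convergence of all derivatives of local coefficients on compact subsets of charts), with its usual commutative bimodule structure $f\omega=\omega f$. $\Omega^1(C^\infty(M))\bar{\otimes}\mathcal{Q}$ is the space of smooth $\mathcal{Q}$-valued one-forms, i.e. maps $\Omega$ with $\Omega(m)\in T_m^*M\otimes\mathcal{Q}$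 (complexified cotangent spaces) which in local coordinates $(x_1,\dots,x_n)$ on a chart have the form $\Omega=\sum_i dx_i\,\Omega_i$ with $\Omega_i$ smooth and $\mathcal{Q}$-valued. It carries the analogous Fréchet topology, and it is a $C^\infty(M,\mathcal{Q})$-bimodule by left and right pointwise multiplication in the $\mathcal{Q}$-component. The map $d\otimes\mathrm{id}:C^\infty(M,\mathcal{Q})\to\Omega^1(C^\infty(M))\bar{\otimes}\mathcal{Q}$ is given locally by $F\mapsto\sum_i dx_i\,\frac{\partial F}{\partial x_i}$. For a smooth vector field $\nu$, viewed as a derivation of $C^\infty(M)$, $\nu\otimes\mathrm{id}$ denotes the induced derivation of $C^\infty(M,\mathcal{Q})$. *)

(* Defs.v *)
From HB Require Import structures.
From mathcomp Require Import all_boot all_order all_algebra.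
From mathcomp Require Export complex.
From mathcomp Require Export all_classical all_reals all_analysis.

Set Implicit Arguments.
Unset Strict Implicit.
Unset Printing Implicit Defensive.

Import Order.TTheory GRing.Theory Num.Theory.
Import numFieldNormedType.Exports.

Local Open Scope classical_set_scope.
Local Open Scope ring_scope.

(** * C*-algebras, Hilbert spaces and the minimal tensor product *)

(* The multiplication is introduced together with the involution and then
   declared as a ring structure: the library does not provide a join of normed
   modules with rings. *)
HB.mixin Record isCStarAlgebra (R : realType) A
    of CompleteNormedModule R[i] A := {
  cstar_mul : A -> A -> A;
  cstar_one : A;
  star : A -> A;
  cstar_mulA : associative cstar_mul;
  cstar_mul1l : left_id cstar_one cstar_mul;
  cstar_mul1r : right_id cstar_one cstar_mul;
  cstar_mulDl : left_distributive cstar_mul +%R;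
  cstar_mulDr : right_distributive cstar_mul +%R;
  cstar_scaleAl : forall (a : R[i]) (x y : A),
    a *: cstar_mul x y = cstar_mul (a *: x) y;
  cstar_scaleAr : forall (a : R[i]) (x y : A),
    a *: cstar_mul x y = cstar_mul x (a *: y);
  star_semilinear : forall (a : R[i]) (x y : A),
    star (a *: x + y) = Num.conj a *: star x + star y;
  starM : forall x y : A, star (cstar_mul x y) = cstar_mul (star y) (star x);
  starK : involutive star;
  cstar_normM : forall x y : A, `|cstar_mul x y| <= `|x| * `|y|;
  cstar_norm_star : forall x : A, `|cstar_mul (star x) x| = `|x| ^+ 2
}.

#[short(type="cstarType")]
HB.structure Definition CStarAlgebra (R : realType) :=
  {A of CompleteNormedModule R[i] A & isCStarAlgebra R A}.

HB.instance Definition _ (R : realType) (A : cstarType R) :=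
  GRing.Zmodule_isPzRing.Build A (@cstar_mulA R A) (@cstar_mul1l R A)
    (@cstar_mul1r R A) (@cstar_mulDl R A) (@cstar_mulDr R A).

Definition cspan (R : realType) (V : lmodType R[i]) (S : set V) : set V :=
  [set v | exists (k : nat) (a : 'I_k -> R[i]) (w : 'I_k -> V),
             (forall i, S (w i)) /\ v = \sum_i a i *: w i].

Record star_hom (R : realType) (A B : cstarType R) (f : A -> B) : Prop :=
  StarHom {
  star_hom_linear : forall (a : R[i]) (x y : A), f (a *: x + y) = a *: f x + f y;
  star_homM : forall x y : A, f (x * y) = f x * f y;
  star_hom1 : f 1 = 1;
  star_hom_star : forall x : A, f (star x) = star (f x)
}.

Record hilbertSpace (R : realType) := HilbertSpace {
  hcarrier :> completeNormedModType R[i];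
  inner : hcarrier -> hcarrier -> R[i];
  inner_linear : forall (a : R[i]) (x y z : hcarrier),
    inner (a *: x + y) z = a * inner x z + inner y z;
  inner_conj : forall x y : hcarrier, inner y x = Num.conj (inner x y);
  inner_norm : forall x : hcarrier, inner x x = `|x| ^+ 2
}.

(* The inner-product formula forces [t] to be bilinear. *)
Definition hilbert_tensor (R : realType) (H1 H2 K : hilbertSpace R)
    (t : H1 -> H2 -> K) : Prop :=
  (forall x x' y y', inner (t x y) (t x' y') = inner x x' * inner y y') /\
  closure (cspan [set z | exists x y, z = t x y]) = [set: K].

(* Boundedness of the operators [pi a] is automatic: they are everywhere
   defined and have an everywhere defined adjoint. *)
Record faithful_rep (R : realType) (A : cstarType R) (H : hilbertSpace R)
    (pi : A -> H -> H) : Prop := FaithfulRep {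
  rep_linear_op : forall (a : A) (c : R[i]) (x y : H),
    pi a (c *: x + y) = c *: pi a x + pi a y;
  rep_linear : forall (c : R[i]) (a b : A) (x : H),
    pi (c *: a + b) x = c *: pi a x + pi b x;
  repM : forall (a b : A) (x : H), pi (a * b) x = pi a (pi b x);
  rep1 : forall x : H, pi 1 x = x;
  rep_star : forall (a : A) (x y : H),
    inner (pi a x) y = inner x (pi (star a) y);
  rep_inj : injective pi
}.

(* [T], with the elementary tensors [t a b], is the minimal (spatial) tensor
   product of [A] and [B]: in suitable faithful representations it is the norm
   closure of the span of the operators [piA a (x) piB b].  Since [rho] is
   injective, bilinearity, multiplicativity and *-compatibility of [t] follow,
   and the norm of [T] is the operator norm of [rho]. *)
Definition min_tensor (R : realType) (A B T : cstarType R)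
    (t : A -> B -> T) : Prop :=
  (exists (H1 H2 K : hilbertSpace R) (ht : H1 -> H2 -> K)
     (piA : A -> H1 -> H1) (piB : B -> H2 -> H2) (rho : T -> K -> K),
     [/\ hilbert_tensor ht, faithful_rep piA, faithful_rep piB,
         faithful_rep rho &
         forall a b x y, rho (t a b) (ht x y) = ht (piA a x) (piB b y)]) /\
  closure (cspan [set z | exists a b, z = t a b]) = [set: T].

(** * Compact quantum groups *)

(* The double and triple minimal tensor powers of the algebra, which are unique
   up to isomorphism, are part of the data; the triple power is bracketed both
   ways, as (Q (x) Q) (x) Q by [tens21] and as Q (x) (Q (x) Q) by [tens12]. *)
Record compactQuantumGroup (R : realType) := CompactQuantumGroup {
  qalg :> cstarType R;
  qalg2 : cstarType R;
  qalg3 : cstarType R;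
  tens : qalg -> qalg -> qalg2;
  tens21 : qalg2 -> qalg -> qalg3;
  tens12 : qalg -> qalg2 -> qalg3;
  tens_min : min_tensor tens;
  tens21_min : min_tensor tens21;
  tens12_min : min_tensor tens12;
  tensA : forall a b c, tens21 (tens a b) c = tens12 a (tens b c);
  comul : qalg -> qalg2;
  comul_hom : star_hom comul;
  comul_coassoc : exists comul_id id_comul : qalg2 -> qalg3,
    [/\ star_hom comul_id, star_hom id_comul,
        forall a b, comul_id (tens a b) = tens21 (comul a) b,
        forall a b, id_comul (tens a b) = tens12 a (comul b) &
        forall a, comul_id (comul a) = id_comul (comul a)];
  comul_densel :
    closure (cspan [set z | exists a b, z = comul a * tens b 1]) = [set: qalg2];
  comul_denser :
    closure (cspan [set z | exists a b, z = comul a * tens 1 b]) = [set: qalg2]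
}.

(** * Differential calculus on relatively open subsets of a half-space *)

(* R^n when n = 0; the boundary is where the coordinate of index 0 vanishes. *)
Definition halfspace (R : realType) (n : nat) : set 'rV[R]_n :=
  [set x | forall i : 'I_n, i = 0%N :> nat -> 0 <= x 0 i].

Definition diff_quot (R : realType) (n : nat) (W : normedModType R[i])
    (f : 'rV[R]_n -> W) (i : 'I_n) (x : 'rV[R]_n) (h : R) : W :=
  (h^-1)%:C%C *: (f (x + h *: delta_mx 0 i) - f x).

(* Increments staying in [V]: at a boundary point of a half-space the derivative
   in the normal direction is one-sided. *)
Definition increments (R : realType) (n : nat) (V : set 'rV[R]_n)
    (i : 'I_n) (x : 'rV[R]_n) : set_system R :=
  within [set h | V (x + h *: delta_mx 0 i)] (0 : R)^'.

Definition pderiv (R : realType) (n : nat) (W : normedModType R[i])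
    (V : set 'rV[R]_n) (i : 'I_n) (f : 'rV[R]_n -> W) (x : 'rV[R]_n) : W :=
  lim (diff_quot f i x @ increments V i x).

Definition ipderiv (R : realType) (n : nat) (W : normedModType R[i])
    (V : set 'rV[R]_n) (s : seq 'I_n) (f : 'rV[R]_n -> W) : 'rV[R]_n -> W :=
  foldr (pderiv V) f s.

(* All iterated partial derivatives exist and are continuous on [V], up to and
   including the boundary of the half-space. *)
Definition smooth_on (R : realType) (n : nat) (W : normedModType R[i])
    (V : set 'rV[R]_n) (f : 'rV[R]_n -> W) : Prop :=
  forall s : seq 'I_n,
    {within V, continuous (ipderiv V s f)} /\
    forall i x, V x ->
      cvg (diff_quot (ipderiv V s f) i x @ increments V i x).

(** * Smooth manifolds with boundary *)

(* Real-valued maps are embedded in the complex numbers, viewed as the normed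
   module [R[i]^o] over themselves. *)
Record smoothManifold (R : realType) (n : nat) := SmoothManifold {
  mcarrier :> topologicalType;
  atlas : choiceType;
  cdom : atlas -> set mcarrier;
  cmap : atlas -> mcarrier -> 'rV[R]_n;
  cinv : atlas -> 'rV[R]_n -> mcarrier;
  mfd_hausdorff : hausdorff_space mcarrier;
  mfd_second_countable : @second_countable mcarrier;
  cdom_open : forall c, open (cdom c);
  cdom_cover : forall m, exists c, cdom c m;
  cmap_open : forall c, exists2 O, open O &
    cmap c @` cdom c = O `&` @halfspace R n;
  cmapK : forall c m, cdom c m -> cinv c (cmap c m) = m;
  cmap_continuous : forall c, {within cdom c, continuous (cmap c)};
  cinv_continuous : forall c,
    {within cmap c @` cdom c, continuous (cinv c)};
  transition_smooth : forall c c' (j : 'I_n),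
    smooth_on (cmap c @` (cdom c `&` cdom c'))
      (fun x => (cmap c' (cinv c x) 0 j)%:C%C : R[i]^o)
}.

Definition cimg (R : realType) (n : nat) (M : smoothManifold R n)
    (c : atlas M) : set 'rV[R]_n := cmap c @` cdom c.

Definition boundary (R : realType) (n : nat) (M : smoothManifold R n) : set M :=
  [set m | exists c, cdom c m /\
             exists i : 'I_n, i = 0%N :> nat /\ cmap c m 0 i = 0].

Definition chart_at (R : realType) (n : nat) (M : smoothManifold R n) (m : M)
  : atlas M := projT1 (cid (cdom_cover m)).

(* The partial derivative at [m], in the direction i of the chart [c], of the
   coordinate j of the chart [c']. *)
Definition jacobian (R : realType) (n : nat) (M : smoothManifold R n)
    (c c' : atlas M) (m : M) (i j : 'I_n) : R[i] :=
  pderiv (cmap c @` (cdom c `&` cdom c')) i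
    (fun x => (cmap c' (cinv c x) 0 j)%:C%C : R[i]^o) (cmap c m).

(** * Smooth W-valued functions and their Fréchet topology *)

Definition smooth (R : realType) (n : nat) (M : smoothManifold R n)
    (W : normedModType R[i]) : set (M -> W) :=
  [set F : M -> W | forall c : atlas M, smooth_on (cimg c) (F \o cinv c)].
Arguments smooth {R n} M W.

Definition chart_compact (R : realType) (n : nat) (M : smoothManifold R n)
    (c : atlas M) : set (set 'rV[R]_n) :=
  [set K | compact K /\ K `<=` cimg c].

Definition jet (R : realType) (n : nat) (M : smoothManifold R n)
    (W : normedModType R[i]) (F : M -> W) :
    prod_topology (fun p : atlas M * seq 'I_n =>
      {family chart_compact p.1, 'rV[R]_n -> W}) :=
  fun p => ipderiv (cimg p.1) p.2 (F \o cinv p.1).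

(* Uniform convergence of all partial derivatives on compact subsets of charts.
   The topology lives on all functions; only its trace on [smooth M W], the
   Fréchet space of smooth W-valued functions, is meaningful. *)
Definition Cinf (R : realType) (n : nat) (M : smoothManifold R n)
    (W : normedModType R[i]) : topologicalType :=
  initial_topology (@jet R n M W).

(** * Smooth W-valued one-forms and their Fréchet topology *)

(* A one-form is given by its coefficients [w c i] in the charts [c]; setting
   them to 0 off the domain of [c] makes the coefficients unique. *)
Definition form_family (R : realType) (n : nat) (M : smoothManifold R n)
    (W : normedModType R[i]) := atlas M -> 'I_n -> M -> W.

Definition one_form (R : realType) (n : nat) (M : smoothManifold R n)
    (W : normedModType R[i]) : set (form_family M W) :=
  [set w | [/\ forall c i m, ~ cdom c m -> w c i m = 0,
               forall c i, smooth_on (cimg c) (w c i \o cinv c) &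
               forall c c' i m, cdom c m -> cdom c' m ->
                 w c i m = \sum_j jacobian c c' m i j *: w c' j m]].
Arguments one_form {R n} M W.

Definition form_jet (R : realType) (n : nat) (M : smoothManifold R n)
    (W : normedModType R[i]) (w : form_family M W) :
    prod_topology (fun p : atlas M * 'I_n * seq 'I_n =>
      {family chart_compact p.1.1, 'rV[R]_n -> W}) :=
  fun p => ipderiv (cimg p.1.1) p.2 (w p.1.1 p.1.2 \o cinv p.1.1).

Definition Omega1 (R : realType) (n : nat) (M : smoothManifold R n)
    (W : normedModType R[i]) : topologicalType :=
  initial_topology (@form_jet R n M W).

(* The exterior derivative; d (x) id when W is a C*-algebra. *)
Definition dform (R : realType) (n : nat) (M : smoothManifold R n)
    (W : normedModType R[i]) (F : M -> W) : form_family M W :=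
  fun c i m =>
    if m \in cdom c then pderiv (cimg c) i (F \o cinv c) (cmap c m) else 0.

Definition lmulf (M I J : Type) (W : pzRingType) (F : M -> W)
    (w : I -> J -> M -> W) : I -> J -> M -> W :=
  fun c i m => F m * w c i m.

Definition rmulf (M I J : Type) (W : pzRingType) (w : I -> J -> M -> W)
    (F : M -> W) : I -> J -> M -> W :=
  fun c i m => w c i m * F m.

(** * Smooth vector fields *)

Record vectorField (R : realType) (n : nat) (M : smoothManifold R n) :=
  VectorField {
  vcoef : atlas M -> 'I_n -> M -> R;
  vcoef_smooth : forall c i,
    smooth_on (cimg c) (fun x => (vcoef c i (cinv c x))%:C%C : R[i]^o);
  vcoef_change : forall c c' j m, cdom c m -> cdom c' m ->
    (vcoef c' j m)%:C%C = \sum_i jacobian c c' m i j * (vcoef c i m)%:C%C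
}.

(* The derivation nu (x) id of C^oo(M, W); its value at [m] does not depend on
   the chart around [m] that is used. *)
Definition vder (R : realType) (n : nat) (M : smoothManifold R n)
    (W : normedModType R[i]) (nu : vectorField M) (F : M -> W) : M -> W :=
  fun m => \sum_i (vcoef nu (chart_at m) i m)%:C%C *: dform F (chart_at m) i m.

(** * Smooth actions *)

Definition fun_tens (R : realType) (M : Type) (W : lmodType R[i])
    (f : M -> R[i]^o) (q : W) : M -> W := fun m => (f m : R[i]) *: q.

(* [A] is the continuous linear extension
   alpha (x) id : C^oo(M, Q) -> C^oo(M, Q (x) Q). *)
Definition is_alpha_id (R : realType) (n : nat) (M : smoothManifold R n)
    (Q : compactQuantumGroup R) (alpha : (M -> R[i]^o) -> (M -> Q))
    (A : (M -> Q) -> (M -> qalg2 Q)) : Prop :=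
  [/\ forall F, smooth M Q F -> smooth M (qalg2 Q) (A F),
      forall (a : R[i]) F G, smooth M Q F -> smooth M Q G ->
        A (a *: F + G) = a *: A F + A G,
      {within (smooth M Q : set (Cinf M Q)),
         continuous (A : Cinf M Q -> Cinf M (qalg2 Q))} &
      forall f q, smooth M R[i]^o f ->
        A (fun_tens f q) = fun m => tens (alpha f m) q].

(* Only the values of [alpha] on smooth functions matter. *)
Record smooth_action (R : realType) (n : nat) (M : smoothManifold R n)
    (Q : compactQuantumGroup R) (alpha : (M -> R[i]^o) -> (M -> Q)) : Prop :=
  SmoothAction {
  act_smooth : forall f, smooth M R[i]^o f -> smooth M Q (alpha f);
  act_linear : forall (a : R[i]) f g,
    smooth M R[i]^o f -> smooth M R[i]^o g ->
    alpha (a *: f + g) = a *: alpha f + alpha g;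
  actM : forall f g, smooth M R[i]^o f -> smooth M R[i]^o g ->
    alpha (f \* g) = alpha f \* alpha g;
  act_star : forall f, smooth M R[i]^o f ->
    alpha (fun m => Num.conj (f m : R[i])) = (fun m => star (alpha f m));
  act_continuous : {within (smooth M R[i]^o : set (Cinf M R[i]^o)),
    continuous (alpha : Cinf M R[i]^o -> Cinf M Q)};
  act_coassoc : exists A, is_alpha_id alpha A /\
    forall f, smooth M R[i]^o f -> A (alpha f) = (fun m => comul (alpha f m));
  act_dense : smooth M Q `<=` closure
    (cspan [set F : M -> Q | exists f q, smooth M R[i]^o f /\
              F = fun m => alpha f m * q] : set (Cinf M Q));
  (* The ideal of functions vanishing on the boundary is mapped into its
     completed tensor product with Q. *)
  act_boundary : @boundary R n M !=set0 ->
    forall f, smooth M R[i]^o f -> (forall m, boundary m -> f m = 0) ->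
      closure (cspan [set F : M -> Q | exists g q, [/\ smooth M R[i]^o g,
                 forall m, boundary m -> g m = 0 & F = fun_tens g q]]
               : set (Cinf M Q)) (alpha f)
}.

(* Main.v *)
Require Import Defs.
From mathcomp Require Import all_boot all_order all_algebra.
From mathcomp Require Import zify ring lra.
Set Implicit Arguments.
Unset Strict Implicit.
Unset Printing Implicit Defensive.
Import Order.TTheory GRing.Theory Num.Theory.
Import numFieldNormedType.Exports.
Local Open Scope classical_set_scope.
Local Open Scope ring_scope.

(** Both conditions say the same thing in coordinates: in every chart, the first
    partial derivatives of [alpha f] commute with the values of [alpha g].  For
    (ii) this holds because vector fields take every coordinate direction at a
    given point ([vder_commutation], [vector_field_exists]).  For (i) => (ii),
    apply [beta] to [g df = df g].

    For (ii) => (i) there is no choice for [beta]: locally a one-form is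
    [sum_j w_j dx_j] and must be sent to [sum_j alpha(w_j) d(alpha x_j)].  Plateau
    functions turn coordinates into functions on M ([patch]), and the local
    expressions are added up with a finite smooth partition of unity [chi_k]
    ([bimodule_map]).  This map is continuous and left linear over [alpha] by
    construction, and right linear because of (ii).  What has to be proved is
    [beta(df) = d(alpha f)], which follows from [alpha 1 = 1] ([alpha1], a
    consequence of the density condition) and from the chain rule

      [alpha(chi) d(alpha f) = sum_j alpha(chi df/dx_j) d(alpha x_j)]

    for [chi] supported in a chart ([local_chain_rule], [patch_exists]).  There,
    fix a point m and a direction i.  By (ii), [D f = d_i (alpha f) (m)] is a
    derivation over the homomorphism [f |-> alpha f (m)]: the values of the latter
    commute with those of D, so that left and right multiplication agree.  The
    difference of the two sides of the chain rule is then a continuous derivation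
    in f that kills the constants and the coordinates, hence the polynomials.

    Such a derivation is zero ([derivation_eq0]) because polynomials are dense for
    the C^L norm on a box.  The density is obtained one variable at a time: a
    function is approximated, together with its derivatives of order at most L, by
    polynomials in one coordinate x_i whose coefficients do not depend on x_i
    ([approx_poly]); the coefficients then depend on fewer variables, and induction
    applies.  The approximation combines Bernstein operators in the variable x_i
    ([bern_bound]) with primitives in x_i, which take care of the derivatives in
    that direction.

    The differential calculus of functions with values in a normed module, on
    relatively open subsets of a half-space, rests on the mean value inequality
    ([mvt_ineq]).  It gives the differentiability of C^1 functions ([C1_diff]),
    hence the chain rule, and the symmetry of second derivatives ([schwarz]).
    Explicit formulas for the iterated derivatives of products ([leibniz]) and
    composites ([smooth_on_comp_ipderiv]) provide smoothness and, at the same time,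
    the estimates behind continuity for the Frechet topologies. *)

(** * Real-valued norms *)

Section RealNorm.
Variables (R : realType) (W : normedModType R[i]).
Implicit Types (x y : W) (a : R).

(** The norm of a module over [R[i]] has values in [R[i]], which is not totally
    ordered; estimates are made with its real part. *)
Definition nrm x : R := complex.Re `|x|.

Lemma nrmE x : `|x| = (nrm x)%:C%C.
Proof.
have : `|x| \is Num.real by apply: normr_real.
by rewrite /nrm; case/complex_realP => k ->.
Qed.

Lemma nrm_ge0 x : 0 <= nrm x.
Proof. by rewrite -ler0c -nrmE. Qed.

Lemma nrm0 : nrm 0 = 0 :> R.
Proof. by rewrite /nrm normr0. Qed.

Lemma nrm_eq0 x : nrm x = 0 -> x = 0.
Proof. by move=> h; apply: normr0_eq0; rewrite nrmE h. Qed.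

Lemma nrmD x y : nrm (x + y) <= nrm x + nrm y.
Proof. by rewrite -(@lecR R) rmorphD /= -!nrmE ler_normD. Qed.

Lemma nrmN x : nrm (- x) = nrm x.
Proof. by rewrite /nrm normrN. Qed.

Lemma nrmBC x y : nrm (x - y) = nrm (y - x).
Proof. by rewrite /nrm distrC. Qed.

Lemma nrmB x y : nrm (x - y) <= nrm x + nrm y.
Proof. by rewrite -(nrmN y) nrmD. Qed.

Lemma nrm_sum (I : Type) (r : seq I) (P : pred I) (F : I -> W) :
  nrm (\sum_(i <- r | P i) F i) <= \sum_(i <- r | P i) nrm (F i).
Proof.
elim/big_ind2 : _ => [|x1 x2 y1 y2 h1 h2|i _]; rewrite ?nrm0 //.
exact: le_trans (nrmD _ _) (lerD _ _).
Qed.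

End RealNorm.

Lemma nrmZ (R : realType) (W : normedModType R[i]) (a : R[i]) (x : W) :
  nrm (a *: x) = nrm (a : R[i]^o) * nrm x.
Proof.
have : `|a *: x| = `|a| * `|x| by rewrite normrZ.
rewrite (nrmE x) (nrmE (a *: x)) (nrmE (a : R[i]^o)) -rmorphM /=.
exact: complexI.
Qed.

Lemma nrmC (R : realType) (a : R) : nrm (a%:C%C : R[i]^o) = `|a|.
Proof. by rewrite /nrm normc_def /= expr0n /= addr0 sqrtr_sqr. Qed.

Lemma nrmZr (R : realType) (W : normedModType R[i]) (a : R) (x : W) :
  nrm (a%:C%C *: x) = `|a| * nrm x.
Proof. by rewrite nrmZ nrmC. Qed.

Lemma le0_eq0_eps (R : realType) (r C : R) :
  (forall e, 0 < e -> r <= e * C) -> r <= 0.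
Proof.
move=> h; apply/ler_addgt0Pr => e e0; rewrite add0r.
have c0 : 0 < `|C| + 1 by rewrite ltr_wpDl.
apply: le_trans (h (e / (`|C| + 1)) _) _; first by rewrite divr_gt0.
rewrite -mulrA ler_piMr ?(ltW e0) // [_^-1 * _]mulrC ler_pdivrMr // mul1r.
by rewrite (le_trans (ler_norm _)) // lerDl.
Qed.

Lemma cvg_nrmP (R : realType) (W : normedModType R[i]) (T : Type)
    (F : set_system T) (FF : Filter F) (f : T -> W) (l : W) :
  f @ F --> l <->
  forall e : R, 0 < e -> \forall t \near F, nrm (f t - l) < e.
Proof.
split.
  move=> /cvgrPdist_lt h e e0.
  have e0' : 0 < e%:C%C :> R[i] by rewrite ltcR.
  near=> t; rewrite nrmBC -(@ltcR R) -nrmE; near: t.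
  exact: h.
move=> h; apply/cvgrPdist_lt => e e0.
have er : e \is Num.real by rewrite gtr0_real.
have [k ek] := complex_realP _ er.
rewrite ek in e0 *; rewrite (@ltcR R 0) in e0.
near=> t; rewrite nrmE ltcR nrmBC; near: t.
exact: h.
Unshelve. all: by end_near. Qed.

(** * Derivatives on relatively open subsets of a half-space *)

Section Calculus.
Variables (R : realType) (n : nat).
Local Notation rV := 'rV[R]_n.
Implicit Types (V : set rV) (x y : rV) (i j : 'I_n).

Definition close (d : R) x y := forall j, `|y 0 j - x 0 j| < d.

Lemma nbhs_closeP x (A : set rV) :
  nbhs x A <-> exists2 d, 0 < d & forall y, close d x y -> A y.
Proof.
split.
  move=> /nbhs_ballP[d /= d0 dA]; exists d => // y xy; apply: dA.
  split => // k j; rewrite (ord1 k) /ball /= distrC; exact: xy.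
case=> d d0 dA; apply/nbhs_ballP; exists d => //= y xy; apply: dA => j.
by have := xy.2 0 j; rewrite /ball /= distrC.
Qed.

Local Notation e_ i := (delta_mx 0 i : rV).

Lemma shiftE x h i j : (x + h *: e_ i) 0 j = x 0 j + h * (j == i)%:R.
Proof. by rewrite !mxE eqxx. Qed.

Lemma shift0 x i : x + 0 *: e_ i = x.
Proof. by rewrite scale0r addr0. Qed.

Lemma near_shift x i (A : set rV) :
  (\forall y \near x, A y) -> \forall h \near (0 : R), A (x + h *: e_ i).
Proof.
case/nbhs_closeP => d d0 dA; apply/nbhs_ballP; exists d => //= h.
rewrite /ball /= sub0r normrN => hd; apply: dA => j.
rewrite shiftE addrC addKr normrM; case: (j == i); rewrite ?normr1 ?mulr1 //.
by rewrite normr0 mulr0.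
Qed.

(** The images of charts have this form: at the boundary they are open in the
    half-space only. *)
Definition relopen V := V `<=` @halfspace R n /\
  forall x, V x -> \forall y \near x, halfspace y -> V y.

Lemma relopen_open (O : set rV) : open O -> relopen (O `&` @halfspace R n).
Proof.
move=> oO; split; first by move=> x [].
move=> x [Ox _]; have : nbhs x O by exact: open_nbhs_nbhs.
by apply: filterS => y Oy hy; split.
Qed.

Lemma relopen_near V V' x : relopen V -> relopen V' -> V x -> V' x ->
  \forall y \near x, V y <-> V' y.
Proof.
move=> [s1 o1] [s2 o2] V1x V2x; near=> y; split => [/s1|/s2]; near: y.
  exact: o2.
exact: o1.
Unshelve. all: by end_near. Qed.

Lemma relopen_close V (p : rV) (r : R) :
  relopen V -> relopen [set x | V x /\ close r p x].
Proof.
move=> [sV oV]; split=> [x [/sV]//|x [Vx xp]].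
have N : \forall y \near x, close r p y.
  apply: (@filter_forall _ _ (fun j (y : 'rV[R]_n) => `|y 0 j - p 0 j| < r) (nbhs x)) => j.
  apply/nbhs_closeP; exists (r - `|x 0 j - p 0 j|); first by rewrite subr_gt0.
  move=> y /(_ j); rewrite ltrBrDr; apply: le_lt_trans.
  by rewrite -{1}(subrK (x 0 j) (y 0 j)) -addrA ler_normD.
by apply: filterS (filterI N (oV x Vx)) => y [a b] hy; split=> //; exact: b.
Qed.

Lemma halfspace_shift x i h : halfspace x -> 0 <= h -> halfspace (x + h *: e_ i).
Proof.
by move=> Hx h0 j j0; rewrite shiftE addr_ge0 ?Hx// mulr_ge0.
Qed.

(** Small positive steps stay in the half-space, in every direction and also from
    a boundary point: this makes limits along increments unique. *)
Lemma increments_proper V i x :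
  relopen V -> V x -> ProperFilter (increments V i x).
Proof.
move=> [sV oV] Vx; have FF : Filter (increments V i x) by exact: within_filter.
apply: Build_ProperFilter_ex => //.
move=> P h.
have {}h : \forall h \near (0 : R), h != 0 -> V (x + h *: e_ i) -> P h.
  exact: h.
have hV := near_shift i (oV x Vx).
have [d /= d0 dP] := (iffLR (nbhs_ballP _ _) (filterI h hV)).
exists (d / 2); have d2 : 0 < d / 2 by rewrite divr_gt0.
have [|a b] := dP (d / 2).
  by rewrite /ball /= sub0r normrN gtr0_norm// ltr_pdivrMr// mulr2n mulrDr mulr1 ltrDl.
apply: a; first by rewrite gt_eqF.
by apply: b; apply: halfspace_shift => //; [exact: sV|exact: ltW].
Unshelve. all: by end_near. Qed.

End Calculus.

(** Convergence of the difference quotient, multiplied by [h].  The estimate is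
    void at h = 0, so that plain neighbourhoods of 0 replace punctured ones. *)
Definition has_pd (R : realType) (n : nat) (W : normedModType R[i])
    (V : set 'rV[R]_n) (i : 'I_n) (f : 'rV[R]_n -> W) (x : 'rV[R]_n) (l : W) :=
  forall e : R, 0 < e -> \forall h \near (0 : R), V (x + h *: delta_mx 0 i) ->
    nrm (f (x + h *: delta_mx 0 i) - f x - h%:C%C *: l) <= e * `|h|.

Definition cont_on (R : realType) (n : nat) (W : normedModType R[i])
    (V : set 'rV[R]_n) (f : 'rV[R]_n -> W) :=
  forall x, V x -> forall e : R, 0 < e -> \forall y \near x, V y ->
    nrm (f y - f x) < e.

Section PartialDerivatives.
Variables (R : realType) (n : nat) (W : normedModType R[i]).
Local Notation rV := 'rV[R]_n.
Local Notation e_ i := (delta_mx 0 i : rV).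
Implicit Types (V : set rV) (x y : rV) (i j : 'I_n) (f g : rV -> W) (l : W).

Lemma cont_onP V f : {within V, continuous f} <-> cont_on V f.
Proof.
split=> [/subspace_continuousP h x Vx e e0|h].
  by have /cvg_nrmP/(_ e e0) := h x Vx.
apply/subspace_continuousP => x Vx; apply/cvg_nrmP => e e0.
by have := h x Vx e e0.
Qed.

Lemma has_pdP V i f x l :
  has_pd V i f x l <-> diff_quot f i x @ increments V i x --> l.
Proof.
have FF : Filter (increments V i x) by exact: within_filter.
have eqn h : h != 0 -> nrm (diff_quot f i x h - l) =
    `|h|^-1 * nrm (f (x + h *: e_ i) - f x - h%:C%C *: l).
  move=> h0; rewrite -[in RHS]normfV -nrmZr; congr nrm.
  by rewrite /diff_quot [RHS]scalerBr scalerA -rmorphM /= mulVf// scale1r.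
split=> [H|/cvg_nrmP H e e0].
  apply/cvg_nrmP => e e0.
  have e2 : 0 < e / 2 by rewrite divr_gt0.
  have H' : \forall h \near (0 : R), h != 0 -> V (x + h *: e_ i) ->
    nrm (diff_quot f i x h - l) < e.
    near=> h => h0 Vh; rewrite eqn// mulrC ltr_pdivrMr ?normr_gt0//.
    apply: (@le_lt_trans _ _ (e / 2 * `|h|)).
      by move: Vh; near: h; exact: H.
    by rewrite ltr_pM2r ?normr_gt0//; lra.
  exact: H'.
have H' : \forall h \near (0 : R), h != 0 -> V (x + h *: e_ i) ->
    nrm (diff_quot f i x h - l) < e by exact: H.
near=> h => Vh.
have [->|h0] := eqVneq h 0.
  by rewrite shift0 subrr scale0r subr0 nrm0 normr0 mulr0.
rewrite -ler_pdivrMr ?normr_gt0// mulrC -eqn//.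
by apply/ltW; move: h0 Vh; near: h.
Unshelve. all: by end_near. Qed.

Lemma pderiv_eq V i f x l :
  relopen V -> V x -> has_pd V i f x l -> pderiv V i f x = l.
Proof.
move=> oV Vx /has_pdP h; apply: cvg_lim => //.
exact: increments_proper.
Qed.

Lemma has_pd_pderiv V i f x l :
  relopen V -> V x -> has_pd V i f x l -> has_pd V i f x (pderiv V i f x).
Proof. by move=> oV Vx h; rewrite (pderiv_eq oV Vx h). Qed.

Lemma has_pd_near V V' i f g x l : relopen V -> relopen V' -> V x -> V' x ->
  (\forall y \near x, V' y -> f y = g y) -> has_pd V i f x l -> has_pd V' i g x l.
Proof.
move=> oV oV' Vx V'x fg H e e0.
have fgx : f x = g x by have /nbhs_singleton := fg; exact.
have h1 := near_shift i fg.
have h2 := near_shift i (relopen_near oV oV' Vx V'x).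
near=> h => V'h.
rewrite -fgx -(_ : f (x + h *: e_ i) = g (x + h *: e_ i)).
  have : V (x + h *: e_ i).
    by apply: (iffRL _ V'h); near: h; exact: h2.
  by near: h; exact: H.
by move: V'h; near: h.
Unshelve. all: by end_near. Qed.

Lemma has_pd_eq V i f g x l : relopen V -> V x ->
  (forall y, V y -> f y = g y) -> has_pd V i f x l -> has_pd V i g x l.
Proof.
move=> oV Vx fg; apply: (has_pd_near oV oV Vx Vx).
by near=> y; exact: fg.
Unshelve. all: by end_near.
Qed.

Lemma has_pd_sub V V' i f x l : V' `<=` V -> has_pd V i f x l -> has_pd V' i f x l.
Proof.
move=> sV H e e0; apply: filterS (H e e0) => h a b; apply: a; exact: sV.
Qed.

(** No derivative needs to exist: the default value of a limit depends only on
    the set of limits, which [f] and [g] share. *)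
Lemma pderiv_near V V' i f g x : relopen V -> relopen V' -> V x -> V' x ->
  (\forall y \near x, V' y -> f y = g y) -> pderiv V i f x = pderiv V' i g x.
Proof.
move=> oV oV' Vx V'x fg.
have fg' : \forall y \near x, V y -> g y = f y.
  have h := relopen_near oV oV' Vx V'x.
  near=> y => Vy; apply/esym; have : V' y by apply: (iffLR _ Vy); near: y.
  by near: y.
have [[l hl]|nl] := pselect (exists l, has_pd V i f x l).
  by rewrite (pderiv_eq oV Vx hl) (pderiv_eq oV' V'x (has_pd_near oV oV' Vx V'x fg hl)).
rewrite /pderiv; congr (get _); apply/funext => l; apply/propext; split => H.
  by exfalso; apply: nl; exists l; apply/has_pdP.
exfalso; apply: nl; exists l; apply: (has_pd_near oV' oV V'x Vx fg').
exact/has_pdP.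
Unshelve. all: by end_near. Qed.

Lemma has_pdD V i f g x l l' : has_pd V i f x l -> has_pd V i g x l' ->
  has_pd V i (fun y => f y + g y) x (l + l').
Proof.
move=> H1 H2 e e0; have e2 : 0 < e / 2 by rewrite divr_gt0.
near=> h => Vh.
have -> : f (x + h *: e_ i) + g (x + h *: e_ i) - (f x + g x) - h%:C%C *: (l + l') =
  (f (x + h *: e_ i) - f x - h%:C%C *: l) + (g (x + h *: e_ i) - g x - h%:C%C *: l').
  by rewrite scalerDr !opprD [X in X + _ = _]addrACA [LHS]addrACA.
apply: le_trans (nrmD _ _) _.
have -> : e * `|h| = e / 2 * `|h| + e / 2 * `|h| by lra.
by apply: lerD; move: Vh; near: h; [exact: H1|exact: H2].
Unshelve. all: by end_near. Qed.

Lemma has_pdN V i f x l : has_pd V i f x l -> has_pd V i (fun y => - f y) x (- l).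
Proof.
move=> H e e0; apply: filterS (H e e0) => h a Vh.
by rewrite scalerN -!opprD nrmN; exact: a.
Qed.

Lemma has_pd_cst V i (c : W) x : has_pd V i (fun=> c) x 0.
Proof.
by move=> e e0; near=> h => _; rewrite subrr scaler0 subr0 nrm0 mulr_ge0// ltW.
Unshelve. all: by end_near. Qed.

Lemma has_pd_sum V i x (I : Type) (r : seq I) (F : I -> rV -> W) (L : I -> W) :
  (forall k, has_pd V i (F k) x (L k)) ->
  has_pd V i (fun y => \sum_(k <- r) F k y) x (\sum_(k <- r) L k).
Proof.
move=> H; elim: r => [|k r IH].
  rewrite big_nil; under eq_fun do rewrite big_nil; exact: has_pd_cst.
rewrite big_cons; under eq_fun do rewrite big_cons; exact: has_pdD (H k) IH.
Qed.

Lemma cont_onD V f g : cont_on V f -> cont_on V g -> cont_on V (fun y => f y + g y).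
Proof.
move=> H1 H2 x Vx e e0; have e2 : 0 < e / 2 by rewrite divr_gt0.
near=> y => Vy; rewrite opprD addrACA; apply: le_lt_trans (nrmD _ _) _.
rewrite (splitr e).
by apply: ltrD; move: Vy; near: y; [exact: H1|exact: H2].
Unshelve. all: by end_near. Qed.

Lemma cont_on_cst V (c : W) : cont_on V (fun=> c).
Proof.
by move=> x _ e e0; near=> y => _; rewrite subrr nrm0.
Unshelve. all: by end_near. Qed.

Lemma cont_on_sum V (I : Type) (r : seq I) (F : I -> rV -> W) :
  (forall k, cont_on V (F k)) -> cont_on V (fun y => \sum_(k <- r) F k y).
Proof.
move=> H; elim: r => [|k r IH].
  under eq_fun do rewrite big_nil; exact: cont_on_cst.
under eq_fun do rewrite big_cons; exact: cont_onD (H k) IH.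
Qed.

Lemma cont_on_near V V' f : relopen V' ->
  (forall x, V' x -> exists V0 g, [/\ relopen V0, V0 x, cont_on V0 g &
     \forall y \near x, V' y -> f y = g y]) -> cont_on V' f.
Proof.
move=> oV' H x V'x e e0; have [V0 [g [oV0 V0x cg fg]]] := H x V'x.
have fgx : f x = g x by have /nbhs_singleton := fg; exact.
have h := relopen_near oV' oV0 V'x V0x.
near=> y => V'y; rewrite fgx (_ : f y = g y); last by move: V'y; near: y.
have : V0 y by apply: (iffLR _ V'y); near: y.
by near: y; exact: cg.
Unshelve. all: by end_near. Qed.

Lemma cont_on_eq V f g : (forall x, V x -> f x = g x) -> cont_on V f -> cont_on V g.
Proof.
move=> fg H x Vx e e0; apply: filterS (H x Vx e e0) => y a Vy.
by rewrite -!fg//; apply: a.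
Qed.

Lemma cont_on_sub V V' f : V' `<=` V -> cont_on V f -> cont_on V' f.
Proof.
move=> sV H x Vx e e0; apply: filterS (H x (sV _ Vx) e e0) => y a Vy.
by apply: a; exact: sV.
Qed.

Lemma cont_on_bounded V K f : cont_on V f -> compact K -> K `<=` V ->
  exists2 C : R, 0 <= C & forall x, K x -> nrm (f x) <= C.
Proof.
move=> cf cK KV; pose P (N : nat) x := V x -> nrm (f x) <= N%:R.
have H : \forall N \near \oo, K `<=` P N.
  apply: (iffLR (compact_near_coveringP _) cK nat \oo P _) => x0 Kx0.
  exists ([set x | V x -> nrm (f x - f x0) < 1], [set N | nrm (f x0) + 1 <= N%:R]).
    by split; [exact: (cf x0 (KV _ Kx0) _ ltr01)|exact: nbhs_infty_ger].
  move=> [x N] /= [cx cN] Vx; apply: le_trans cN.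
  rewrite -(subrK (f x0) (f x)) addrC; apply: le_trans (nrmD _ _) _.
  by rewrite lerD2l; apply/ltW/cx.
have [N HN] := filter_ex H.
by exists N%:R => // x Kx; exact: (HN x Kx (KV _ Kx)).
Qed.

(** * The mean value inequality *)

(** The supremum of the times up to which the estimate holds is such a time; if it
    were less than [h], the local bound at it would carry the estimate further. *)
Lemma loc_lipschitz (g : R -> W) (e h : R) : 0 <= h ->
  (forall t, 0 <= t <= h -> exists2 d, 0 < d &
     forall u, 0 <= u <= h -> `|u - t| < d -> nrm (g u - g t) <= e * `|u - t|) ->
  nrm (g h - g 0) <= e * h.
Proof.
move=> h0 H.
pose A := [set t | 0 <= t <= h /\ nrm (g t - g 0) <= e * t].
have A0 : A 0 by split; [rewrite lexx|rewrite subrr nrm0 mulr0].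
have supA : has_sup A by split; [exists 0|exists h => t [/andP[]]].
have s0 : 0 <= sup A by exact: sup_upper_bound.
have sh : sup A <= h by apply: ge_sup; [exists 0|move=> t [/andP[]]].
have sin : 0 <= sup A <= h by rewrite s0.
have [d d0 dP] := H _ sin.
have As : A (sup A).
  split=> //; have [t At ts] := sup_adherent d0 supA.
  have tles : t <= sup A by exact: sup_upper_bound.
  have tn : `|t - sup A| = sup A - t by rewrite distrC ger0_norm// subr_ge0.
  have : `|t - sup A| < d by rewrite tn; lra.
  move=> /(dP _ At.1); rewrite tn => dt.
  rewrite -(subrK (g t) (g (sup A))) -addrA.
  apply: le_trans (nrmD _ _) _; rewrite nrmBC.
  by have := At.2; move: dt; rewrite mulrBr; lra.
suff <- : sup A = h by exact: As.2.
apply/eqP; rewrite eq_le sh /= leNgt; apply/negP => slt.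
pose u := Num.min h (sup A + d / 2).
have uh : u <= h by rewrite ge_min lexx.
have su : sup A < u by rewrite lt_min slt ltrDl divr_gt0.
have ud : u <= sup A + d / 2 by rewrite ge_min lexx orbT.
have un : `|u - sup A| = u - sup A by rewrite gtr0_norm// subr_gt0.
have u0 : 0 <= u <= h by rewrite uh andbT; apply: le_trans s0 (ltW su).
have Au : A u.
  split=> //; have := dP u u0; rewrite un => /(_ ltac:(lra)) du.
  rewrite -(subrK (g (sup A)) (g u)) -addrA.
  apply: le_trans (nrmD _ _) _.
  by have := As.2; move: du; rewrite mulrBr; lra.
by have := sup_upper_bound supA Au; rewrite leNgt su.
Qed.

(** Apply [loc_lipschitz] to [t |-> f (x + t h e_i) - t h c].  Subtracting [c]
    makes the inequality fit for first-order expansions, and [h] may be negative. *)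
Lemma mvt_ineq V i f x (h e : R) (l : rV -> W) (c : W) :
  (forall t, 0 <= t <= 1 -> V (x + (t * h) *: e_ i)) ->
  (forall y, V y -> has_pd V i f y (l y)) ->
  (forall t, 0 <= t <= 1 -> nrm (l (x + (t * h) *: e_ i) - c) <= e) ->
  nrm (f (x + h *: e_ i) - f x - h%:C%C *: c) <= e * `|h|.
Proof.
move=> HV Hl Hc; apply/ler_addgt0Pr => e' e'0.
have [->|h0] := eqVneq h 0.
  by rewrite shift0 subrr scale0r subr0 nrm0 normr0 mulr0 add0r ltW.
have nh : 0 < `|h| by rewrite normr_gt0.
pose g (t : R) := f (x + (t * h) *: e_ i) - (t * h)%:C%C *: c.
have -> : f (x + h *: e_ i) - f x - h%:C%C *: c = g 1 - g 0.
  by rewrite /g mul1r mul0r shift0 scale0r subr0 addrAC.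
have := @loc_lipschitz g ((e + e' / `|h|) * `|h|) 1 ler01.
have -> : (e + e' / `|h|) * `|h| * 1 = e * `|h| + e'.
  by rewrite mulr1 mulrDl divfK// gt_eqF.
apply => t t01.
have := Hl _ (HV t t01) (e' / `|h|) (divr_gt0 e'0 nh).
move=> /nbhs_ballP[d /= d0 dP].
exists (d / `|h|); first by rewrite divr_gt0.
move=> u u01; rewrite ltr_pdivlMr// => ut.
have := dP ((u - t) * h); rewrite /ball /= sub0r normrN normrM => /(_ ut).
have -> : x + (t * h) *: e_ i + ((u - t) * h) *: e_ i = x + (u * h) *: e_ i.
  by rewrite -addrA -scalerDl -mulrDl [t + _]addrC subrK.
move=> /(_ (HV u u01)) H1.
have -> : g u - g t = (f (x + (u * h) *: e_ i) - f (x + (t * h) *: e_ i) -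
    ((u - t) * h)%:C%C *: l (x + (t * h) *: e_ i)) +
    ((u - t) * h)%:C%C *: (l (x + (t * h) *: e_ i) - c).
  rewrite scalerBr [RHS]addrA subrK /g opprB mulrBl rmorphB /= scalerBl opprB.
  by rewrite [LHS]addrACA [RHS]addrACA; congr (_ + _); exact: addrC.
apply: le_trans (nrmD _ _) _; rewrite nrmZr normrM.
have := Hc t t01; move: H1; set a := nrm _; set b := nrm _ => H1 H2.
have H3 : `|u - t| * `|h| * b <= `|u - t| * `|h| * e by rewrite ler_wpM2l// mulr_ge0.
apply: le_trans (lerD H1 H3) _.
rewrite mulrACA mulVf ?gt_eqF//.
by rewrite mulrDl divfK ?gt_eqF//; lra.
Qed.

End PartialDerivatives.

(** Division by [C + 1] spares the case distinction on [C = 0]. *)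
Lemma divC_gt0 (R : realType) (e C : R) : 0 < e -> 0 <= C -> 0 < e / (C + 1).
Proof. by move=> e0 C0; rewrite divr_gt0// ltr_wpDl. Qed.

Lemma divC_le (R : realType) (e C c : R) : 0 < e -> 0 <= c -> c <= C -> e / (C + 1) * c <= e.
Proof.
move=> e0 c0 cC; have C1 : 0 < C + 1 by rewrite ltr_wpDl// (le_trans c0).
by rewrite mulrAC ler_pdivrMr// ler_pM2l//; lra.
Qed.

(** * Differentiability and the chain rule *)

Section Differentiability.
Variables (R : realType) (n : nat) (W : normedModType R[i]).
Local Notation rV := 'rV[R]_n.
Local Notation e_ i := (delta_mx 0 i : rV).
Implicit Types (V : set rV) (x y z : rV) (i j : 'I_n).

(** The corners of the path from y to z that changes the coordinates one after
    the other. *)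
Definition mixrow (k : nat) y z : rV := \row_j (if (j < k)%N then z 0 j else y 0 j).

Lemma mixrowS (k : 'I_n) y z :
  mixrow k.+1 y z = mixrow k y z + (z 0 k - y 0 k) *: e_ k.
Proof.
apply/rowP => j; rewrite shiftE !mxE ltnS leq_eqVlt.
have [->|jk] := eqVneq j k; first by rewrite eqxx ltnn mulr1 addrC subrK.
by rewrite (negbTE (_ : (j : nat) != k))//= mulr0 addr0.
Qed.

(** The path moves along the axes because only partial derivatives are at hand.
    Each coordinate of its points lies between those of y and z, which keeps it in
    the half-space and in boxes. *)
Definition path_pt (k : 'I_n) (t : R) y z : rV :=
  mixrow k y z + (t * (z 0 k - y 0 k)) *: e_ k.

Lemma path_ptE (k : 'I_n) (t : R) y z j : 0 <= t <= 1 ->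
  exists2 u, 0 <= u <= 1 & path_pt k t y z 0 j = (1 - u) * y 0 j + u * z 0 j.
Proof.
move=> t01; rewrite shiftE mxE; have [->|_] := eqVneq j k.
  by exists t => //; rewrite ltnn mulr1; ring.
rewrite mulr0 addr0.
by case: (j < k)%N; [exists 1 | exists 0]; rewrite ?lexx ?ler01//; ring.
Qed.

Lemma mvt_path V (f : rV -> W) (D : 'I_n -> rV -> W) y z (e : R) (c : 'I_n -> W) :
  (forall k t, 0 <= t <= 1 -> V (path_pt k t y z)) ->
  (forall i x, V x -> has_pd V i f x (D i x)) ->
  (forall k t, 0 <= t <= 1 -> nrm (D k (path_pt k t y z) - c k) <= e) ->
  nrm (f z - f y - \sum_j (z 0 j - y 0 j)%:C%C *: c j) <= e * \sum_j `|z 0 j - y 0 j|.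
Proof.
move=> inV HD Hc.
have E0 : mixrow 0 y z = y by apply/rowP => j; rewrite mxE.
have En : mixrow n y z = z by apply/rowP => j; rewrite mxE ltn_ord.
have -> : f z - f y = \sum_(k < n) (f (mixrow k.+1 y z) - f (mixrow k y z)).
  by rewrite -(big_mkord predT (fun k => f (mixrow k.+1 y z) - f (mixrow k y z)))
     telescope_sumr// E0 En.
rewrite -sumrB; apply: le_trans (nrm_sum _ _ _) _.
rewrite mulr_sumr; apply: ler_sum => k _; rewrite mixrowS.
exact: (mvt_ineq (inV k) (HD k) (Hc k)).
Qed.

(** [mvt_path] with the derivatives at y as the constants; [D] varies little on
    the path, which remains close to y. *)
Lemma C1_diff V (f : rV -> W) (D : 'I_n -> rV -> W) y : relopen V -> V y ->
  (forall i x, V x -> has_pd V i f x (D i x)) -> (forall i, cont_on V (D i)) ->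
  forall e, 0 < e -> \forall z \near y, V z ->
    nrm (f z - f y - \sum_j (z 0 j - y 0 j)%:C%C *: D j y) <=
      e * \sum_j `|z 0 j - y 0 j|.
Proof.
move=> [sV oV] Vy HD cD e e0.
have H1 : \forall z \near y, forall i, V z -> nrm (D i z - D i y) < e.
  apply: (@filter_forall _ _ (fun i z => V z -> nrm (D i z - D i y) < e) (nbhs y)) => i.
  exact: (cD i y Vy e e0).
have [d d0 dP] := iffLR (nbhs_closeP _ _) (filterI H1 (oV y Vy)).
apply/nbhs_closeP; exists d => // z yz Vz.
have cl k t : 0 <= t <= 1 -> close d y (path_pt k t y z).
  move=> t01 j; have [u /andP[u0 u1] ->] := path_ptE k y z j t01.
  rewrite (_ : _ - _ = u * (z 0 j - y 0 j)); last by ring.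
  rewrite normrM ger0_norm//; apply: le_lt_trans (yz j); exact: ler_piMl.
have inV k t : 0 <= t <= 1 -> V (path_pt k t y z).
  move=> t01; apply: (dP _ (cl k t t01)).2 => j j0.
  have [u /andP[u0 u1] ->] := path_ptE k y z j t01.
  by rewrite addr_ge0// mulr_ge0 ?subr_ge0// ?(sV _ Vy)// (sV _ Vz).
apply: (mvt_path inV HD) => k t t01.
by apply/ltW/(dP _ (cl k t t01)).1; exact: inV.
Qed.

(** The expansion [C1_diff] of [f] is composed with those of the coordinates of
    [tau]; [C1] bounds the increment of [tau] and [C2] the gradient of [f]. *)
Lemma chain_pd V V' (f : rV -> W) (D : 'I_n -> rV -> W) (tau : rV -> rV) i x
    (l : 'I_n -> R[i]) :
  V x -> relopen V' -> (forall z, V z -> V' (tau z)) ->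
  (forall i x, V' x -> has_pd V' i f x (D i x)) -> (forall i, cont_on V' (D i)) ->
  (forall j, has_pd V i (fun z => (tau z 0 j)%:C%C : R[i]^o) x (l j)) ->
  has_pd V i (f \o tau) x (\sum_j l j *: D j (tau x)).
Proof.
move=> Vx oV' sub HD cD Ht e e0.
pose C1 := \sum_j (nrm (l j : R[i]^o) + 1); pose C2 := \sum_j nrm (D j (tau x)).
have C10 : 0 <= C1 by apply: sumr_ge0 => j _; rewrite addr_ge0// nrm_ge0.
have C20 : 0 <= C2 by apply: sumr_ge0 => j _; exact: nrm_ge0.
have e2 : 0 < e / 2 by rewrite divr_gt0.
have k1 := divC_gt0 e2 C10; have k2 := divC_gt0 e2 C20.
have N1 : \forall h \near (0 : R), forall j, V (x + h *: e_ i) ->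
    nrm ((tau (x + h *: e_ i) 0 j)%:C%C - (tau x 0 j)%:C%C - h%:C%C *: l j : R[i]^o)
      <= Num.min 1 (e / 2 / (C2 + 1)) * `|h|.
  apply: (@filter_forall _ _ (fun j h => V (x + h *: e_ i) ->
    nrm ((tau (x + h *: e_ i) 0 j)%:C%C - (tau x 0 j)%:C%C - h%:C%C *: l j : R[i]^o)
      <= Num.min 1 (e / 2 / (C2 + 1)) * `|h|) (nbhs (0 : R))) => j.
  by apply: Ht; rewrite lt_min k2 ltr01.
have step h j : V (x + h *: e_ i) ->
   nrm ((tau (x + h *: e_ i) 0 j)%:C%C - (tau x 0 j)%:C%C - h%:C%C *: l j : R[i]^o)
      <= Num.min 1 (e / 2 / (C2 + 1)) * `|h| ->
   `|tau (x + h *: e_ i) 0 j - tau x 0 j| <= (nrm (l j : R[i]^o) + 1) * `|h|.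
  move=> Vh H; rewrite -nrmC rmorphB /=.
  rewrite -(subrK (h%:C%C *: (l j : R[i]^o)) (_ - _)).
  apply: le_trans (nrmD _ _) _; rewrite nrmZr.
  have H' := le_trans H (_ : _ <= 1 * `|h|).
  apply: le_trans (lerD (H' _) (lexx _)) _; last by lra.
  by rewrite ler_wpM2r// ge_min lexx.
have N2 : \forall h \near (0 : R), V (x + h *: e_ i) ->
    nrm (f (tau (x + h *: e_ i)) - f (tau x) -
     \sum_j (tau (x + h *: e_ i) 0 j - tau x 0 j)%:C%C *: D j (tau x)) <=
     e / 2 / (C1 + 1) * \sum_j `|tau (x + h *: e_ i) 0 j - tau x 0 j|.
  have [d d0 dP] := iffLR (nbhs_closeP _ _) (C1_diff oV' (sub _ Vx) HD cD k1).
  have kd : 0 < d / (C1 + 1) by exact: divC_gt0.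
  have N3 : \forall h \near (0 : R), `|h| < d / (C1 + 1).
    by apply/nbhs_ballP; exists (d / (C1 + 1)) => //= h; rewrite /ball /= sub0r normrN.
  near=> h => Vh; apply: dP; last exact: sub.
  have H : forall j, `|tau (x + h *: e_ i) 0 j - tau x 0 j| <= (nrm (l j : R[i]^o) + 1) * `|h|.
    move=> j; apply: step => //; move: Vh j; near: h.
    by apply: filterS N1 => h a b j; apply: a.
  move=> j; apply: le_lt_trans (H j) _.
  apply: (@le_lt_trans _ _ (C1 * `|h|)).
    rewrite ler_wpM2r// /C1 (bigD1 j)//= lerDl; apply: sumr_ge0 => k _.
    by rewrite addr_ge0// nrm_ge0.
  apply: (@le_lt_trans _ _ ((C1 + 1) * `|h|)); first by rewrite ler_wpM2r// lerDl.
  by rewrite mulrC -ltr_pdivlMr ?ltr_wpDl//; near: h.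
near=> h => Vh /=.
have M1 : forall j, nrm ((tau (x + h *: e_ i) 0 j)%:C%C - (tau x 0 j)%:C%C - h%:C%C *: l j : R[i]^o)
      <= Num.min 1 (e / 2 / (C2 + 1)) * `|h|.
  by move=> j; move: Vh; move: j; near: h; exact: N1.
have M2 := step h ^~ Vh.
have M3 : nrm (f (tau (x + h *: e_ i)) - f (tau x) -
     \sum_j (tau (x + h *: e_ i) 0 j - tau x 0 j)%:C%C *: D j (tau x)) <=
     e / 2 / (C1 + 1) * \sum_j `|tau (x + h *: e_ i) 0 j - tau x 0 j|.
  by move: Vh; near: h.
rewrite -(subrK (\sum_j (tau (x + h *: e_ i) 0 j - tau x 0 j)%:C%C *: D j (tau x)) (_ - f _)).
rewrite -addrA; apply: le_trans (nrmD _ _) _.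
have -> : e * `|h| = e / 2 * `|h| + e / 2 * `|h| by lra.
apply: lerD.
  apply: le_trans M3 _.
  have H : \sum_j `|tau (x + h *: e_ i) 0 j - tau x 0 j| <= C1 * `|h|.
    by rewrite mulr_suml; apply: ler_sum => j _; exact: M2.
  apply: le_trans (ler_wpM2l (ltW k1) H) _.
  by rewrite mulrA ler_wpM2r//; apply: divC_le.
rewrite scaler_sumr -sumrB; apply: le_trans (nrm_sum _ _ _) _.
apply: (@le_trans _ _ (\sum_j (e / 2 / (C2 + 1) * `|h|) * nrm (D j (tau x)))).
  apply: ler_sum => j _; rewrite scalerA -scalerBl nrmZ ler_wpM2r ?nrm_ge0//.
  rewrite rmorphB /=; apply: le_trans (M1 j) _.
  by rewrite ler_wpM2r// ge_min lexx orbT.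
rewrite -mulr_sumr -/C2 mulrAC ler_wpM2r//; exact: divC_le.
Unshelve. all: by end_near. Qed.

End Differentiability.

(** * Smooth functions on relatively open sets *)

Section Smooth.
Variables (R : realType) (n : nat).
Local Notation rV := 'rV[R]_n.
Local Notation e_ i := (delta_mx 0 i : rV).
Implicit Types (V : set rV) (x y z : rV) (i j : 'I_n) (s : seq 'I_n).

Section Basics.
Variable W : normedModType R[i].
Implicit Types f g : rV -> W.

Lemma smooth_onP V f : relopen V -> (smooth_on V f <->
  (forall s, cont_on V (ipderiv V s f)) /\
  (forall s i x, V x -> has_pd V i (ipderiv V s f) x (ipderiv V (i :: s) f x))).
Proof.
move=> oV; split=> [H|[H1 H2] s].
  split=> [s|s i x Vx]; first by apply/cont_onP; exact: (H s).1.
  by apply/has_pdP; exact: (H s).2 i x Vx.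
split; first exact/cont_onP.
by move=> i x Vx; apply/cvg_ex; exists (ipderiv V (i :: s) f x); apply/has_pdP; exact: H2.
Qed.

Lemma smooth_on_cont V f s : relopen V -> smooth_on V f -> cont_on V (ipderiv V s f).
Proof. by move=> oV /(smooth_onP f oV)[]. Qed.

Lemma smooth_on_pd V f s i x : relopen V -> smooth_on V f -> V x ->
  has_pd V i (ipderiv V s f) x (ipderiv V (i :: s) f x).
Proof. by move=> oV /(smooth_onP f oV)[_ H]; exact: H. Qed.

Lemma ipderiv_cat V s t f : ipderiv V (s ++ t) f = ipderiv V s (ipderiv V t f).
Proof. by rewrite /ipderiv foldr_cat. Qed.

Lemma smooth_on_ipderiv V f s : smooth_on V f -> smooth_on V (ipderiv V s f).
Proof. by move=> H t; rewrite -ipderiv_cat; exact: H. Qed.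

Lemma ipderiv_local V V' f g s x : relopen V -> relopen V' -> V' `<=` V ->
  (forall y, V' y -> f y = g y) -> V' x -> ipderiv V s f x = ipderiv V' s g x.
Proof.
move=> oV oV' sV fg; elim: s x => [|i s IH] x V'x /=; first exact: fg.
by apply: (pderiv_near i oV oV' (sV _ V'x) V'x); near=> y; exact: IH.
Unshelve. all: by end_near. Qed.

(** A guess for all iterated derivatives is right as soon as it is closed under
    one differentiation step.  The formulas for [ipderiv] are obtained in this way. *)
Lemma smooth_on_family V f (G : seq 'I_n -> rV -> W) : relopen V ->
  (forall x, V x -> G [::] x = f x) -> (forall s, cont_on V (G s)) ->
  (forall s i x, V x -> has_pd V i (G s) x (G (i :: s) x)) ->
  smooth_on V f /\ forall s x, V x -> ipderiv V s f x = G s x.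
Proof.
move=> oV G0 cG pG.
have E s : forall x, V x -> ipderiv V s f x = G s x.
  elim: s => [|i s IH] x Vx /=; first by rewrite G0.
  apply: pderiv_eq => //; apply: has_pd_eq (pG s i x Vx) => // y Vy.
  by rewrite -IH.
split=> //; apply/smooth_onP => //; split=> [s|s i x Vx].
  by apply: cont_on_eq (cG s) => x Vx; rewrite E.
rewrite E//; apply: has_pd_eq (pG s i x Vx) => // y Vy.
by rewrite E.
Qed.

(** Coinduction, for functions whose iterated derivatives have no convenient
    closed form but stay in a known class [S]. *)
Lemma smooth_on_coind V (S : set (rV -> W)) : relopen V ->
  (forall f, S f -> cont_on V f /\ forall i, exists2 g, S g &
     forall x, V x -> has_pd V i f x (g x)) ->
  forall f, S f -> smooth_on V f.
Proof.
move=> oV HS f Sf.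
have E s : exists2 g, S g & forall x, V x -> ipderiv V s f x = g x.
  elim: s => [|i s [g Sg Eg]]; first by exists f.
  have [_ /(_ i)[g' Sg' Eg']] := HS g Sg.
  exists g' => // x Vx /=; apply: pderiv_eq => //.
  by apply: has_pd_eq (Eg' x Vx) => // y Vy; rewrite Eg.
apply/smooth_onP => //; split=> [s|s i x Vx]; have [g Sg Eg] := E s.
  by apply: cont_on_eq (HS g Sg).1 => x Vx; rewrite Eg.
have [_ /(_ i)[g' Sg' Eg']] := HS g Sg.
apply: (has_pd_pderiv oV Vx (l := g' x)).
by apply: has_pd_eq (Eg' x Vx) => // y Vy; rewrite Eg.
Qed.

Lemma smooth_on_eq V f g : relopen V -> (forall x, V x -> f x = g x) ->
  smooth_on V f -> smooth_on V g.
Proof.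
move=> oV fg Hf.
apply: (smooth_on_family (G := fun s => ipderiv V s f) oV _ _ _).1 => //.
- by move=> s; exact: smooth_on_cont.
- by move=> s i x Vx; exact: smooth_on_pd.
Qed.

Lemma smooth_on_sub V V' f : relopen V -> relopen V' -> V' `<=` V ->
  smooth_on V f -> smooth_on V' f.
Proof.
move=> oV oV' sV Hf.
apply: (smooth_on_family (G := fun s => ipderiv V s f) oV' _ _ _).1 => //.
- by move=> s; apply: (cont_on_sub sV); exact: smooth_on_cont.
- by move=> s i x V'x; apply: (has_pd_sub sV); apply: smooth_on_pd => //; exact: sV.
Qed.

Lemma smooth_on_local V f : relopen V ->
  (forall x, V x -> exists V', [/\ relopen V', V' x, V' `<=` V & smooth_on V' f]) ->
  smooth_on V f.
Proof.
move=> oV H; apply/smooth_onP => //; split=> [s|s i x Vx].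
  apply: cont_on_near => // x Vx; have [V' [oV' V'x sV sf]] := H x Vx.
  exists V', (ipderiv V' s f); split=> //; first exact: smooth_on_cont.
  have [_ h] := oV'.
  have h' := relopen_near oV oV' Vx V'x; near=> y => Vy.
  by apply: ipderiv_local => //; apply: (iffLR _ Vy); near: y.
have [V' [oV' V'x sV sf]] := H x Vx.
rewrite (@ipderiv_local V V' f f (i :: s))//.
apply: (has_pd_near oV' oV V'x Vx _ (smooth_on_pd s i oV' sf V'x)).
have h' := relopen_near oV oV' Vx V'x; near=> y => Vy.
by apply/esym/ipderiv_local => //; apply: (iffLR _ Vy); near: y.
Unshelve. all: by end_near. Qed.

Lemma smooth_on_cst V (c : W) : relopen V -> smooth_on V (fun=> c).
Proof.
move=> oV; apply: (@smooth_on_coind V [set f | exists c, f = fun=> c] oV); last by exists c.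
move=> _ [d ->]; split; first exact: cont_on_cst.
by move=> i; exists (fun=> 0) => [|x _]; [exists 0|exact: has_pd_cst].
Qed.

Lemma smooth_onD_ipderiv V f g : relopen V -> smooth_on V f -> smooth_on V g ->
  smooth_on V (fun x => f x + g x) /\ forall s x, V x ->
    ipderiv V s (fun x => f x + g x) x = ipderiv V s f x + ipderiv V s g x.
Proof.
move=> oV Hf Hg.
apply: (smooth_on_family (G := fun s x => ipderiv V s f x + ipderiv V s g x) oV _ _ _) => //.
- by move=> s; apply: cont_onD; exact: smooth_on_cont.
- by move=> s i x Vx; apply: has_pdD; exact: smooth_on_pd.
Qed.

Lemma smooth_onD V f g : relopen V -> smooth_on V f -> smooth_on V g ->
  smooth_on V (fun x => f x + g x).
Proof. by move=> oV Hf Hg; exact: (smooth_onD_ipderiv oV Hf Hg).1. Qed.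

Lemma ipderivD V f g s x : relopen V -> smooth_on V f -> smooth_on V g -> V x ->
  ipderiv V s (fun x => f x + g x) x = ipderiv V s f x + ipderiv V s g x.
Proof. by move=> oV Hf Hg; exact: (smooth_onD_ipderiv oV Hf Hg).2. Qed.

Lemma smooth_onB_ipderiv V f g : relopen V -> smooth_on V f -> smooth_on V g ->
  smooth_on V (fun x => f x - g x) /\ forall s x, V x ->
    ipderiv V s (fun x => f x - g x) x = ipderiv V s f x - ipderiv V s g x.
Proof.
move=> oV Hf Hg.
apply: (smooth_on_family (G := fun s x => ipderiv V s f x - ipderiv V s g x) oV _ _ _) => //.
- move=> s; apply: cont_onD; first exact: smooth_on_cont.
  move=> x Vx e e0; apply: filterS (smooth_on_cont s oV Hg Vx e0) => y a Vy.
  by rewrite -opprD nrmN; exact: a.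
- move=> s i x Vx; apply: has_pdD; first exact: smooth_on_pd.
  by apply: has_pdN; exact: smooth_on_pd.
Qed.

Lemma smooth_onB V f g : relopen V -> smooth_on V f -> smooth_on V g ->
  smooth_on V (fun x => f x - g x).
Proof. by move=> oV Hf Hg; exact: (smooth_onB_ipderiv oV Hf Hg).1. Qed.

Lemma ipderivB V f g s x : relopen V -> smooth_on V f -> smooth_on V g -> V x ->
  ipderiv V s (fun x => f x - g x) x = ipderiv V s f x - ipderiv V s g x.
Proof. by move=> oV Hf Hg; exact: (smooth_onB_ipderiv oV Hf Hg).2. Qed.

Lemma ipderiv0 V s x : relopen V -> V x -> ipderiv V s (fun=> 0 : W) x = 0.
Proof.
move=> oV Vx; have [_ E] := smooth_on_family (V := V) (f := fun=> 0 : W)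
  (G := fun _ _ => 0) oV (fun _ _ => erefl) (fun _ => cont_on_cst _)
  (fun _ i x _ => has_pd_cst V i 0 x).
exact: E.
Qed.

Lemma smooth_on_sum V (I : eqType) (r : seq I) (F : I -> rV -> W) : relopen V ->
  (forall k, k \in r -> smooth_on V (F k)) -> smooth_on V (fun x => \sum_(k <- r) F k x).
Proof.
move=> oV; elim: r => [|k r IH] H.
  under eq_fun do rewrite big_nil; exact: smooth_on_cst.
under eq_fun do rewrite big_cons; apply: smooth_onD => //.
  by apply: H; rewrite mem_head.
by apply: IH => j jr; apply: H; rewrite in_cons jr orbT.
Qed.

Lemma ipderiv_sum V (I : eqType) (r : seq I) (F : I -> rV -> W) s x : relopen V ->
  (forall k, k \in r -> smooth_on V (F k)) -> V x ->
  ipderiv V s (fun x => \sum_(k <- r) F k x) x = \sum_(k <- r) ipderiv V s (F k) x.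
Proof.
move=> oV H Vx; elim: r H => [|k r IH] H.
  by under eq_fun do rewrite big_nil; rewrite big_nil ipderiv0.
under eq_fun do rewrite big_cons.
rewrite big_cons ipderivD//.
- by rewrite IH// => j jr; apply: H; rewrite in_cons jr orbT.
- by apply: H; rewrite mem_head.
- by apply: smooth_on_sum => // j jr; apply: H; rewrite in_cons jr orbT.
Qed.

End Basics.

(** * Bilinear products and the Leibniz formula *)

(** Covers the product of a C*-algebra, the product of complex numbers and scalar
    multiplication, all with bound 1. *)
Record bounded_bilinear (W1 W2 W3 : normedModType R[i]) (B : W1 -> W2 -> W3) : Prop :=
  BoundedBilinear {
  bilDl : forall u u' v, B (u + u') v = B u v + B u' v;
  bilDr : forall u v v', B u (v + v') = B u v + B u v';
  bilZl : forall (a : R[i]) u v, B (a *: u) v = a *: B u v;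
  bilZr : forall (a : R[i]) u v, B u (a *: v) = a *: B u v;
  bil_bound : forall u v, nrm (B u v) <= nrm u * nrm v
}.

(** The index set of the Leibniz formula: one entry for each subset of the
    positions in [s], which replaces binomial coefficients. *)
Fixpoint splits s : seq (seq 'I_n * seq 'I_n) :=
  if s is i :: s' then
    [seq (i :: p.1, p.2) | p <- splits s'] ++ [seq (p.1, i :: p.2) | p <- splits s']
  else [:: ([::], [::])].

Section Bilinear.
Variables (W1 W2 W3 : normedModType R[i]) (B : W1 -> W2 -> W3).
Hypothesis bB : bounded_bilinear B.
Implicit Types (f : rV -> W1) (g : rV -> W2).

Lemma bilBl u u' v : B (u - u') v = B u v - B u' v.
Proof. by rewrite (bilDl bB) -[- u']scaleN1r (bilZl bB) scaleN1r. Qed.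

Lemma bilBr u v v' : B u (v - v') = B u v - B u v'.
Proof. by rewrite (bilDr bB) -[- v']scaleN1r (bilZr bB) scaleN1r. Qed.

Lemma cont_on_bil V f g : cont_on V f -> cont_on V g -> cont_on V (fun x => B (f x) (g x)).
Proof.
move=> cf cg x Vx e e0.
pose C := nrm (g x) + 1 + nrm (f x).
have C0 : 0 <= C by rewrite !addr_ge0 ?nrm_ge0.
have k0 := divC_gt0 e0 C0.
have k1 : 0 < Num.min 1 (e / (C + 1)) by rewrite lt_min k0 ltr01.
near=> y => Vy.
have H1 : nrm (f y - f x) < e / (C + 1) by move: Vy; near: y; exact: cf.
have H2 : nrm (g y - g x) < Num.min 1 (e / (C + 1)) by move: Vy; near: y; exact: cg.
move: H2; rewrite lt_min => /andP[H2 H3].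
have -> : B (f y) (g y) - B (f x) (g x) = B (f y - f x) (g y) + B (f x) (g y - g x).
  by rewrite bilBl bilBr addrA subrK.
have H4 : nrm (g y) <= nrm (g x) + 1.
  by rewrite -(subrK (g x) (g y)) (le_trans (nrmD _ _))// addrC lerD2l ltW.
apply: le_lt_trans (nrmD _ _) _.
have Ha : nrm (B (f y - f x) (g y)) <= e / (C + 1) * (nrm (g x) + 1).
  by apply: le_trans (bil_bound bB _ _) _; apply: ler_pM; rewrite ?nrm_ge0// ltW.
have Hb : nrm (B (f x) (g y - g x)) <= e / (C + 1) * nrm (f x).
  by apply: le_trans (bil_bound bB _ _) _; rewrite mulrC ler_wpM2r ?nrm_ge0// ltW.
apply: le_lt_trans (lerD Ha Hb) _; rewrite -mulrDr -/C.
have C1 : 0 < C + 1 by rewrite ltr_wpDl.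
by rewrite mulrAC (ltr_pdivrMr _ _ C1) ltr_pM2l//; lra.
Unshelve. all: by end_near. Qed.

Lemma has_pd_bil V i f g x l l' : V x -> cont_on V g ->
  has_pd V i f x l -> has_pd V i g x l' ->
  has_pd V i (fun x => B (f x) (g x)) x (B l (g x) + B (f x) l').
Proof.
move=> Vx cg Hf Hg e e0.
pose C := nrm (g x) + 1 + nrm l + nrm (f x).
have C0 : 0 <= C by rewrite !addr_ge0 ?nrm_ge0.
have k0 := divC_gt0 e0 C0.
have k1 : 0 < Num.min 1 (e / (C + 1)) by rewrite lt_min k0 ltr01.
have cgx := near_shift i (cg x Vx _ k1).
near=> h => Vh.
have H1 : nrm (f (x + h *: e_ i) - f x - h%:C%C *: l) <= e / (C + 1) * `|h|.
  by move: Vh; near: h; exact: Hf.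
have H2 : nrm (g (x + h *: e_ i) - g x - h%:C%C *: l') <= e / (C + 1) * `|h|.
  by move: Vh; near: h; exact: Hg.
have H3 : nrm (g (x + h *: e_ i) - g x) < Num.min 1 (e / (C + 1)) by move: Vh; near: h.
set y := x + _ in H1 H2 H3 *.
move: H3; rewrite lt_min => /andP[H3 H3'].
have H4 : nrm (g y) <= nrm (g x) + 1.
  by rewrite -(subrK (g x) (g y)) (le_trans (nrmD _ _))// addrC lerD2l ltW.
have -> : B (f y) (g y) - B (f x) (g x) - h%:C%C *: (B l (g x) + B (f x) l') =
  B (f y - f x - h%:C%C *: l) (g y) + h%:C%C *: B l (g y - g x) +
  B (f x) (g y - g x - h%:C%C *: l').
  rewrite 4!(bilBl, bilBr) !bilBr (bilZl bB) (bilZr bB) scalerBr scalerDr.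
  set a := B (f y) _; set b := B (f x) (g y); set c := B (f x) (g x).
  set p := _ *: B l (g y); set q := _ *: B l (g x); set r := _ *: B (f x) l'.
  rewrite [a - b - p + _]addrA subrK opprD addrA [a - b - q]addrAC.
  by rewrite -[b - c - r]addrA [RHS]addrA subrK [RHS]addrA [a - q - c]addrAC.
apply: le_trans (nrmD _ _) _.
have Ha : nrm (B (f y - f x - h%:C%C *: l) (g y)) <= e / (C + 1) * `|h| * (nrm (g x) + 1).
  by apply: le_trans (bil_bound bB _ _) _; apply: ler_pM; rewrite ?nrm_ge0.
have Hb : nrm (h%:C%C *: B l (g y - g x)) <= e / (C + 1) * `|h| * nrm l.
  rewrite nrmZr [_ * `|h|]mulrC -mulrA ler_wpM2l//.
  by apply: le_trans (bil_bound bB _ _) _; rewrite mulrC ler_wpM2r ?nrm_ge0// ltW.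
have Hc : nrm (B (f x) (g y - g x - h%:C%C *: l')) <= e / (C + 1) * `|h| * nrm (f x).
  by apply: le_trans (bil_bound bB _ _) _; rewrite mulrC ler_wpM2r ?nrm_ge0.
apply: le_trans (lerD (le_trans (nrmD _ _) (lerD Ha Hb)) Hc) _.
rewrite -!mulrDr -/C mulrAC ler_wpM2r//; exact: divC_le.
Unshelve. all: by end_near. Qed.

Lemma leibniz V f g : relopen V -> smooth_on V f -> smooth_on V g ->
  smooth_on V (fun x => B (f x) (g x)) /\ forall s x, V x ->
  ipderiv V s (fun x => B (f x) (g x)) x =
    \sum_(p <- splits s) B (ipderiv V p.1 f x) (ipderiv V p.2 g x).
Proof.
move=> oV Hf Hg.
apply: (smooth_on_family (G := fun s x =>
  \sum_(p <- splits s) B (ipderiv V p.1 f x) (ipderiv V p.2 g x)) oV _ _ _).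
- by move=> x Vx; rewrite big_seq1.
- by move=> s; apply: cont_on_sum => p; apply: cont_on_bil; exact: smooth_on_cont.
- move=> s i x Vx; rewrite big_cat/= !big_map -big_split/=.
  apply: has_pd_sum => p; apply: has_pd_bil => //; try exact: smooth_on_cont.
    exact: smooth_on_pd.
  exact: smooth_on_pd.
Qed.

Lemma smooth_on_bil V f g : relopen V -> smooth_on V f -> smooth_on V g ->
  smooth_on V (fun x => B (f x) (g x)).
Proof. by move=> oV Hf Hg; exact: (leibniz oV Hf Hg).1. Qed.

Lemma pderiv_bil V f g i x : relopen V -> smooth_on V f -> smooth_on V g -> V x ->
  pderiv V i (fun x => B (f x) (g x)) x = B (pderiv V i f x) (g x) + B (f x) (pderiv V i g x).
Proof.
move=> oV Hf Hg Vx; have := (leibniz oV Hf Hg).2 [:: i] x Vx.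
by rewrite /= !big_cons big_nil addr0.
Qed.

End Bilinear.

Lemma scale_bil (W : normedModType R[i]) :
  bounded_bilinear (fun (a : R[i]^o) (v : W) => (a : R[i]) *: v).
Proof.
split=> [u u' v|u v v'|a u v|a u v|u v].
- exact: scalerDl.
- exact: scalerDr.
- by rewrite scalerA.
- by rewrite !scalerA mulrC.
- by rewrite nrmZ.
Qed.

Lemma cmul_bil : bounded_bilinear (fun u v : R[i]^o => u * v : R[i]^o).
Proof. exact: (scale_bil R[i]^o). Qed.

Lemma smooth_onZ (W : normedModType R[i]) V (a : rV -> R[i]^o) (f : rV -> W) :
  relopen V -> smooth_on V a -> smooth_on V f -> smooth_on V (fun x => (a x : R[i]) *: f x).
Proof. exact: (smooth_on_bil (scale_bil W)). Qed.

Lemma smooth_onM V (a b : rV -> R[i]^o) :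
  relopen V -> smooth_on V a -> smooth_on V b -> smooth_on V (fun x => a x * b x : R[i]^o).
Proof. exact: (smooth_on_bil cmul_bil). Qed.

Lemma smooth_onN (W : normedModType R[i]) V (f : rV -> W) :
  relopen V -> smooth_on V f -> smooth_on V (fun x => - f x).
Proof.
move=> oV Hf; under eq_fun do rewrite -scaleN1r.
by apply: (@smooth_onZ _ _ (fun=> -1)) => //; exact: smooth_on_cst.
Qed.

(** * Composition *)

Section Composition.
Variables (V V' : set rV) (tau : rV -> rV).
Hypotheses (oV : relopen V) (oV' : relopen V').
Hypotheses (tauV : forall z, V z -> V' (tau z)).
Hypothesis tau_smooth : forall j, smooth_on V (fun z => (tau z 0 j)%:C%C : R[i]^o).

Let sfun := {v : rV -> R[i]^o | smooth_on V v}.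
Let dsfun (i : 'I_n) (v : sfun) : sfun :=
  exist _ (pderiv V i (sval v)) (smooth_on_ipderiv [:: i] (svalP v)).
Let msfun (i j : 'I_n) (v : sfun) : sfun :=
  exist _ (fun x => sval v x * pderiv V i (fun z => (tau z 0 j)%:C%C : R[i]^o) x : R[i]^o)
    (smooth_onM oV (svalP v) (smooth_on_ipderiv [:: i] (@tau_smooth j))).

(** Each derivative of a composite with [tau] is a sum of terms
    [v * (d^t f o tau)], listed here as pairs [(t, v)].  Differentiating such a term
    differentiates [v] or, by the chain rule, adds one derivation [j] to [t] at the
    price of a factor [d_i tau_j].  The list does not depend on [f], which makes
    estimates uniform in [f] possible; [v] carries its smoothness, as it will be
    differentiated in turn. *)
Fixpoint comp_terms (s : seq 'I_n) : seq (seq 'I_n * sfun) :=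
  if s is i :: s' then
    flatten [seq (p.1, dsfun i p.2) :: [seq (j :: p.1, msfun i j p.2) | j <- index_enum 'I_n]
       | p <- comp_terms s']
  else [:: ([::], exist _ (fun=> 1) (smooth_on_cst _ oV))].

Lemma smooth_on_comp_ipderiv (W : normedModType R[i]) (f : rV -> W) : smooth_on V' f ->
  smooth_on V (f \o tau) /\ forall s x, V x -> ipderiv V s (f \o tau) x =
    \sum_(p <- comp_terms s) (sval p.2 x : R[i]) *: ipderiv V' p.1 f (tau x).
Proof.
move=> Hf.
have pdc s i x : V x -> has_pd V i (ipderiv V' s f \o tau) x
    (\sum_j (pderiv V i (fun z => (tau z 0 j)%:C%C : R[i]^o) x : R[i]) *:
        ipderiv V' (j :: s) f (tau x)).
  move=> Vx; apply: (chain_pd (D := fun j => ipderiv V' (j :: s) f)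
    (l := fun j => pderiv V i (fun z => (tau z 0 j)%:C%C : R[i]^o) x)
    Vx oV' tauV) => [j y V'y|j|j].
  - exact: smooth_on_pd.
  - exact: smooth_on_cont.
  - exact: (smooth_on_pd [::] i oV (tau_smooth j) Vx).
have cc s : cont_on V (ipderiv V' s f \o tau).
  move=> x Vx e e0.
  have [d d0 dP] := iffLR (nbhs_closeP _ _) (smooth_on_cont s oV' Hf (tauV Vx) e0).
  have N : \forall y \near x, forall j, V y -> `|tau y 0 j - tau x 0 j| < d.
    apply: (@filter_forall _ _ (fun j y => V y -> `|tau y 0 j - tau x 0 j| < d) (nbhs x)) => j.
    have := smooth_on_cont [::] oV (tau_smooth j) Vx d0; apply: filterS => y a Vy.
    by have := a Vy; rewrite /= -rmorphB /= nrmC.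
  near=> y => Vy; apply: dP (tauV Vy) => j; move: Vy; move: j; near: y; exact: N.
apply: (smooth_on_family (G := fun s x =>
   \sum_(p <- comp_terms s) (sval p.2 x : R[i]) *: ipderiv V' p.1 f (tau x)) oV _ _ _).
- by move=> x Vx; rewrite big_seq1 /= scale1r.
- move=> s; apply: cont_on_sum => -[t [v Hv]] /=.
  apply: (cont_on_bil (scale_bil W)); [exact: (smooth_on_cont [::])|exact: cc].
move=> s i x Vx; rewrite /= big_flatten /= big_map.
apply: has_pd_sum => -[t [v Hv]]; rewrite big_cons big_map /=.
have := has_pd_bil (scale_bil W) Vx (cc t) (smooth_on_pd [::] i oV Hv Vx) (pdc t i x Vx).
rewrite /= scaler_sumr; under [X in _ + X]eq_bigr do rewrite scalerA.
by [].
Unshelve. all: by end_near. Qed.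

Lemma smooth_on_comp (W : normedModType R[i]) (f : rV -> W) :
  smooth_on V' f -> smooth_on V (f \o tau).
Proof. by move=> Hf; exact: (smooth_on_comp_ipderiv Hf).1. Qed.

Lemma pderiv_comp (W : normedModType R[i]) (f : rV -> W) i x : smooth_on V' f -> V x ->
  pderiv V i (f \o tau) x = \sum_j
    (pderiv V i (fun z => (tau z 0 j)%:C%C : R[i]^o) x : R[i]) *: pderiv V' j f (tau x).
Proof.
move=> Hf Vx; apply: pderiv_eq => //; apply: (chain_pd (D := fun j => pderiv V' j f)
    (l := fun j => pderiv V i (fun z => (tau z 0 j)%:C%C : R[i]^o) x)
    Vx oV' tauV) => [j y V'y|j|j].
- exact: (smooth_on_pd [::]).
- exact: (smooth_on_cont [:: j]).
- exact: (smooth_on_pd [::] i oV (tau_smooth j) Vx).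
Qed.

End Composition.

End Smooth.

(** * Plateau functions *)

Section OneVariable.
Variable R : realType.
Implicit Types (g : R -> R) (t d : R).

Definition der1 g t d := forall e, 0 < e ->
  \forall h \near (0 : R), `|g (t + h) - g t - h * d| <= e * `|h|.

Lemma der1_is_derive g t d : is_derive t 1 g d -> der1 g t d.
Proof.
case=> dg <- e e0; have /cvgrPdist_le/(_ e e0) H := dg.
have {}H : \forall h \near (0 : R), h != 0 ->
  `|'D_1 g t - h^-1 *: (g (h *: 1 + t) - g t)| <= e by exact: H.
near=> h; have [->|h0] := eqVneq h 0.
  by rewrite addr0 subrr mul0r subr0 !normr0 mulr0.
rewrite -ler_pdivrMr ?normr_gt0// mulrC -normfV -normrM.
have -> : h^-1 * (g (t + h) - g t - h * 'D_1 g t) =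
   - ('D_1 g t - h^-1 *: (g (h *: 1 + t) - g t)).
  have -> : h *: 1 + t = t + h by rewrite [h *: _]mulr1 addrC.
  by rewrite opprB mulrBr [h^-1 * (h * _)]mulrA mulVf// mul1r.
by rewrite normrN; move: h0; near: h.
Unshelve. all: by end_near. Qed.

Lemma der1_near g g' t d : (\forall u \near t, g u = g' u) -> der1 g t d -> der1 g' t d.
Proof.
move=> gg' H e e0.
have g0 : g t = g' t by exact: nbhs_singleton gg'.
have gg2 : \forall h \near (0 : R), g (t + h) = g' (t + h).
  have [r /= r0 rP] := iffLR (nbhs_ballP _ _) gg'.
  apply/nbhs_ballP; exists r => //= h; rewrite /ball /= sub0r normrN => hr.
  by apply: rP; rewrite /ball /= opprD addrA subrr sub0r normrN.
near=> h; rewrite -g0 -(_ : g (t + h) = g' (t + h)); last by near: h.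
by near: h; exact: H.
Unshelve. all: by end_near. Qed.

End OneVariable.

Section CompOne.
Variables (R : realType) (n : nat).
Local Notation rV := 'rV[R]_n.
Local Notation e_ i := (delta_mx 0 i : rV).
Implicit Types (V : set rV) (u : rV -> R).

Lemma cont_on_comp1 V u (g : R -> R) :
  (forall t, exists d, der1 g t d) ->
  cont_on V (fun x => (u x)%:C%C : R[i]^o) -> cont_on V (fun x => (g (u x))%:C%C : R[i]^o).
Proof.
move=> dg cu x Vx e e0; have [d gd] := dg (u x).
have [r /= r0 rP] := iffLR (nbhs_ballP _ _) (gd 1 ltr01).
have k1 : 0 < Num.min r (e / (`|d| + 1 + 1)) by rewrite lt_min r0 divr_gt0.
apply: filterS (cu x Vx _ k1) => y a Vy; have := a Vy.
rewrite -!rmorphB /= !nrmC lt_min => /andP[yr ye].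
have := rP (u y - u x); rewrite /ball /= sub0r normrN => /(_ yr).
rewrite [u x + _]addrC subrK mul1r => H.
rewrite -(subrK ((u y - u x) * d) (g (u y) - _)).
apply: le_lt_trans (ler_normD _ _) _.
apply: le_lt_trans (lerD H (lexx _)) _.
rewrite normrM; apply: (@le_lt_trans _ _ ((`|d| + 1 + 1) * `|u y - u x|)).
  by have := normr_ge0 (u y - u x); lra.
by rewrite mulrC -ltr_pdivlMr.
Qed.

Lemma has_pd_comp1 V i u (g : R -> R) x d (l : R[i]^o) :
  der1 g (u x) d -> has_pd V i (fun x => (u x)%:C%C : R[i]^o) x l ->
  has_pd V i (fun x => (g (u x))%:C%C : R[i]^o) x (d%:C%C * l).
Proof.
move=> gd ul e e0.
pose C := nrm l + 1 + `|d|.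
have C0 : 0 <= C by rewrite !addr_ge0 ?nrm_ge0.
have k0 := divC_gt0 e0 C0.
have [r /= r0 rP] := iffLR (nbhs_ballP _ _) (gd _ k0).
have k1 : 0 < Num.min 1 (e / (C + 1)) by rewrite lt_min k0 ltr01.
have kr : 0 < r / (nrm l + 1) by rewrite divr_gt0// ltr_wpDl ?nrm_ge0.
have N3 : \forall h \near (0 : R), `|h| < r / (nrm l + 1).
  by apply/nbhs_ballP; exists (r / (nrm l + 1)) => //= h; rewrite /ball /= sub0r normrN.
near=> h => Vh.
have H1 : nrm ((u (x + h *: e_ i))%:C%C - (u x)%:C%C - h%:C%C *: l : R[i]^o) <=
   Num.min 1 (e / (C + 1)) * `|h| by move: Vh; near: h; exact: ul.
have hr : `|h| < r / (nrm l + 1) by near: h.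
set y := x + _ in H1 *.
have H2 : nrm ((u y)%:C%C - (u x)%:C%C - h%:C%C *: l : R[i]^o) <= e / (C + 1) * `|h|.
  by apply: le_trans H1 _; rewrite ler_wpM2r// ge_min lexx orbT.
have H3 : nrm ((u y)%:C%C - (u x)%:C%C - h%:C%C *: l : R[i]^o) <= `|h|.
  by apply: le_trans H1 _; rewrite -[X in _ <= X]mul1r ler_wpM2r// ge_min lexx.
have H4 : `|u y - u x| <= (nrm l + 1) * `|h|.
  rewrite -nrmC rmorphB /= -(subrK (h%:C%C *: l) ((u y)%:C%C - _ : R[i]^o)).
  by apply: le_trans (nrmD _ _) _; rewrite nrmZr; move: H3; lra.
have := rP (u y - u x); rewrite /ball /= sub0r normrN => /(_ _).
rewrite [u x + _]addrC subrK => H5.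
have {}H5 : `|g (u y) - g (u x) - (u y - u x) * d| <= e / (C + 1) * ((nrm l + 1) * `|h|).
  apply: le_trans (H5 _) _.
    by apply: le_lt_trans H4 _; rewrite mulrC -ltr_pdivlMr ?ltr_wpDl ?nrm_ge0.
  by rewrite ler_wpM2l// ltW.
have -> : (g (u y))%:C%C - (g (u x))%:C%C - h%:C%C *: (d%:C%C * l : R[i]^o) =
  (g (u y) - g (u x) - (u y - u x) * d)%:C%C +
  d%:C%C *: ((u y)%:C%C - (u x)%:C%C - h%:C%C *: l) :> R[i]^o.
  rewrite !rmorphB rmorphM rmorphB /= /GRing.scale /=; ring.
apply: le_trans (nrmD _ _) _; rewrite nrmC nrmZr.
have H6 := ler_wpM2l (normr_ge0 d) H2.
apply: le_trans (lerD H5 H6) _.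
have -> : e / (C + 1) * ((nrm l + 1) * `|h|) + `|d| * (e / (C + 1) * `|h|) =
   e / (C + 1) * C * `|h| by rewrite /C; ring.
by rewrite ler_wpM2r//; exact: divC_le.
Unshelve. all: by end_near. Qed.

(** The derivatives of [g o u] are sums of products [(g' o u) v] with [g'] a
    derivative of [g] and [v] smooth; this class is closed under differentiation. *)
Inductive comp1_class (G : set (R -> R)) V u : set (rV -> R[i]^o) :=
| Comp1Base g (v : rV -> R[i]^o) : G g -> smooth_on V v ->
    comp1_class G V u (fun x => (g (u x))%:C%C * v x : R[i]^o)
| Comp1Add f1 f2 : comp1_class G V u f1 -> comp1_class G V u f2 ->
    comp1_class G V u (fun x => f1 x + f2 x).

Lemma smooth_on_comp1 (G : set (R -> R)) V u g : relopen V ->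
  (forall g, G g -> exists2 g', G g' & forall t, der1 g t (g' t)) ->
  G g -> smooth_on V (fun x => (u x)%:C%C : R[i]^o) ->
  smooth_on V (fun x => (g (u x))%:C%C : R[i]^o).
Proof.
move=> oV HG Gg su.
have H : smooth_on V (fun x => (g (u x))%:C%C * (fun=> 1) x : R[i]^o).
  apply: (smooth_on_coind oV (S := comp1_class G V u)); last first.
    exact: (@Comp1Base G V u g (fun=> 1) Gg (smooth_on_cst _ oV)).
  move=> f; elim=> {f} [h v Gh sv|f1 f2 _ [c1 p1] _ [c2 p2]].
    have [h' Gh' hh'] := HG h Gh.
    have cu := smooth_on_cont [::] oV su.
    have ch : cont_on V (fun x => (h (u x))%:C%C : R[i]^o).
      by apply: cont_on_comp1 cu => t; exists (h' t).
    split; first by apply: (cont_on_bil (cmul_bil R) ch); exact: (smooth_on_cont [::]).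
    move=> i; exists (fun x => (h' (u x))%:C%C * (pderiv V i (fun x => (u x)%:C%C : R[i]^o) x * v x)
       + (h (u x))%:C%C * pderiv V i v x).
      have s1 := smooth_onM oV (smooth_on_ipderiv [:: i] su) sv.
      exact: Comp1Add (Comp1Base u Gh' s1) (Comp1Base u Gh (smooth_on_ipderiv [:: i] sv)).
    move=> x Vx; rewrite mulrA; apply: (has_pd_bil (cmul_bil R)) => //.
    - exact: (smooth_on_cont [::]).
    - by apply: has_pd_comp1 => //; exact: (smooth_on_pd [::] i oV su Vx).
    - exact: (smooth_on_pd [::] i oV sv Vx).
  split; first exact: cont_onD.
  move=> i; have [g1 S1 P1] := p1 i; have [g2 S2 P2] := p2 i.
  exists (fun x => g1 x + g2 x); first exact: Comp1Add.
  by move=> x Vx; apply: has_pdD; [exact: P1|exact: P2].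
by apply: smooth_on_eq H => // x _; rewrite mulr1.
Qed.

Lemma pd_coord V i j x : has_pd V i (fun x => (x 0 j)%:C%C : R[i]^o) x (j == i)%:R.
Proof.
move=> e e0; near=> h => _; rewrite shiftE rmorphD /= [_ + (h * _)%:C%C]addrC addrK.
rewrite rmorphM rmorph_nat /= subrr nrm0 mulr_ge0// ltW//.
Unshelve. all: by end_near. Qed.

Lemma smooth_coord V j : relopen V -> smooth_on V (fun x => (x 0 j)%:C%C : R[i]^o).
Proof.
move=> oV; apply: (smooth_on_coind oV (S := [set f : rV -> R[i]^o |
  f = (fun x => (x 0 j)%:C%C) \/ exists c, f = fun=> c])); last by left.
move=> f [->|[c ->]].
  split; last by move=> i; exists (fun=> (j == i)%:R) => [|x _]; [right; eexists|exact: pd_coord].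
  move=> x Vx e e0; apply/nbhs_closeP; exists e => // y yx _.
  by rewrite -rmorphB /= nrmC.
split; first exact: cont_on_cst.
by move=> i; exists (fun=> 0) => [|x _]; [right; exists 0|exact: has_pd_cst].
Qed.

Lemma pderiv_coord V i j x : relopen V -> V x ->
  pderiv V i (fun x => (x 0 j)%:C%C : R[i]^o) x = (j == i)%:R.
Proof. by move=> oV Vx; apply: pderiv_eq => //; exact: pd_coord. Qed.

End CompOne.

Section Flat.
Variable R : realType.
Implicit Types (P : {poly R}) (t : R).

(** The derivatives of exp(-1/t), extended by 0 to t <= 0, all have the form
    P(1/t) exp(-1/t). *)
Definition flat P t : R := if 0 < t then P.[t^-1] * expR (- t^-1) else 0.

(** For [y >= 1], [P y] is at most [C y^k] with [k] the size of [P], while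
    [expR y >= y^(k+1) / (k+1)!]. *)
Lemma poly_expR_decay P (e : R) : 0 < e ->
  exists2 y0, 1 <= y0 & forall y, y0 <= y -> `|P.[y] * expR (- y)| <= e.
Proof.
move=> e0.
pose C := \sum_(i < size P) `|P`_i|; pose k := size P.
have C0 : 0 <= C by apply: sumr_ge0.
pose D := C * (k.+1)`!%:R.
have D0 : 0 <= D by rewrite mulr_ge0.
exists (1 + D / e); first by rewrite lerDl divr_ge0// ltW.
move=> y hy; have y1 : 1 <= y by apply: le_trans hy; rewrite lerDl divr_ge0// ltW.
have y0 : 0 < y by apply: lt_le_trans y1.
have yD : D <= e * y.
  rewrite mulrC -ler_pdivrMr//; apply: le_trans hy; rewrite lerDr//.
have HP : `|P.[y]| <= C * y ^+ k.
  rewrite horner_coef mulr_suml; apply: le_trans (ler_norm_sum _ _ _) _.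
  apply: ler_sum => i _; rewrite normrM (ger0_norm (exprn_ge0 _ (ltW y0))) ler_wpM2l//.
  by apply: ler_weXn2l => //; rewrite ltnW.
have HE : y ^+ k.+1 <= (k.+1)`!%:R * expR y.
  rewrite mulrC -ler_pdivrMr ?ltr0n ?fact_gt0//.
  by apply: le_trans (expR_ge1Dxn k (ltW y0)); rewrite lerDr.
rewrite normrM [X in _ * X]ger0_norm ?expR_ge0// expRN ler_pdivrMr ?expR_gt0//.
apply: le_trans HP _; rewrite -(@ler_pM2r _ y)// -mulrA -exprSr.
apply: le_trans (ler_wpM2l C0 HE) _; rewrite mulrA -/D.
by have := ler_wpM2r (expR_ge0 y) yD; lra.
Qed.

Lemma der1_flat P t : der1 (flat P) t (flat ((P - P^`()) * 'X^2) t).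
Proof.
have [t0|t0|<-] := ltgtP 0 t.
- apply: (@der1_near _ (fun t => P.[t^-1] * expR (- t^-1))).
    have : \forall u \near t, 0 < u by exact: lt_nbhsr.
    by apply: filterS => u u0; rewrite /flat u0.
  apply: der1_is_derive; rewrite /flat t0.
  have tn : t != 0 by rewrite gt_eqF.
  have dV : is_derive t 1 (fun y : R => y^-1) (- t ^- 2).
    have := @is_deriveV R id t 1 1 tn (is_derive_id _ _).
    by rewrite [_ *: 1]mulr1.
  have dP : is_derive t 1 (fun y : R => P.[y^-1]) (P^`().[t^-1] * - t ^- 2).
    exact: (@is_derive1_comp _ (horner P) (fun y => y^-1)).
  have dE : is_derive t 1 (fun y : R => expR (- y^-1)) (expR (- t^-1) * - - t ^- 2).
    exact: (@is_derive1_comp _ expR (fun y => - y^-1) _ _ _ (is_derive_expR _) (is_deriveN dV)).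
  apply: (is_derive_eq (@is_deriveM _ _ (fun y : R => P.[y^-1]) (fun y => expR (- y^-1)) _ _ _ _ dP dE)).
  change (P.[t^-1] * (expR (- t^-1) * - - t ^- 2) + expR (- t^-1) * (P^`().[t^-1] * - t ^- 2)
    = ((P - P^`()) * 'X^2).[t^-1] * expR (- t^-1)).
  by rewrite hornerM hornerXn hornerD hornerN -exprVn; ring.
- apply: (@der1_near _ (fun=> 0)).
    have : \forall u \near t, u < 0 by exact: lt_nbhsl.
    by apply: filterS => u u0; rewrite /flat ltNge (ltW u0).
  rewrite /flat ltNge (ltW t0) /= => e e0; near=> h.
  by rewrite mulr0 !subrr normr0 mulr_ge0// ltW.
- rewrite /flat ltxx => e e0.
  have [y0 y01 yP] := poly_expR_decay ('X * P) e0.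
  have y0p : 0 < y0 by apply: lt_le_trans y01.
  apply/nbhs_ballP; exists y0^-1; first by rewrite /= invr_gt0.
  move=> h; rewrite /ball /= sub0r normrN add0r ltxx mulr0 !subr0 => hy.
  case: ifPn => h0; last by rewrite normr0 mulr_ge0// ltW.
  rewrite gtr0_norm// in hy.
  have := yP h^-1; rewrite -[y0 <= _]lef_pV2 ?posrE ?invr_gt0// invrK => /(_ (ltW hy)).
  rewrite !hornerE -mulrA normrM => H.
  by rewrite -ler_pdivrMr ?normr_gt0 ?gt_eqF// mulrC -normfV.
Unshelve. all: by end_near. Qed.

Lemma flat_class (g : R -> R) : range flat g ->
  exists2 g', range flat g' & forall t, der1 g t (g' t).
Proof.
case=> P _ <-; exists (flat ((P - P^`()) * 'X^2)); first by exists ((P - P^`()) * 'X^2).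
exact: der1_flat.
Qed.

Lemma flat1_gt0 t : 0 < t -> 0 < flat 1 t.
Proof. by move=> t0; rewrite /flat t0 hornerC mul1r expR_gt0. Qed.

Lemma flat_le0 P t : t <= 0 -> flat P t = 0.
Proof. by rewrite /flat ltNge => ->. Qed.

Lemma flat1_mono s t : s <= t -> flat 1 s <= flat 1 t.
Proof.
move=> st; have [s0|s0] := leP s 0.
  rewrite flat_le0//; have [t0|t0] := leP t 0; first by rewrite flat_le0.
  exact/ltW/flat1_gt0.
have t0 := lt_le_trans s0 st.
by rewrite /flat s0 t0 !hornerC !mul1r ler_expR lerN2 lef_pV2.
Qed.

End Flat.

Section Bump.
Variables (R : realType) (n : nat).
Local Notation rV := 'rV[R]_n.

Lemma smooth_on_flat (V : set rV) (u : rV -> R) P : relopen V ->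
  smooth_on V (fun x => (u x)%:C%C : R[i]^o) ->
  smooth_on V (fun x => (flat P (u x))%:C%C : R[i]^o).
Proof.
by move=> oV; apply: (smooth_on_comp1 (G := range (@flat R)) oV (@flat_class R)); exists P.
Qed.

(** The inner function [flat 1 (u x)] is positive on a ball around [p] only and is
    at least [k] near [p].  There [k] minus it is not positive, so that the outer
    flat function vanishes and the value is exactly 1; off the ball the outer
    function takes its value at [k], which is the normalising constant. *)
Lemma bump_exists (p : rV) (d : R) : 0 < d ->
  exists phi : rV -> R,
    [/\ forall V, relopen V -> smooth_on V (fun x => (phi x)%:C%C : R[i]^o),
        exists2 d', 0 < d' & forall x, close d' p x -> phi x = 1 &
        forall x, phi x != 0 -> close d p x].
Proof.
move=> d0.
pose q (x : rV) := \sum_j (x 0 j - p 0 j) ^+ 2.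
pose u (x : rV) := d ^+ 2 - q x.
pose k := flat 1 (d ^+ 2 / 2).
have k0 : 0 < k by apply: flat1_gt0; rewrite divr_gt0// exprn_gt0.
exists (fun x => 1 - flat 1 (k - flat 1 (u x)) / flat 1 k); split.
- move=> V oV.
  have su : smooth_on V (fun x => (u x)%:C%C : R[i]^o).
    rewrite /u; under eq_fun do rewrite rmorphB /=.
    apply: smooth_onD => //; first exact: smooth_on_cst.
    apply: smooth_onN => //; rewrite /q; under eq_fun do rewrite rmorph_sum /=.
    apply: smooth_on_sum => // j _; under eq_fun do rewrite expr2 rmorphM rmorphB /=.
    by apply: smooth_onM => //; apply: smooth_onD => //;
      [exact: smooth_coord|exact: smooth_on_cst|exact: smooth_coord|exact: smooth_on_cst].
  have s1 (f : rV -> R) (c : R) : smooth_on V (fun x => (f x)%:C%C : R[i]^o) ->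
      smooth_on V (fun x => (c - f x)%:C%C : R[i]^o).
    move=> sf; under eq_fun do rewrite rmorphB /=.
    apply: (smooth_onD oV (smooth_on_cst _ oV)); exact: smooth_onN oV sf.
  apply: (s1 (fun x => flat 1 (k - flat 1 (u x)) / flat 1 k)); under eq_fun do rewrite rmorphM /=.
  apply: (smooth_onM oV _ (smooth_on_cst _ oV)).
  apply: (smooth_on_flat _ oV).
  exact: (s1 (fun x => flat 1 (u x)) k (smooth_on_flat _ oV su)).
(* With this radius q x <= n (d / (n + 1))^2 <= d^2 / 2, so that u x is at least
   the argument d^2 / 2 that defines k. *)
- exists (d / n.+1%:R); first by rewrite divr_gt0.
  move=> x xp; rewrite (@flat_le0 _ _ (k - _)) ?mul0r ?subr0// subr_le0.
  apply: flat1_mono; rewrite /u lerBrDr -lerBrDl.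
  have -> : d ^+ 2 - d ^+ 2 / 2 = d ^+ 2 / 2 by lra.
  apply: (@le_trans _ _ (\sum_(j < n) (d / n.+1%:R) ^+ 2)).
    apply: ler_sum => j _; rewrite -(real_normK (num_real (x 0 j - _))).
    by rewrite ler_sqr ?nnegrE ?divr_ge0// ?ltW//; exact: xp.
  rewrite sumr_const card_ord -[X in X <= _]mulr_natl.
  have N : (0 : R) < n.+1%:R ^+ 2 by rewrite exprn_gt0.
  have -> : n%:R * (d / n.+1%:R) ^+ 2 = d ^+ 2 * (n%:R / n.+1%:R ^+ 2).
    by rewrite exprMn exprVn mulrCA.
  apply: ler_wpM2l; first by rewrite exprn_ge0// ltW.
  rewrite ler_pdivrMr// ler_pdivlMl// -natrX -natrM ler_nat.
  by rewrite mulSn expnS expn1 mulSn; lia.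
- move=> x; apply: contra_neqP => nx.
  have [j jd] : exists j, d <= `|x 0 j - p 0 j|.
    apply: contra_notP nx => H j; rewrite ltNge; apply/negP => h; apply: H.
    by exists j.
  have u0 : u x <= 0.
    rewrite subr_le0 /q (bigD1 j)//= -[X in X <= _]addr0; apply: lerD.
      by rewrite -(real_normK (num_real (x 0 j - _))) ler_sqr ?nnegrE// ltW.
    by apply: sumr_ge0 => i _; rewrite sqr_ge0.
  by rewrite (flat_le0 _ u0) subr0 divff ?subrr// gt_eqF// flat1_gt0.
Qed.

End Bump.

(** * Symmetry of second derivatives *)

Section Schwarz.
Variables (R : realType) (n : nat) (W : normedModType R[i]).
Local Notation rV := 'rV[R]_n.
Local Notation e_ i := (delta_mx 0 i : rV).
Implicit Types (V : set rV) (x y z : rV) (i j : 'I_n) (f g : rV -> W).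

Lemma nrm_sub_sub (u y z : W) (a b : R) :
  nrm (u - y) <= a -> nrm (u - z) <= b -> nrm (y - z) <= a + b.
Proof.
move=> ha hb; rewrite -(subrK u y) -addrA.
by apply: le_trans (nrmD _ _) _; apply: lerD => //; rewrite nrmBC.
Qed.

Lemma has_pd_translate V i f y w l : has_pd V i f (y + w) l ->
  has_pd [set z | V (z + w)] i (fun z => f (z + w)) y l.
Proof.
by move=> H e e0; apply: filterS (H e e0) => h a; rewrite /= addrAC; exact: a.
Qed.

(** The mean value inequality, first for [d_i f] in direction j, then for
    [y |-> f (y + k e_j) - f y] in direction i.  Steps are nonnegative in order to
    stay in the half-space. *)
Lemma mixed_difference V f i j x (e : R) : relopen V -> smooth_on V f -> V x -> 0 < e ->
  exists2 d, 0 < d & forall h k, 0 <= h < d -> 0 <= k < d ->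
    nrm (f (x + h *: e_ i + k *: e_ j) - f (x + h *: e_ i) - (f (x + k *: e_ j) - f x)
         - (h * k)%:C%C *: ipderiv V [:: j; i] f x) <= e * k * h.
Proof.
move=> oV sf Vx e0.
have cb := smooth_on_cont [:: j; i] oV sf Vx e0.
have [d d0 dP] := iffLR (nbhs_closeP _ _) (filterI cb (oV.2 x Vx)).
have d2 : 0 < d / 2 by rewrite divr_gt0.
exists (d / 2) => // h k /andP[h0 hd] /andP[k0 kd].
have inV s t : 0 <= s <= h -> 0 <= t <= k ->
    V (x + s *: e_ i + t *: e_ j) /\
    nrm (ipderiv V [:: j; i] f (x + s *: e_ i + t *: e_ j) - ipderiv V [:: j; i] f x) <= e.
  move=> /andP[s0 sh] /andP[t0 tk].
  have cl : close d x (x + s *: e_ i + t *: e_ j).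
    move=> q; rewrite !shiftE -[x 0 q + _ + _]addrA [_ - x 0 q]addrC addKr.
    apply: le_lt_trans (ler_normD _ _) _; rewrite !normrM !normr_nat.
    have a1 : `|s| * (q == i)%:R <= `|s| by rewrite ler_piMr//; case: (q == i).
    have a2 : `|t| * (q == j)%:R <= `|t| by rewrite ler_piMr//; case: (q == j).
    by move: a1 a2; rewrite (ger0_norm s0) (ger0_norm t0); lra.
  have Vy : V (x + s *: e_ i + t *: e_ j).
    by apply: (dP _ cl).2; do 2 (apply: halfspace_shift => //); exact: oV.1.
  by split=> //; apply/ltW; apply: (dP _ cl).1.
pose Vk := V `&` [set z | V (z + k *: e_ j)].
pose a := ipderiv V [:: i] f; pose b := ipderiv V [:: j; i] f.
have st0 s : 0 <= s -> 0 <= (0 : R) <= s by move=> ->; rewrite lexx.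
have sts (s : R) : 0 <= s -> 0 <= s <= s by move=> ->; rewrite lexx.
have tm (t s : R) : 0 <= s -> 0 <= t <= 1 -> 0 <= t * s <= s.
  by move=> s0 /andP[t0 t1]; rewrite mulr_ge0// ler_piMl.
have inner s : 0 <= s <= h ->
   nrm (a (x + s *: e_ i + k *: e_ j) - a (x + s *: e_ i) - k%:C%C *: b x) <= e * k.
  move=> sh; rewrite -[X in e * X](ger0_norm k0).
  apply: (@mvt_ineq _ _ _ V j a _ k e b) => [t t01|y Vy|t t01].
  - exact: (inV _ _ sh (tm _ _ k0 t01)).1.
  - exact: smooth_on_pd.
  - exact: (inV _ _ sh (tm _ _ k0 t01)).2.
have := @mvt_ineq _ _ _ Vk i (fun y => f (y + k *: e_ j) - f y) x h (e * k)
  (fun y => a (y + k *: e_ j) - a y) (k%:C%C *: b x).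
rewrite scalerA -rmorphM /= (ger0_norm h0); apply.
- move=> t /(tm _ _ h0) t01; split=> /=; last exact: (inV _ _ t01 (sts _ k0)).1.
  by have := (inV _ _ t01 (st0 _ k0)).1; rewrite shift0.
- move=> y [Vy Vyk]; apply: has_pdD.
    apply: (has_pd_sub (V := [set z | V (z + k *: e_ j)])); first by move=> z [].
    by apply: has_pd_translate; exact: (smooth_on_pd [::]).
  apply: has_pdN; apply: (has_pd_sub (V := V)); first by move=> z [].
  exact: (smooth_on_pd [::]).
- by move=> t /(tm _ _ h0) t01; exact: inner.
Qed.

(** The second difference of [f] with equal steps is symmetric in i and j, and
    [mixed_difference] compares it with either mixed derivative. *)
Lemma schwarz V f i j x : relopen V -> smooth_on V f -> V x ->
  pderiv V i (pderiv V j f) x = pderiv V j (pderiv V i f) x.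
Proof.
move=> oV sf Vx.
apply/eqP; rewrite -subr_eq0; apply/eqP/nrm_eq0/eqP; rewrite eq_le nrm_ge0 andbT.
apply: (@le0_eq0_eps _ _ 2) => e e0.
have K (a b : R) : a * b * b + a * b * b = b * b * (a * 2) by ring.
have [d1 d10 P1] := mixed_difference i j oV sf Vx e0.
have [d2 d20 P2] := mixed_difference j i oV sf Vx e0.
pose h := Num.min d1 d2 / 2.
have m0 : 0 < Num.min d1 d2 by rewrite lt_min d10.
have h0 : 0 < h by rewrite divr_gt0.
have hm : h < Num.min d1 d2 by rewrite /h; lra.
move: hm; rewrite lt_min => /andP[h1 h2].
have /= := P1 h h; rewrite h1 (ltW h0) => /(_ erefl erefl).
have /= := P2 h h; rewrite h2 (ltW h0) => /(_ erefl erefl).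
rewrite [x + h *: e_ j + _]addrAC.
set A := f _; set B := f _; set C := f _; set D := f x => Q2 Q1.
have E : A - C - (B - D) = A - B - (C - D).
  by rewrite !opprB addrACA [RHS]addrACA [- C + _]addrC.
move: Q1; rewrite E => Q1.
have := nrm_sub_sub Q2 Q1; rewrite -scalerBr.
rewrite nrmZr gtr0_norm ?mulr_gt0// => Q.
have hh : 0 < h * h by rewrite mulr_gt0.
by rewrite -(ler_pM2l hh) -K.
Qed.

Lemma ipderiv_rot V f i s x : relopen V -> smooth_on V f -> V x ->
  ipderiv V (i :: s) f x = ipderiv V (s ++ [:: i]) f x.
Proof.
move=> oV sf; elim: s x => [//|j s IH] x Vx.
have -> : ipderiv V (i :: j :: s) f x = pderiv V j (pderiv V i (ipderiv V s f)) x.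
  by rewrite /= schwarz//; exact: smooth_on_ipderiv.
apply: (ipderiv_local [:: j] oV oV (f := ipderiv V (i :: s) f)) => //.
Qed.

(** Moves a derivation [d_i] next to the function, where [approx_poly] knows what
    it does. *)
Lemma ipderiv_mem V i s : relopen V -> i \in s -> exists2 s', perm_eq s (i :: s') &
  forall f x, smooth_on V f -> V x -> ipderiv V s f x = ipderiv V s' (pderiv V i f) x.
Proof.
move=> oV /path.splitPr[s1 s2]; exists (s1 ++ s2).
  by rewrite -cat1s perm_catCA.
move=> f x sf Vx; rewrite ipderiv_cat.
have -> : ipderiv V (s1 ++ s2) (pderiv V i f) = ipderiv V s1 (ipderiv V (s2 ++ [:: i]) f).
  by rewrite !ipderiv_cat.
by apply: (ipderiv_local s1 oV oV) => // y Vy; exact: ipderiv_rot.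
Qed.

End Schwarz.

(** * Approximation by polynomials in one coordinate *)

(** The Bernstein polynomial of degree [N] with coefficients
    [phi 0, ..., phi N], by the recursion of de Casteljau. *)
Fixpoint bern (R : realType) (W : normedModType R[i]) (N : nat) (phi : nat -> W) (t : R) : W :=
  if N is N'.+1 then
    t%:C%C *: bern N' (phi \o S) t + (1 - t)%:C%C *: bern N' phi t
  else phi 0%N.

(** [N t (1 - t) + (N t - q)^2] is the second moment about [q] of the binomial
    distribution, as one sees by conditioning on one trial: it moves [q] to [q - 1]
    with probability [t].  The hypothesis thus passes through the recursion. *)
Lemma bern_bound (R : realType) (W : normedModType R[i]) (N : nat) (phi : nat -> W)
    (c : W) (t q A B : R) : 0 <= t <= 1 ->
  (forall k, (k <= N)%N -> nrm (phi k - c) <= A + B * (k%:R - q) ^+ 2) ->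
  nrm (bern N phi t - c) <= A + B * (N%:R * t * (1 - t) + (N%:R * t - q) ^+ 2).
Proof.
move=> /andP[t0 t1]; have t1' : 0 <= 1 - t by rewrite subr_ge0.
elim: N phi q => [|N IH] phi q H /=.
  by have := H 0%N erefl; rewrite !mulr0n !mul0r !add0r.
have H1 : nrm (bern N (phi \o S) t - c) <= A + B * (N%:R * t * (1 - t) + (N%:R * t - (q - 1)) ^+ 2).
  apply: IH => k kN /=; have := H k.+1 kN.
  by rewrite (_ : (k.+1%:R - q) = (k%:R - (q - 1)))// -natr1; ring.
have H2 : nrm (bern N phi t - c) <= A + B * (N%:R * t * (1 - t) + (N%:R * t - q) ^+ 2).
  by apply: IH => k kN; apply: H; exact: leqW.
have -> : t%:C%C *: bern N (phi \o S) t + (1 - t)%:C%C *: bern N phi t - c =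
  t%:C%C *: (bern N (phi \o S) t - c) + (1 - t)%:C%C *: (bern N phi t - c).
  rewrite !scalerBr addrACA; congr (_ + _); rewrite -opprD -scalerDl -rmorphD /=.
  by rewrite addrC subrK scale1r.
apply: le_trans (nrmD _ _) _; rewrite !nrmZr (ger0_norm t0) (ger0_norm t1').
apply: le_trans (lerD (ler_wpM2l t0 H1) (ler_wpM2l t1' H2)) _.
by rewrite -natr1 le_eqVlt; apply/orP; left; apply/eqP; ring.
Qed.

Section Coordinates.
Variables (R : realType) (n : nat).
Local Notation rV := 'rV[R]_n.
Local Notation e_ i := (delta_mx 0 i : rV).
Implicit Types (x y z : rV) (i j : 'I_n).

Definition upd i (t : R) x : rV := \row_j if j == i then t else x 0 j.

Lemma updE i t x j : upd i t x 0 j = if j == i then t else x 0 j.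
Proof. by rewrite mxE. Qed.

Lemma upd_shift i t x : upd i t x = x + (t - x 0 i) *: e_ i.
Proof.
apply/rowP => j; rewrite shiftE updE; have [->|_] := eqVneq j i.
  by rewrite mulr1 addrC subrK.
by rewrite mulr0 addr0.
Qed.

Variables (V : set rV) (lo hi : 'I_n -> R).
Hypothesis oV : relopen V.
Hypothesis lohi : forall i, lo i < hi i.
Definition box : set rV := [set x | forall i, lo i <= x 0 i <= hi i].
Hypothesis boxV : box `<=` V.
Hypothesis updV : forall i t x, V x -> lo i <= t <= hi i -> V (upd i t x).

Lemma upd_box i t x : box x -> lo i <= t <= hi i -> box (upd i t x).
Proof. by move=> bx bt j; rewrite updE; case: eqP => [->|_]. Qed.

Lemma upd_coord_smooth i t j : smooth_on V (fun z => (upd i t z 0 j)%:C%C : R[i]^o).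
Proof.
under eq_fun do rewrite updE; case: (j == i); first exact: smooth_on_cst.
exact: smooth_coord.
Qed.

Section Update.
Variable W : normedModType R[i].
Implicit Types g : rV -> W.

Lemma smooth_upd i t g : lo i <= t <= hi i -> smooth_on V g -> smooth_on V (g \o upd i t).
Proof.
move=> bt; apply: smooth_on_comp => //; first by move=> z Vz; exact: updV.
exact: upd_coord_smooth.
Qed.

Lemma pderiv_upd i t g j x : lo i <= t <= hi i -> smooth_on V g -> V x ->
  pderiv V j (g \o upd i t) x = if j == i then 0 else pderiv V j g (upd i t x).
Proof.
move=> bt sg Vx.
rewrite (pderiv_comp (V' := V))//; last 2 first.
- by move=> z Vz; exact: updV.
- exact: upd_coord_smooth.
have E k : pderiv V j (fun z => (upd i t z 0 k)%:C%C : R[i]^o) x = if k == i then 0 else (k == j)%:R.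
  under eq_fun do rewrite updE; have [_|_] := eqVneq k i.
    by apply: pderiv_eq => //; exact: has_pd_cst.
  exact: pderiv_coord.
under eq_bigr do rewrite E.
have [->|ji] := eqVneq j i.
  by rewrite big1// => k _; case: eqP; rewrite ?scale0r.
rewrite (bigD1 j)//= eqxx (negbTE ji) scale1r big1 ?addr0// => k kj.
by rewrite (negbTE kj) if_same scale0r.
Qed.

Lemma ipderiv_upd i t g s x : lo i <= t <= hi i -> smooth_on V g -> i \notin s -> V x ->
  ipderiv V s (g \o upd i t) x = ipderiv V s g (upd i t x).
Proof.
move=> bt sg; elim: s x => [//|j s IH] x; rewrite in_cons negb_or => /andP[ij is_] Vx /=.
rewrite (pderiv_near (V' := V) (g := ipderiv V s g \o upd i t) j oV oV Vx Vx).
  by rewrite pderiv_upd 1?eq_sym ?(negbTE ij)//; exact: smooth_on_ipderiv.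
by near=> y; exact: IH.
Unshelve. all: by end_near. Qed.

End Update.

Local Notation C := (R[i]^o).
Implicit Types (f g h A : rV -> C) (T : {set 'I_n}).

(** Vanishing derivatives rather than constancy: this form passes to derivatives
    of [g] by [schwarz], and makes no demand on the shape of [V]. *)
Definition flat_in T g := smooth_on V g /\
  forall j, j \in T -> forall x, V x -> pderiv V j g x = 0.

Lemma pderivD f g j x : smooth_on V f -> smooth_on V g -> V x ->
  pderiv V j (fun x => f x + g x) x = pderiv V j f x + pderiv V j g x.
Proof. by move=> sf sg; exact: (ipderivD [:: j]). Qed.

Lemma pderivM f g j x : smooth_on V f -> smooth_on V g -> V x ->
  pderiv V j (fun x => f x * g x : C) x = pderiv V j f x * g x + f x * pderiv V j g x.
Proof. exact: (pderiv_bil (cmul_bil R) j oV). Qed.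

Lemma pderiv_cst j (c : C) x : V x -> pderiv V j (fun=> c) x = 0.
Proof. by move=> Vx; apply: pderiv_eq => //; exact: has_pd_cst. Qed.

Lemma flat_in_cst T c : flat_in T (fun=> c).
Proof. by split=> [|j _ x Vx]; [exact: smooth_on_cst|exact: pderiv_cst]. Qed.

Lemma flat_inM T f g : flat_in T f -> flat_in T g -> flat_in T (fun x => f x * g x : C).
Proof.
move=> [sf ff] [sg fg]; split=> [|j jT x Vx]; first exact: smooth_onM.
by rewrite pderivM// ff// fg// mul0r mulr0 addr0.
Qed.

Lemma flat_inZ T (a : C) f : flat_in T f -> flat_in T (fun x => a * f x : C).
Proof. exact: (@flat_inM T (fun=> a) f (flat_in_cst T a)). Qed.

Lemma flat_in_pderiv T g i : flat_in T g -> flat_in T (pderiv V i g).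
Proof.
move=> [sg fg]; split=> [|j jT x Vx]; first exact: (smooth_on_ipderiv [:: i]).
rewrite schwarz//; rewrite (pderiv_near (V' := V) (g := fun=> 0) i oV oV Vx Vx).
  exact: pderiv_cst.
by near=> y; exact: fg.
Unshelve. all: by end_near. Qed.

Lemma flat_in_upd T g i t : lo i <= t <= hi i -> flat_in T g ->
  flat_in (i |: T) (g \o upd i t).
Proof.
move=> bt [sg fg]; split=> [|j]; first exact: smooth_upd.
rewrite in_setU1 => jT x Vx; rewrite pderiv_upd//.
by case: eqP jT => //= _ jT; apply: fg => //; exact: updV.
Qed.

(** Measured from the lower face of the box, on which primitives are made to
    vanish. *)
Definition cvar i : rV -> C := fun x => (x 0 i - lo i)%:C%C.

Lemma smooth_cvar i : smooth_on V (cvar i).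
Proof.
rewrite /cvar; under eq_fun do rewrite rmorphB /=.
by apply: smooth_onD => //; [exact: smooth_coord|exact: smooth_on_cst].
Qed.

Lemma pderiv_cvar i j x : V x -> pderiv V j (cvar i) x = (i == j)%:R.
Proof.
move=> Vx; rewrite /cvar; under eq_fun do rewrite rmorphB /=.
rewrite pderivD//; [|exact: smooth_coord|exact: smooth_on_cst].
by rewrite pderiv_cst// addr0 pderiv_coord.
Qed.

Lemma smooth_cvarX i k : smooth_on V (fun x => cvar i x ^+ k : C).
Proof.
elim: k => [|k IH]; first by under eq_fun do rewrite expr0; exact: smooth_on_cst.
by under eq_fun do rewrite exprS; exact: (smooth_onM oV (smooth_cvar i) IH).
Qed.

Lemma pderiv_cvarX i k x : V x ->
  pderiv V i (fun x => cvar i x ^+ k.+1 : C) x = k.+1%:R * cvar i x ^+ k.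
Proof.
move=> Vx; elim: k => [|k IH].
  by under eq_fun do rewrite expr1; rewrite pderiv_cvar// eqxx expr0 mulr1.
under eq_fun do rewrite exprS.
rewrite (pderivM i (smooth_cvar i) (smooth_cvarX i k.+1) Vx).
by rewrite IH pderiv_cvar// eqxx mul1r mulrCA -exprS -[k.+2%:R]natr1 mulrDl mul1r addrC.
Qed.

(** [T] holds the coordinates eliminated so far; the coefficients are free of one
    more, so that induction applies to them. *)
Inductive polyin i T : (rV -> C) -> Prop :=
| PolyNil : polyin i T (fun=> 0)
| PolyCons c k A : flat_in (i |: T) c -> polyin i T A ->
    polyin i T (fun x => c x * cvar i x ^+ k + A x).

Lemma polyin_smooth i T A : polyin i T A -> smooth_on V A.
Proof.
elim=> [|c k {}A [sc _] _ sA]; first exact: smooth_on_cst.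
exact: (smooth_onD oV (smooth_onM oV sc (smooth_cvarX i k)) sA).
Qed.

Lemma polyinD i T A A' : polyin i T A -> polyin i T A' -> polyin i T (fun x => A x + A' x).
Proof.
move=> pA pA'; elim: pA => [|c k {}A fc _ IH].
  by under eq_fun do rewrite add0r.
by under eq_fun do rewrite -addrA; exact: PolyCons.
Qed.

Lemma polyin_cvar i T A : polyin i T A -> polyin i T (fun x => cvar i x * A x).
Proof.
elim=> [|c k {}A fc _ IH]; first by under eq_fun do rewrite mulr0; exact: PolyNil.
by under eq_fun do rewrite mulrDr mulrCA -exprS; exact: PolyCons.
Qed.

Lemma polyinZ i T (a : C) A : polyin i T A -> polyin i T (fun x => a * A x).
Proof.
elim=> [|c k {}A fc _ IH]; first by under eq_fun do rewrite mulr0; exact: PolyNil.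
under eq_fun do rewrite mulrDr mulrA.
apply: (@PolyCons i T (fun x => a * c x) k _ _ IH).
exact: flat_inZ.
Qed.

Lemma polyin_coef i T c : flat_in (i |: T) c -> polyin i T c.
Proof.
move=> fc; have := PolyCons 0 fc (PolyNil i T).
by under eq_fun do rewrite expr0 mulr1 addr0.
Qed.

Lemma polyin_primitive i T A : polyin i T A ->
  exists2 B, polyin i T B & forall x, V x -> pderiv V i B x = A x /\ B (upd i (lo i) x) = 0.
Proof.
elim=> [|c k {}A fc pA [B pB IH]].
  by exists (fun=> 0) => [|x Vx]; [exact: PolyNil|rewrite pderiv_cst].
exists (fun x => k.+1%:R^-1 * c x * cvar i x ^+ k.+1 + B x).
  exact: (@PolyCons i T (fun x => k.+1%:R^-1 * c x) k.+1 _ (flat_inZ _ fc) pB).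
have fc' : flat_in (i |: T) (fun x => k.+1%:R^-1 * c x).
  exact: flat_inZ.
move=> x Vx; have [I1 I2] := IH x Vx; split; last first.
  by rewrite I2 /cvar updE eqxx subrr expr0n /= mulr0 addr0.
rewrite (pderivD (f := fun x => k.+1%:R^-1 * c x * cvar i x ^+ k.+1))//; last 2 first.
- exact: (smooth_onM oV fc'.1 (smooth_cvarX i k.+1)).
- exact: polyin_smooth pB.
rewrite I1 (pderivM i fc'.1 (smooth_cvarX i k.+1) Vx) pderiv_cvarX//.
rewrite (fc'.2 i)// ?in_setU1 ?eqxx// mul0r add0r.
by congr (_ + _); rewrite mulrA [_ * k.+1%:R]mulrC mulrA mulfV ?mul1r// pnatr_eq0.
Qed.

End Coordinates.

Lemma bern_eq (R : realType) (W : normedModType R[i]) (N : nat) (phi psi : nat -> W) (t : R) :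
  (forall k, (k <= N)%N -> phi k = psi k) -> bern N phi t = bern N psi t.
Proof.
elim: N phi psi => [|N IH] phi psi H /=; first exact: H.
by congr (_ *: _ + _ *: _); apply: IH => k kN; apply: H => //; exact: leqW.
Qed.

Section Approximation.
Variables (R : realType) (n : nat).
Local Notation rV := 'rV[R]_n.
Local Notation e_ i := (delta_mx 0 i : rV).
Local Notation C := (R[i]^o).
Variables (V : set rV) (lo hi : 'I_n -> R).
Hypothesis oV : relopen V.
Hypothesis lohi : forall i, lo i < hi i.
Local Notation box := (box lo hi).
Hypothesis boxV : box `<=` V.
Hypothesis updV : forall i t x, V x -> lo i <= t <= hi i -> V (upd i t x).
Local Notation flat_in := (flat_in V).
Local Notation polyin := (polyin V lo).
Implicit Types (x y z : rV) (i j : 'I_n) (f g h A : rV -> C) (T : {set 'I_n}).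

Lemma box_compact : compact box.
Proof.
have := @rV_compact R n (fun i => [set` `[lo i, hi i]]) (fun i => @segment_compact R (lo i) (hi i)).
by congr compact; apply/seteqP; split=> x H i; have := H i; rewrite /= in_itv.
Qed.

Lemma box_uniform h i e : cont_on V h -> 0 < e -> exists2 d, 0 < d &
  forall x t, box x -> lo i <= t <= hi i -> `|t - x 0 i| < d ->
    nrm (h (upd i t x) - h x) < e.
Proof.
move=> ch e0.
pose P (r : R) x := forall y, box x -> box y -> close r x y -> nrm (h y - h x) < e.
have e2 : 0 < e / 2 by rewrite divr_gt0.
have H : \forall r \near (0 : R), box `<=` P r.
  apply: (iffLR (compact_near_coveringP _) box_compact R (nbhs (0 : R)) P _) => x0 bx0.
  have [d d0 dP] := iffLR (nbhs_closeP _ _) (ch x0 (boxV bx0) _ e2).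
  have d2 : 0 < d / 2 by rewrite divr_gt0.
  exists ([set x | close (d / 2) x0 x], [set r | `|r| < d / 2]).
    split; first by apply/nbhs_closeP; exists (d / 2).
    by apply/nbhs_ballP; exists (d / 2) => //= r; rewrite /ball /= sub0r normrN.
  move=> [x r] /= [cx cr] y bx by_ xy.
  have h1 := dP x (fun j => lt_le_trans (cx j) (ltW (_ : d / 2 < d))) (boxV bx).
  have h2 : nrm (h y - h x0) < e / 2.
    apply: dP (boxV by_) => j; rewrite -(subrK (x 0 j) (y 0 j)) -addrA.
    apply: le_lt_trans (ler_normD _ _) _; rewrite (splitr d); apply: ltrD => //.
    by apply: lt_trans (xy j) _; apply: le_lt_trans (ler_norm _) cr.
  rewrite -(subrK (h x0) (h y)) -addrA (splitr e).
  apply: le_lt_trans (nrmD _ _) _; apply: ltrD => //.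
  by rewrite nrmBC; apply: h1; lra.
have [d /= d0 dP] := iffLR (nbhs_ballP _ _) H.
exists (d / 2); first by rewrite divr_gt0.
move=> x t bx bt tx; apply: (dP (d / 2)) => //.
- by rewrite /ball /= sub0r normrN gtr0_norm; lra.
- exact: upd_box.
- move=> j; rewrite updE; case: eqP => [->//|_].
  by rewrite subrr normr0 divr_gt0.
Qed.

Definition node i N k : R := lo i + (hi i - lo i) * (k%:R / N%:R).
Definition tvar i x : R := (x 0 i - lo i) / (hi i - lo i).
Definition bernop i N h x : C := bern N (fun k => h (upd i (node i N k) x)) (tvar i x).

Lemma node_in i N k : (k <= N)%N -> lo i <= node i N k <= hi i.
Proof.
move=> kN; have w0 : 0 < hi i - lo i by rewrite subr_gt0.
have q1 : 0 <= (k%:R / N%:R : R) <= 1.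
  apply/andP; split; first by rewrite divr_ge0// ler0n.
  case: N kN => [|N] kN; first by rewrite invr0 mulr0.
  by rewrite ler_pdivrMr ?ltr0n// mul1r ler_nat.
move/andP: q1 => [q0 q1].
by rewrite /node lerDl (mulr_ge0 (ltW w0) q0) /= -lerBrDl ler_piMr// ltW.
Qed.

(** Nodes at distance less than [d] from [x_i] are dealt with by uniform
    continuity.  At the others, the crude bound 2M is at most a multiple of the
    squared distance, whose average is O(1/N) by [bern_bound]. *)
Lemma bernop_approx h i e : cont_on V h -> 0 < e ->
  \forall N \near \oo, forall x, box x -> nrm (bernop i N h x - h x) <= e.
Proof.
move=> ch e0; have e2 : 0 < e / 2 by rewrite divr_gt0.
have [d d0 dP] := box_uniform i ch e2.
have [M M0 MP] := cont_on_bounded ch box_compact boxV.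
set w := hi i - lo i; have w0 : 0 < w by rewrite subr_gt0.
near=> N => x bx.
have N0 : (0 < N)%N by near: N; exists 1%N.
have NR : (0 : R) < N%:R by rewrite ltr0n.
have NL : 2 * M * (w / d) ^+ 2 / (e / 2) <= N%:R by near: N; exact: nbhs_infty_ger.
have t01 : 0 <= tvar i x <= 1.
  have /andP[b1 b2] := bx i.
  by rewrite /tvar divr_ge0 ?subr_ge0//= ?(ltW (lohi i))// ler_pdivrMr// mul1r lerD2r.
pose B := 2 * M * (w / (d * N%:R)) ^+ 2.
have B0 : 0 <= B by rewrite /B mulr_ge0 ?sqr_ge0// mulr_ge0.
have K k : (k <= N)%N -> nrm (h (upd i (node i N k) x) - h x) <=
     e / 2 + B * (k%:R - N%:R * tvar i x) ^+ 2.
  move=> kN; have nin := node_in i kN.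
  have [cl|far] := ltP `|node i N k - x 0 i| d.
    apply: le_trans (ltW (dP _ _ bx nin cl)) _.
    by rewrite lerDl mulr_ge0// sqr_ge0.
  have E : node i N k - x 0 i = w / N%:R * (k%:R - N%:R * tvar i x).
    rewrite /node /tvar -/w; field; rewrite /w subr_eq0 !gt_eqF ?lohi//=.
  (* The choice of B: far from the node the quadratic term alone reaches 2 M. *)
  have F : 1 <= (w / (d * N%:R)) ^+ 2 * (k%:R - N%:R * tvar i x) ^+ 2.
    rewrite -exprMn -real_normK ?num_real// exprn_ege1//.
    rewrite invfM mulrCA -mulrA -E normrM (gtr0_norm (_ : 0 < d^-1)) ?invr_gt0//.
    by rewrite ler_pdivlMl// mulr1.
  apply: (@le_trans _ _ (2 * M)).
    apply: le_trans (nrmB _ _) _; rewrite mulr2n mulrDl mul1r.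
    by apply: lerD; apply: MP => //; exact: upd_box.
  rewrite -[X in X <= _]addr0 addrC; apply: lerD; first exact: ltW.
  by rewrite /B -mulrA ler_peMr// mulr_ge0.
apply: le_trans (bern_bound t01 K) _.
rewrite subrr expr0n /= addr0 [X in _ <= X](splitr e) lerD2l.
move/andP: t01 => [t0 t1].
apply: (@le_trans _ _ (B * N%:R)).
  rewrite ler_wpM2l// -mulrA ler_piMr ?ler0n// mulr_ile1 ?subr_ge0//.
  by rewrite lerBlDr lerDl.
have -> : B * N%:R = 2 * M * (w / d) ^+ 2 / N%:R.
  by rewrite /B; field; rewrite !gt_eqF.
by rewrite (ler_pdivrMr _ _ NR) [X in _ <= X]mulrC -(ler_pdivrMr _ _ e2).
Unshelve. all: by end_near. Qed.

Lemma tvarE i x : (tvar i x)%:C%C = (hi i - lo i)^-1%:C%C * cvar lo i x :> C.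
Proof. by rewrite /tvar /cvar mulrC rmorphM. Qed.

Lemma bern_polyin i T N (phi : nat -> rV -> C) :
  (forall k, (k <= N)%N -> flat_in (i |: T) (phi k)) ->
  polyin i T (fun x => bern N (phi^~ x) (tvar i x)).
Proof.
elim: N phi => [|N IH] phi H /=; first exact: polyin_coef (H 0%N isT).
have p1 := IH (fun k => phi k.+1) (fun k kN => H k.+1 kN).
have p2 := IH phi (fun k kN => H k (leqW kN)).
set A1 := (fun x => _) in p1; set A2 := (fun x => _) in p2.
have := polyinD (polyinZ oV (hi i - lo i)^-1%:C%C (polyin_cvar p1))
  (polyinD p2 (polyinZ oV (- (hi i - lo i)^-1%:C%C) (polyin_cvar p2))).
congr polyin; apply/funext => x.
rewrite /A1 /A2 rmorphB rmorph1 /= tvarE.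
set a := bern _ _ _; set b := bern _ _ _.
rewrite /GRing.scale /=; ring.
Qed.

Lemma ipderiv_mulr s (a f : rV -> C) x : smooth_on V a -> smooth_on V f ->
  (forall j, j \in s -> forall y, V y -> pderiv V j a y = 0) -> V x ->
  ipderiv V s (fun x => a x * f x : C) x = a x * ipderiv V s f x.
Proof.
move=> sa sf; elim: s x => [//|j s IH] x H Vx /=.
have H' k : k \in s -> forall y, V y -> pderiv V k a y = 0.
  by move=> ks; apply: H; rewrite in_cons ks orbT.
rewrite (pderiv_near (V' := V) (g := fun y => a y * ipderiv V s f y : C) j oV oV Vx Vx).
  rewrite (pderivM oV j sa (smooth_on_ipderiv s sf) Vx).
  by rewrite H ?mem_head// mul0r add0r.
by near=> y; exact: IH.
Unshelve. all: by end_near. Qed.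

Lemma ipderiv_mulc s (c : C) f x : smooth_on V f -> V x ->
  ipderiv V s (fun x => c * f x : C) x = c * ipderiv V s f x.
Proof.
move=> sf Vx; exact: (@ipderiv_mulr s (fun=> c) f x (smooth_on_cst c oV) sf
  (fun j _ y Vy => pderiv_cst oV j c Vy) Vx).
Qed.

(** Derivations transverse to [x_i] pass through the Bernstein operator because
    [tvar i] does not depend on the other coordinates. *)
Lemma ipderiv_bern i T s N (phi : nat -> rV -> C) x : i \notin s ->
  (forall k, (k <= N)%N -> flat_in (i |: T) (phi k)) -> V x ->
  ipderiv V s (fun x => bern N (phi^~ x) (tvar i x)) x =
    bern N (fun k => ipderiv V s (phi k) x) (tvar i x).
Proof.
move=> is_ H Vx; elim: N phi H => [//|N IH] phi H /=.
have H1 k (kN : (k <= N)%N) := H k.+1 kN.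
have H2 k (kN : (k <= N)%N) := H k (leqW kN).
have s1 := polyin_smooth oV (bern_polyin (phi := fun k => phi k.+1) H1).
have s2 := polyin_smooth oV (bern_polyin H2).
have st : smooth_on V (fun x => (tvar i x)%:C%C : C).
  under eq_fun do rewrite tvarE.
  exact: (smooth_onM oV (smooth_on_cst _ oV) (smooth_cvar lo oV i)).
have st' : smooth_on V (fun x => (1 - tvar i x)%:C%C : C).
  under eq_fun do rewrite rmorphB /=.
  exact: smooth_onB oV (smooth_on_cst _ oV) st.
have dt j y : j \in s -> V y -> pderiv V j (fun x => (tvar i x)%:C%C : C) y = 0.
  move=> js Vy; under eq_fun do rewrite tvarE.
  have /= -> := ipderiv_mulc [:: j] (hi i - lo i)^-1%:C%C (smooth_cvar lo oV i) Vy.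
  rewrite pderiv_cvar//.
  by case: eqP js is_ => [->->|]; rewrite ?mulr0.
have dt' j y : j \in s -> V y -> pderiv V j (fun x => (1 - tvar i x)%:C%C : C) y = 0.
  move=> js Vy; under eq_fun do rewrite rmorphB /=.
  have /= -> := ipderivB [:: j] oV (smooth_on_cst (1 : C) oV) st Vy.
  rewrite dt// subr0.
  exact: pderiv_cst.
rewrite (ipderivD s oV (smooth_onM oV st s1) (smooth_onM oV st' s2) Vx).
rewrite (ipderiv_mulr st s1 (fun j js y => dt j y js) Vx).
rewrite (ipderiv_mulr st' s2 (fun j js y => dt' j y js) Vx).
by rewrite (IH _ H2) (IH (fun k => phi k.+1) H1).
Qed.

(** The Bernstein operator commutes with the derivations transverse to [x_i], so
    that it approximates the transverse derivatives along with the function. *)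
Lemma approx_transverse T i g (L : nat) e : flat_in T g -> 0 < e ->
  exists2 A, polyin i T A & forall s, (size s <= L)%N -> i \notin s ->
    forall x, box x -> nrm (ipderiv V s (fun x => g x - A x) x) <= e.
Proof.
move=> fg e0.
have H : \forall N \near \oo, forall s : L.-bseq 'I_n, forall x, box x ->
    nrm (bernop i N (ipderiv V s g) x - ipderiv V s g x) <= e.
  apply: (@filter_forall _ _ (fun (s : L.-bseq 'I_n) N => forall x, box x ->
    nrm (bernop i N (ipderiv V s g) x - ipderiv V s g x) <= e) \oo) => s.
  by apply: bernop_approx => //; apply: smooth_on_cont fg.1.
have [N HN] := filter_ex H.
pose phi k := g \o upd i (node i N k).
have fphi k : (k <= N)%N -> flat_in (i |: T) (phi k).
  by move=> kN; exact: (flat_in_upd oV updV (node_in i kN) fg).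
exists (fun x => bern N (phi^~ x) (tvar i x)); first exact: bern_polyin.
move=> s sL is_ x bx; have Vx := boxV bx.
rewrite (ipderivB s oV fg.1 (polyin_smooth oV (bern_polyin fphi)) Vx).
rewrite (ipderiv_bern is_ fphi Vx).
rewrite nrmBC; suff <- : bernop i N (ipderiv V s g) x =
    bern N (fun k => ipderiv V s (phi k) x) (tvar i x) by exact: (HN (Bseq sL) x bx).
apply: bern_eq => k kN.
by rewrite (ipderiv_upd oV updV (node_in i kN) fg.1 is_ Vx).
Qed.

(** Induction on the number [m] of derivations in direction i under control.
    Approximate [d_i g] with [m - 1] of them and let [A] be the primitive that
    agrees with [g] on the face [x_i = lo i].  If [s] contains i, the claim is the
    one about [d_i g].  If not, the error vanishes on that face, and the mean value
    inequality bounds it across the box. *)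
Lemma approx_poly T i (L m : nat) g e : flat_in T g -> 0 < e ->
  exists2 A, polyin i T A & forall s, (size s <= L)%N -> (count_mem i s <= m)%N ->
    forall x, box x -> nrm (ipderiv V s (fun x => g x - A x) x) <= e.
Proof.
elim: m g e => [|m IH] g e fg e0.
  have [A pA HA] := approx_transverse i L fg e0; exists A => // s sL ci.
  by apply: HA => //; rewrite -has_pred1 has_count -leqNgt.
pose w := hi i - lo i; have w0 : 0 < w by rewrite subr_gt0.
have w1 : 0 <= w + 1 by rewrite addr_ge0// ltW.
have e'0 := divC_gt0 e0 w1; set e' := e / _ in e'0.
have e'e : e' <= e by have := divC_le e0 ler01 (_ : 1 <= w + 1); rewrite mulr1; apply; lra.
have e'w : e' * w <= e by apply: divC_le => //; lra.
have [A' pA' HA'] := IH _ _ (flat_in_pderiv oV i fg) e'0.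
have [B pB HB] := polyin_primitive oV pA'.
have li : lo i <= lo i <= hi i by rewrite lexx ltW.
have fgl := flat_in_upd oV updV li fg.
(* B vanishes on the face x_i = lo i, and so does g - A. *)
pose A x := g (upd i (lo i) x) + B x.
have pA : polyin i T A by apply: polyinD => //; exact: polyin_coef fgl.
have sA := polyin_smooth oV pA.
exists A => // s sL ci.
pose r x := g x - A x.
have sr : smooth_on V r by exact: smooth_onB oV fg.1 sA.
have dr y : V y -> pderiv V i r y = pderiv V i g y - A' y.
  move=> Vy; have /= -> := ipderivB [:: i] oV fg.1 sA Vy; congr (_ - _).
  rewrite (pderivD oV i fgl.1 (polyin_smooth oV pB) Vy) (HB y Vy).1.
  by rewrite (fgl.2 i)// ?add0r// in_setU1 eqxx.
have dr' t y : V y -> ipderiv V t (pderiv V i r) y = ipderiv V t (fun y => pderiv V i g y - A' y) y.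
  by move=> Vy; apply: (ipderiv_local t oV oV).
have [is_|nis] := boolP (i \in s).
  have [s' ps' Hs'] := ipderiv_mem (R[i]^o) oV is_.
  move=> x bx; have Vx := boxV bx.
  rewrite (Hs' r x sr Vx) dr'//; apply: le_trans e'e; apply: HA' => //.
    by apply: leq_trans sL; rewrite (perm_size ps') /= leqW.
  by move: ci; rewrite (permP ps') /= eqxx.
have r0 y : V y -> ipderiv V s r (upd i (lo i) y) = 0.
  move=> Vy; rewrite -(ipderiv_upd oV updV li sr nis Vy).
  rewrite (ipderiv_local s oV oV (g := fun=> 0)) ?ipderiv0// => z Vz /=.
  rewrite /r /A (HB z Vz).2 addr0 (_ : upd i (lo i) (upd i (lo i) z) = upd i (lo i) z) ?subrr//.
  by apply/rowP => j; rewrite !updE; case: eqP.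
move=> x bx; have Vx := boxV bx; have /andP[x1 x2] := bx i.
have xE : x = upd i (lo i) x + (x 0 i - lo i) *: e_ i.
  by rewrite upd_shift -addrA -scalerDl -(opprB (x 0 i)) addNr scale0r addr0.
have seg t : 0 <= t <= 1 -> box (upd i (lo i) x + (t * (x 0 i - lo i)) *: e_ i).
  move=> /andP[t0 t1] j; rewrite shiftE updE; have [->|ji] := eqVneq j i; last first.
    by rewrite mulr0 addr0.
  rewrite mulr1 lerDl mulr_ge0 ?subr_ge0//= addrC -lerBrDr.
  by apply: le_trans (_ : _ <= x 0 i - lo i) _; rewrite ?lerD2r// ler_piMl// subr_ge0.
have M := @mvt_ineq _ _ _ V i (ipderiv V s r) (upd i (lo i) x) (x 0 i - lo i) e'
  (ipderiv V (i :: s) r) 0.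
rewrite -xE r0// !subr0 scaler0 subr0 in M.
apply: le_trans (M _ _ _) _.
- by move=> t t01; apply: boxV; exact: seg.
- by move=> y Vy; exact: smooth_on_pd.
- move=> t t01; rewrite subr0; have by_ := seg t t01; have Vy := boxV by_.
  rewrite ipderiv_rot// ipderiv_cat dr'//; apply: HA' => //.
  by rewrite (_ : count_mem i s = 0%N)//; apply/eqP; rewrite -leqn0 leqNgt -has_count has_pred1.
- apply: le_trans e'w; rewrite ler_wpM2l ?(ltW e'0)// ger0_norm ?subr_ge0//.
  by rewrite lerD2r.
Qed.

End Approximation.

(** * Continuous derivations killing the coordinates *)

Section DerivationVanishes.
Variables (R : realType) (n : nat) (Q : normedModType R[i]).
Local Notation rV := 'rV[R]_n.
Local Notation e_ i := (delta_mx 0 i : rV).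
Local Notation C := (R[i]^o).
Variables (V : set rV) (lo hi : 'I_n -> R).
Hypothesis oV : relopen V.
Hypothesis lohi : forall i, lo i < hi i.
Local Notation box := (box lo hi).
Hypothesis boxV : box `<=` V.
Hypothesis updV : forall i t x, V x -> lo i <= t <= hi i -> V (upd i t x).
Variable E : (rV -> C) -> Q.
Hypothesis ED : forall f g, smooth_on V f -> smooth_on V g ->
  E (fun x => f x + g x) = E f + E g.
(* The form of the Leibniz rule that makes sense for values in a module without
   product. *)
Hypothesis EM : forall f g, smooth_on V f -> smooth_on V g -> E f = 0 -> E g = 0 ->
  E (fun x => f x * g x : C) = 0.
Hypothesis Ecst : forall c, E (fun=> c) = 0.
Hypothesis Ecoord : forall i, E (fun x => (x 0 i)%:C%C) = 0.
Hypothesis Econt : forall e : R, 0 < e -> exists L, exists2 d : R, 0 < d &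
  forall f, smooth_on V f ->
    (forall s, (size s <= L)%N -> forall x, box x -> nrm (ipderiv V s f x) <= d) ->
    nrm (E f) <= e.
Implicit Types (x y z : rV) (i j : 'I_n) (f g h A : rV -> C) (T : {set 'I_n}).

Lemma E_cvarX i k : E (fun x => cvar lo i x ^+ k : C) = 0.
Proof.
have E1 : E (cvar lo i) = 0.
  have -> : cvar lo i = fun x => (x 0 i)%:C%C + (fun=> (- lo i)%:C%C) x.
    by apply/funext => x; rewrite /cvar rmorphB rmorphN.
  by rewrite (ED (smooth_coord i oV) (smooth_on_cst _ oV)) Ecoord Ecst addr0.
elim: k => [|k IH]; first by under eq_fun do rewrite expr0; exact: Ecst.
under eq_fun do rewrite exprS.
exact: (EM (smooth_cvar lo oV i) (smooth_cvarX lo oV i k) E1 IH).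
Qed.

Lemma E_polyin i T A : (forall c, flat_in V (i |: T) c -> E c = 0) ->
  polyin V lo i T A -> E A = 0.
Proof.
move=> H; elim=> [|c k {}A fc pA IH]; first exact: Ecst.
have sk := smooth_cvarX lo oV i k.
rewrite (ED (smooth_onM oV fc.1 sk) (polyin_smooth oV pA)) IH addr0.
exact: (EM fc.1 sk (H c fc) (E_cvarX i k)).
Qed.

Lemma E_limit f : smooth_on V f ->
  (forall L e, 0 < e -> exists A, [/\ smooth_on V A, E A = 0 & forall s, (size s <= L)%N ->
     forall x, box x -> nrm (ipderiv V s (fun x => f x - A x) x) <= e]) ->
  E f = 0.
Proof.
move=> sf H; apply/nrm_eq0/eqP; rewrite eq_le nrm_ge0 andbT.
apply: (@le0_eq0_eps _ _ 1) => e e0; rewrite mulr1.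
have [L [d d0 HL]] := Econt e0.
have [A [sA EA HA]] := H L d d0.
have -> : f = fun x => (f x - A x) + A x by apply/funext => x; rewrite subrK.
rewrite (ED (smooth_onB oV sf sA) sA) EA addr0.
exact: HL (smooth_onB oV sf sA) HA.
Qed.

Lemma flat_in_setT_box f x y : flat_in V setT f -> box x -> box y -> f x = f y.
Proof.
move=> [sf ff] bx by_.
have seg k t : 0 <= t <= 1 -> box (path_pt k t y x).
  move=> t01 j; have [u /andP[u0 u1] ->] := path_ptE k y x j t01.
  have /andP[a1 a2] := bx j; have /andP[b1 b2] := by_ j.
  have u1' : 0 <= 1 - u by rewrite subr_ge0.
  have := ler_wpM2l u0 a1; have := ler_wpM2l u0 a2.
  have := ler_wpM2l u1' b1; have := ler_wpM2l u1' b2.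
  by move=> *; apply/andP; split; lra.
have := @mvt_path _ _ _ V f (fun k => pderiv V k f) y x 0 (fun=> 0)
  (fun k t t01 => boxV (seg k t t01)) (fun k z => @smooth_on_pd _ _ _ V f [::] k z oV sf).
rewrite big1 => [|j _]; last exact: scaler0.
rewrite subr0 mul0r => M; apply/eqP; rewrite -subr_eq0; apply/eqP/nrm_eq0/eqP.
rewrite eq_le nrm_ge0 andbT; apply: M => k t t01.
by rewrite subr0 ff ?in_setT// ?nrm0//; exact: boxV (seg k t t01).
Qed.

(** Induction on the number of coordinates on which [g] depends.  By [approx_poly]
    it is a limit of polynomials in one of these coordinates with coefficients
    depending on the others only.  A function that depends on no coordinate is
    constant on the box, and [E] is controlled by jets there. *)
Lemma derivation_eq0 f : smooth_on V f -> E f = 0.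
Proof.
suff H : forall m T, (#|~: T| <= m)%N -> forall g, flat_in V T g -> E g = 0.
  by move=> sf; apply: (H _ set0 (leqnn _)); split=> // j; rewrite inE.
elim=> [|m IH] T Tm g fg.
  have TT : T = setT by apply/eqP; rewrite -subTset -setCS setCT subset0 -cards_eq0 -leqn0.
  rewrite TT in fg.
  have blo : box (\row_j lo j) by move=> j; rewrite mxE lexx ltW.
  apply: (E_limit fg.1) => L e e0.
  exists (fun=> g (\row_j lo j)); split; [exact: smooth_on_cst|exact: Ecst|].
  move=> s _ x bx; have Vx := boxV bx.
  rewrite (ipderivB s oV fg.1 (smooth_on_cst _ oV) Vx).
  case: (lastP s) => [|s' j] /=.
    by rewrite (flat_in_setT_box fg bx blo) subrr nrm0 ltW.
  rewrite -cats1 !ipderiv_cat.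
  have z0 (h : rV -> C) : (forall y, V y -> pderiv V j h y = 0) ->
      ipderiv V s' (ipderiv V [:: j] h) x = 0.
    by move=> hz; rewrite (ipderiv_local s' oV oV (g := fun=> 0)) ?ipderiv0.
  have dg y : V y -> pderiv V j g y = 0 by apply: fg.2; rewrite inE.
  have dc := z0 (fun=> g (\row_j lo j)) (fun y => pderiv_cst oV j _ (x := y)).
  rewrite (congr2 (fun a b : C => a - b) (z0 g dg) dc) subr0 nrm0; exact: ltW.
have [T0|[i iT]] := set_0Vmem (~: T).
  by apply: (IH T) => //; rewrite T0 cards0.
apply: (E_limit fg.1) => L e e0.
have [A pA HA] := approx_poly oV lohi boxV updV i L L fg e0.
exists A; split; first exact: (polyin_smooth oV pA).
  apply: E_polyin pA => c fc; apply: (IH (i |: T)) fc.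
  have -> : ~: (i |: T) = (~: T) :\ i.
    by apply/setP => j; rewrite !inE negb_or.
  by move: Tm; rewrite (cardsD1 i (~: T)) iT.
move=> s sL; apply: HA => //; exact: leq_trans (count_size _ _) sL.
Qed.

End DerivationVanishes.

(** * Convergence in the spaces of smooth functions and of forms *)

Lemma cvg_initialP (S : choiceType) (T : topologicalType) (f : S -> T)
    (F : set_system S) (s : S) : Filter F ->
  F --> (s : initial_topology f) <-> f @ F --> f s.
Proof.
move=> FF; split=> [H A|H A].
  by move=> /(initial_continuous (f := f)) /H.
case=> B; case; case=> O oO <- Bs BA; apply: filterS BA _.
by apply: (H O); apply: open_nbhs_nbhs.
Qed.

Lemma cvg_prod_topologyP (I : Type) (T : I -> topologicalType)
    (F : set_system (forall i, T i)) (t : forall i, T i) : Filter F ->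
  F --> (t : prod_topology T) <-> forall i, (fun f => f i) @ F --> t i.
Proof.
move=> FF; split.
  move=> /cvg_sup H i; have := H i.
  by move=> /(cvg_initialP (fun f : forall i, T i => f i) t).
by move=> H; apply/cvg_sup => i; apply/(cvg_initialP (fun f : forall i, T i => f i)).
Qed.

Lemma cvg_familyP (R : realType) (U : choiceType) (W : normedModType R[i])
    (fam : set U -> Prop) (F : set_system (U -> W)) (f : U -> W) : Filter F ->
  F --> (f : {family fam, U -> W}) <-> forall A, fam A -> forall e : R, 0 < e ->
    \forall g \near F, forall y, A y -> nrm (g y - f y) < e.
Proof.
move=> FF; split.
  move=> /fam_cvgP H A fA e e0; have := H A fA.
  move=> h; apply: (h [set g | forall y, A y -> nrm (g y - f y) < e]).
  apply/uniform_nbhs; exists [set xy | ball xy.1 e%:C%C xy.2]; split.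
    by rewrite -entourage_ballE; exists e%:C%C => //=; rewrite ltcR.
  move=> g /= H1 y Ay; have := H1 y Ay.
  by rewrite -ball_normE /= nrmBC -(@ltcR R) -nrmE.
move=> H; apply/fam_cvgP => A fA P /uniform_nbhs[E [entE EP]].
move: entE; rewrite -entourage_ballE => -[e /= e0 eE].
have er : e \is Num.real by rewrite gtr0_real.
have [k ek] := complex_realP _ er.
rewrite ek in e0 eE; rewrite (@ltcR R 0) in e0.
apply: filterS (H A fA k e0) => g Hg; apply: EP => y Ay; apply: eE.
by rewrite /= -ball_normE /= nrmE ltcR nrmBC; exact: Hg.
Qed.

Section FrechetConvergence.
Variables (R : realType) (n : nat) (M : smoothManifold R n) (W : normedModType R[i]).

Lemma cvg_CinfP (F : set_system (M -> W)) (f0 : M -> W) : Filter F ->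
  F --> (f0 : Cinf M W) <->
  forall (c : atlas M) s K, chart_compact c K -> forall e : R, 0 < e ->
    \forall f \near F, forall x, K x ->
      nrm (ipderiv (cimg c) s (f \o cinv c) x - ipderiv (cimg c) s (f0 \o cinv c) x) < e.
Proof.
move=> FF; split.
  move=> /(cvg_initialP (@jet R n M W)) /cvg_prod_topologyP H c s K cK e e0.
  by have /cvg_familyP/(_ K cK e e0) := H (c, s).
move=> H; apply/(cvg_initialP (@jet R n M W)); apply/cvg_prod_topologyP => -[c s].
by apply/cvg_familyP => K cK e e0; exact: (H c s K cK e e0).
Qed.

Lemma cvg_Omega1P (F : set_system (form_family M W)) (w0 : form_family M W) : Filter F ->
  F --> (w0 : Omega1 M W) <->
  forall (c : atlas M) i s K, chart_compact c K -> forall e : R, 0 < e ->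
    \forall w \near F, forall x, K x ->
      nrm (ipderiv (cimg c) s (w c i \o cinv c) x - ipderiv (cimg c) s (w0 c i \o cinv c) x) < e.
Proof.
move=> FF; split.
  move=> /(cvg_initialP (@form_jet R n M W)) /cvg_prod_topologyP H c i s K cK e e0.
  by have /cvg_familyP/(_ K cK e e0) := H (c, i, s).
move=> H; apply/(cvg_initialP (@form_jet R n M W)); apply/cvg_prod_topologyP => -[[c i] s].
by apply/cvg_familyP => K cK e e0; exact: (H c i s K cK e e0).
Qed.

End FrechetConvergence.

(** * Charts and extension by zero *)

Section Charts.
Variables (R : realType) (n : nat) (M : smoothManifold R n).
Local Notation rV := 'rV[R]_n.
Implicit Types (c : atlas M) (m : M) (x : rV).

Lemma cimg_cinv c x : cimg c x -> cdom c (cinv c x) /\ cmap c (cinv c x) = x.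
Proof. by case=> m cm <-; rewrite cmapK. Qed.

Lemma cmap_cimg c m : cdom c m -> cimg c (cmap c m).
Proof. by exists m. Qed.

Lemma relopen_cimg c : relopen (cimg c).
Proof.
have [U oU E] := cmap_open c; rewrite /cimg E; exact: relopen_open.
Qed.

Lemma relopen_pre c (O : set M) : open O -> relopen [set x | cimg c x /\ O (cinv c x)].
Proof.
move=> oO; have [sC oC] := relopen_cimg c.
split=> [x [/sC]//|x [Cx Ox]].
have /subspace_continuousP/(_ x Cx) H := @cinv_continuous _ _ M c.
have HO : \forall y \near x, cimg c y -> O (cinv c y).
  by have := H O (open_nbhs_nbhs (conj oO Ox)); exact.
near=> y => hy; have Cy : cimg c y by move: hy; near: y; exact: oC.
by split=> //; move: Cy; near: y.
Unshelve. all: by end_near. Qed.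

Lemma overlapE c c' : cmap c @` (cdom c `&` cdom c') =
  [set x | cimg c x /\ cdom c' (cinv c x)].
Proof.
apply/seteqP; split=> x.
  by case=> m [cm c'm] <-; split; [exists m|rewrite cmapK].
by move=> [/cimg_cinv[a b] H]; exists (cinv c x).
Qed.

Lemma relopen_overlap c c' : relopen (cmap c @` (cdom c `&` cdom c')).
Proof. by rewrite overlapE; apply: relopen_pre; exact: cdom_open. Qed.

Lemma open_dom c (V : set rV) : relopen V -> open [set m | cdom c m /\ V (cmap c m)].
Proof.
move=> [sV oV]; rewrite openE => m [cm Vm].
have /subspace_continuousP/(_ m cm) H := @cmap_continuous _ _ M c.
have H1 : \forall m' \near m, cdom c m' -> (halfspace (cmap c m') -> V (cmap c m')).
  exact: (H _ (oV _ Vm)).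
have H2 : \forall m' \near m, cdom c m'.
  by apply: open_nbhs_nbhs; split=> //; exact: cdom_open.
rewrite /interior; near=> m'.
have cm' : cdom c m' by near: m'.
split=> //; have : halfspace (cmap c m') by apply: (relopen_cimg c).1; exact: cmap_cimg.
by move: cm'; near: m'.
Unshelve. all: by end_near. Qed.

Lemma smooth_transition c c' (V' : set rV) j : relopen V' ->
  V' `<=` [set x | cimg c x /\ cdom c' (cinv c x)] ->
  smooth_on V' (fun x => (cmap c' (cinv c x) 0 j)%:C%C : R[i]^o).
Proof.
move=> oV' sV'; apply: (smooth_on_sub (relopen_overlap c c') oV').
  by rewrite overlapE.
exact: transition_smooth.
Qed.

End Charts.

Section ExtensionByZero.
Variables (R : realType) (n : nat) (M : smoothManifold R n) (W : normedModType R[i]).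
Local Notation rV := 'rV[R]_n.
Variables (c : atlas M) (V K : set rV).
Hypotheses (oV : relopen V) (VC : V `<=` cimg c) (KV : K `<=` V) (cK : compact K).
Implicit Types (m : M) (x : rV) (G : rV -> W).

Definition ext0 G : M -> W := fun m =>
  if `[< cdom c m /\ V (cmap c m) >] then G (cmap c m) else 0.

Lemma ext0_in G m : cdom c m -> V (cmap c m) -> ext0 G m = G (cmap c m).
Proof. by move=> cm Vm; rewrite /ext0 asboolT. Qed.

Definition supported G := forall x, V x -> ~ K x -> G x = 0.

Let KM : set M := cinv c @` K.

Lemma ext0_out G m : supported G -> ~ KM m -> ext0 G m = 0.
Proof.
move=> sG Km; rewrite /ext0; case: asboolP => // -[cm Vm].
by apply: sG => // Kx; apply: Km; exists (cmap c m) => //; rewrite cmapK.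
Qed.

(** Compact subsets of M are closed because M is Hausdorff. *)
Lemma open_setC_cinv : open (~` KM).
Proof.
rewrite openC; apply: compact_closed; first exact: mfd_hausdorff.
apply: continuous_compact => //.
by apply: continuous_subspaceW (@cinv_continuous _ _ M c) => x /KV/VC.
Qed.

Let ov (c' : atlas M) : set rV := [set x | cimg c' x /\ (cdom c (cinv c' x) /\ V (cmap c (cinv c' x)))].
Let off (c' : atlas M) : set rV := [set x | cimg c' x /\ ~ KM (cinv c' x)].

Lemma relopen_ov c' : relopen (ov c').
Proof. exact: (relopen_pre c' (open_dom c oV)). Qed.

Lemma relopen_off c' : relopen (off c').
Proof. exact: (relopen_pre c' open_setC_cinv). Qed.

Lemma KM_ov c' x : cimg c' x -> KM (cinv c' x) -> ov c' x.
Proof.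
move=> Cx [y Ky e]; split=> //; rewrite -e.
by have [a b] := cimg_cinv (VC (KV Ky)); rewrite b; split=> //; exact: KV.
Qed.

Let tau (c' : atlas M) x := cmap c (cinv c' x).

Lemma tau_ov c' x : ov c' x -> V (tau c' x).
Proof. by case=> _ []. Qed.

Lemma tau_smooth c' j : smooth_on (ov c') (fun x => (tau c' x 0 j)%:C%C : R[i]^o).
Proof.
by apply: smooth_transition; [exact: relopen_ov|move=> x [a [b _]]].
Qed.

Lemma ext0_ov G c' x : ov c' x -> (ext0 G \o cinv c') x = (G \o tau c') x.
Proof. by move=> [_ [a b]]; rewrite /= ext0_in. Qed.

Lemma ext0_off G c' x : supported G -> off c' x -> (ext0 G \o cinv c') x = 0.
Proof. by move=> sG [_ a]; rewrite /= ext0_out. Qed.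

(** Near the compact set [KM] the extension is the composite of [G] with a change
    of charts; elsewhere it is locally 0. *)
Lemma smooth_ext0 G : smooth_on V G -> supported G -> smooth M W (ext0 G).
Proof.
move=> smG sG c'; apply: smooth_on_local; first exact: relopen_cimg.
move=> x Cx; have [Kx|nKx] := pselect (KM (cinv c' x)).
  exists (ov c'); split; [exact: relopen_ov|exact: KM_ov|by move=> y []|].
  apply: (smooth_on_eq (relopen_ov c') (f := G \o tau c')).
    by move=> y oy; rewrite ext0_ov.
  exact: (smooth_on_comp (relopen_ov c') oV (@tau_ov c') (tau_smooth c') smG).
exists (off c'); split; [exact: relopen_off|by []|by move=> y []|].
apply: (smooth_on_eq (relopen_off c') (f := fun=> 0)); last exact: smooth_on_cst (relopen_off c').
by move=> y oy; rewrite ext0_off.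
Qed.

(** Membership is [List.In] because the terms contain proofs and have no decidable
    equality. *)
Lemma comp_terms_size c' s p :
  List.In p (comp_terms (relopen_ov c') (tau_smooth c') s) -> (size p.1 <= size s)%N.
Proof.
elim: s p => [|i s IH] p /=; first by case=> [<-|[]].
elim: (comp_terms _ _ s) IH => [|q l IHl] IH //=.
case=> [<-|] /=; first by apply: leq_trans (IH q _) (leqnSn _); left.
rewrite List.in_app_iff => -[/List.in_map_iff[j [<- _]] /=|H].
  by rewrite ltnS; apply: IH; left.
by apply: IHl => // q' q'l; apply: IH; right.
Qed.

(** The coefficients in the composition formula do not depend on [G].  They need
    not be bounded on [K'], but they are on its part where the extension is not
    locally 0, by a compactness argument on [K']. *)
Lemma ext0_jet_bound c' s K' : chart_compact c' K' -> exists2 B : R, 0 <= B &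
  forall G (d : R), 0 <= d -> smooth_on V G -> supported G ->
    (forall t, (size t <= size s)%N -> forall x, K x -> nrm (ipderiv V t G x) <= d) ->
    forall x, K' x -> nrm (ipderiv (cimg c') s (ext0 G \o cinv c') x) <= B * d.
Proof.
move=> [cK' K'C].
have oc := relopen_cimg c'.
pose L := comp_terms (relopen_ov c') (tau_smooth c') s.
pose N x := \sum_(p <- L) nrm (sval p.2 x).
(* The coefficients are bounded on the part of K' that is mapped into KM. *)
pose P (k : nat) x := cimg c' x -> KM (cinv c' x) -> N x <= k%:R.
have H : \forall k \near \oo, K' `<=` P k.
  apply: (iffLR (compact_near_coveringP _) cK' nat \oo P _) => x0 K'x0.
  have Cx0 := K'C _ K'x0.
  have [Kx|nKx] := pselect (KM (cinv c' x0)); last first.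
    exists ([set x | cimg c' x -> ~ KM (cinv c' x)], [set k | True]).
      split; last exact: filterT.
      have o0 : off c' x0 by [].
      have h := relopen_near oc (relopen_off c') Cx0 o0.
      by apply: filterS h => y [a _] Cy; exact: (a Cy).2.
    by move=> [x k] /= [a _] Cx Kx; case: (a Cx).
  have ov0 := KM_ov Cx0 Kx.
  have cN : \forall x \near x0, ov c' x -> N x <= N x0 + (size L)%:R.
    rewrite /N; elim: (L) => [|[t [v sv]] l IHl] /=.
      by near=> x => _; rewrite !big_nil addr0.
    have cv := smooth_on_cont [::] (relopen_ov c') sv ov0 ltr01.
    have arith (a1 b1 a2 b2 k : R) : a1 <= b1 + 1 -> a2 <= b2 + k -> a1 + a2 <= b1 + b2 + (k + 1).
      by move=> *; lra.
    near=> x => ox; rewrite !big_cons -natr1; apply: arith => /=.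
      rewrite -{1}(subrK (v x0) (v x)) addrC; apply: le_trans (nrmD _ _) _.
      by rewrite lerD2l; apply/ltW; move: ox; near: x.
    by move: ox; near: x.
  exists ([set x | ov c' x -> N x <= N x0 + (size L)%:R], [set k | N x0 + (size L)%:R <= k%:R]).
    by split=> //; exact: nbhs_infty_ger.
  move=> [x k] /= [a b] Cx Kx'; apply: le_trans b; apply: a; exact: KM_ov.
have [k Hk] := filter_ex H.
exists k%:R => // G d d0 sG suppG HG x K'x.
have Cx := K'C _ K'x.
have kd : 0 <= k%:R * d by rewrite mulr_ge0.
have [Kx|nKx] := pselect (KM (cinv c' x)); last first.
  rewrite (ipderiv_local s oc (relopen_off c') (g := fun=> 0))//; first 1 last.
  - by move=> y [].
  - by move=> y oy; exact: ext0_off.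
  by rewrite ipderiv0 ?nrm0//; exact: relopen_off.
have ox := KM_ov Cx Kx.
rewrite (ipderiv_local s oc (relopen_ov c') (g := G \o tau c'))//; first 1 last.
- by move=> y [].
- by move=> y oy; exact: ext0_ov.
rewrite (smooth_on_comp_ipderiv (relopen_ov c') oV (@tau_ov c') (tau_smooth c') sG).2//.
have Ktau : K (tau c' x).
  by case: Kx => y Ky e; rewrite /tau -e; have [_ ->] := cimg_cinv (VC (KV Ky)).
apply: le_trans (nrm_sum _ _ _) _.
have Nk : N x <= k%:R by exact: (Hk x K'x Cx Kx).
apply: le_trans (ler_wpM2r d0 Nk); rewrite /N mulr_suml.
rewrite -/L; have : forall p, List.In p L -> (size p.1 <= size s)%N by exact: comp_terms_size.
elim: (L) => [|q l IHl] HL; first by rewrite !big_nil.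
rewrite !big_cons; apply: lerD; last by apply: IHl => p pl; apply: HL; right.
by rewrite nrmZ ler_wpM2l ?nrm_ge0//; apply: HG => //; apply: HL; left.
Unshelve. all: by end_near. Qed.

End ExtensionByZero.

(** * Smooth maps and one-forms on a manifold *)

Section Jets.
Variables (R : realType) (n : nat) (W : normedModType R[i]).
Local Notation rV := 'rV[R]_n.
Implicit Types (V : set rV) (f g : rV -> W).

Lemma jets_bounded V K f (L : nat) : relopen V -> smooth_on V f -> compact K -> K `<=` V ->
  exists2 C : R, 0 <= C &
    forall s, (size s <= L)%N -> forall x, K x -> nrm (ipderiv V s f x) <= C.
Proof.
move=> oV sf cK KV.
have /choice[C HC] : forall s : L.-bseq 'I_n, exists C : R, 0 <= C /\
    forall x, K x -> nrm (ipderiv V s f x) <= C.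
  by move=> s; have [C C0 HC] := cont_on_bounded (smooth_on_cont s oV sf) cK KV; exists C.
exists (\sum_s C s); first by apply: sumr_ge0 => s _; exact: (HC s).1.
move=> s sL x Kx; apply: le_trans ((HC (Bseq sL)).2 x Kx) _.
by rewrite (bigD1 (Bseq sL))//= lerDl; apply: sumr_ge0 => t _; exact: (HC t).1.
Qed.

End Jets.

Lemma size_splits n (s : seq 'I_n) : size (splits s) = (2 ^ size s)%N.
Proof.
by elim: s => //= i s IH; rewrite size_cat !size_map IH expnS mul2n addnn.
Qed.

Lemma splits_le n (s : seq 'I_n) p : p \in splits s ->
  (size p.1 <= size s)%N /\ (size p.2 <= size s)%N.
Proof.
elim: s p => [|i s IH] p /=; first by rewrite inE => /eqP ->.
rewrite mem_cat => /orP[] /mapP[q /IH[h1 h2] ->] /=; split=> //; exact: leqW.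
Qed.

(** The Leibniz formula for a derivative of order at most [L] has at most 2^L
    terms. *)
Lemma bil_small (R : realType) (n : nat) (W1 W2 W3 : normedModType R[i])
    (B : W1 -> W2 -> W3) (V K : set 'rV[R]_n) (f : 'rV[R]_n -> W1) (L : nat) (d : R) :
  bounded_bilinear B -> relopen V -> smooth_on V f -> compact K -> K `<=` V -> 0 < d ->
  exists2 d' : R, 0 < d' & forall g, smooth_on V g ->
    (forall s, (size s <= L)%N -> forall x, K x -> nrm (ipderiv V s g x) <= d') ->
    forall s, (size s <= L)%N -> forall x, K x ->
      nrm (ipderiv V s (fun x => B (f x) (g x)) x) <= d.
Proof.
move=> bB oV sf cK KV d0.
have [C C0 HC] := jets_bounded L oV sf cK KV.
pose C' := (2 ^ L)%:R * C; have C'0 : 0 <= C' by rewrite mulr_ge0.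
exists (d / (C' + 1)); first exact: divC_gt0.
move=> g sg Hg s sL x Kx; rewrite (leibniz bB oV sf sg).2; last exact: KV.
apply: le_trans (nrm_sum _ _ _) _.
apply: (@le_trans _ _ (\sum_(p <- splits s) C * (d / (C' + 1)))).
  rewrite !big_seq; apply: ler_sum => p /splits_le[h1 h2].
  apply: le_trans (bil_bound bB _ _) _; apply: ler_pM; rewrite ?nrm_ge0//.
    by apply: HC => //; exact: leq_trans sL.
  by apply: Hg => //; exact: leq_trans sL.
rewrite big_const_seq count_predT size_splits iter_addr_0 -mulr_natl mulrA mulrC.
apply: divC_le => //; first by rewrite mulr_ge0.
by rewrite /C' ler_wpM2r// ler_nat leq_exp2l.
Qed.

Lemma bil_flip (R : realType) (W1 W2 W3 : normedModType R[i]) (B : W1 -> W2 -> W3) :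
  bounded_bilinear B -> bounded_bilinear (fun u v => B v u).
Proof.
move=> bB; split=> [u u' v|u v v'|a u v|a u v|u v].
- exact: (bilDr bB).
- exact: (bilDl bB).
- exact: (bilZr bB).
- exact: (bilZl bB).
- by rewrite mulrC; exact: (bil_bound bB).
Qed.

Lemma qmul_bil (R : realType) (Q : cstarType R) : bounded_bilinear (fun u v : Q => u * v).
Proof.
split=> [u u' v|u v v'|a u v|a u v|u v].
- exact: mulrDl.
- exact: mulrDr.
- by rewrite -[LHS]cstar_scaleAl.
- by rewrite -[LHS]cstar_scaleAr.
- rewrite -(@lecR R) rmorphM /= -!nrmE; exact: cstar_normM.
Qed.

Section Manifold.
Variables (R : realType) (n : nat) (M : smoothManifold R n).
Local Notation rV := 'rV[R]_n.
Local Notation C := (R[i]^o).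
Implicit Types (c : atlas M) (m : M) (x : rV) (i j : 'I_n).

Section Functions.
Variable W : normedModType R[i].
Implicit Types F G : M -> W.

Lemma smooth_cst (w : W) : smooth M W (fun=> w).
Proof. by move=> c; exact: (smooth_on_cst w (relopen_cimg c)). Qed.

Lemma smoothD F G : smooth M W F -> smooth M W G -> smooth M W (fun m => F m + G m).
Proof. by move=> sF sG c; exact: (smooth_onD (relopen_cimg c) (sF c) (sG c)). Qed.

Lemma smoothB F G : smooth M W F -> smooth M W G -> smooth M W (fun m => F m - G m).
Proof. by move=> sF sG c; exact: (smooth_onB (relopen_cimg c) (sF c) (sG c)). Qed.

Lemma dform_in F c i m : cdom c m ->
  dform F c i m = pderiv (cimg c) i (F \o cinv c) (cmap c m).
Proof. by move=> cm; rewrite /dform mem_set. Qed.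

Lemma dform_out F c i m : ~ cdom c m -> dform F c i m = 0.
Proof. by move=> cm; rewrite /dform memNset. Qed.

Lemma dform_cinv F c i x : cimg c x ->
  dform F c i (cinv c x) = pderiv (cimg c) i (F \o cinv c) x.
Proof. by move=> Cx; have [a b] := cimg_cinv Cx; rewrite dform_in// b. Qed.

Lemma dform_change F c c' i m : smooth M W F -> cdom c m -> cdom c' m ->
  dform F c i m = \sum_j jacobian c c' m i j *: dform F c' j m.
Proof.
move=> sF cm c'm; have oc := relopen_cimg c; have oc' := relopen_cimg c'.
pose V := cmap c @` (cdom c `&` cdom c').
have oV : relopen V by exact: relopen_overlap.
have Vm : V (cmap c m) by exists m.
rewrite dform_in// (pderiv_near (V' := V) (g := (F \o cinv c') \o (cmap c' \o cinv c)) i oc oV)//;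
  first last.
- near=> y => -[m' [a b] <-] /=; by rewrite !cmapK.
- exact: cmap_cimg.
rewrite (pderiv_comp oV oc')//; last 2 first.
- by move=> y [m' [a b] <-] /=; rewrite cmapK//; exact: cmap_cimg.
- by move=> j; exact: transition_smooth.
by apply: eq_bigr => j _; rewrite /= cmapK// [in RHS]dform_in.
Unshelve. all: by end_near. Qed.

Lemma one_form_dform F : smooth M W F -> one_form M W (dform F).
Proof.
move=> sF; split.
- by move=> c i m cm; rewrite dform_out.
- move=> c i; apply: (smooth_on_eq (relopen_cimg c) (f := pderiv (cimg c) i (F \o cinv c))).
    by move=> x Cx; rewrite /= dform_cinv.
  exact: (smooth_on_ipderiv [:: i] (sF c)).
- by move=> c c' i m cm c'm; exact: dform_change.
Qed.

Lemma one_form_sum (I : eqType) (r : seq I) (w : I -> form_family M W) :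
  (forall k, k \in r -> one_form M W (w k)) ->
  one_form M W (fun c i m => \sum_(k <- r) w k c i m).
Proof.
move=> H; split.
- by move=> c i m cm; rewrite big_seq big1// => k /H[a _ _]; exact: a.
- move=> c i; apply: (smooth_on_sum (F := fun k => w k c i \o cinv c) (relopen_cimg c)) => k /H[_ a _].
  exact: a.
- move=> c c' i m cm c'm /=.
  under [in RHS]eq_bigr do rewrite scaler_sumr.
  rewrite exchange_big /= !big_seq; apply: eq_bigr => k /H[_ _ a]; exact: a.
Qed.

End Functions.

Section Products.
Variables (W1 W2 W3 : normedModType R[i]) (B : W1 -> W2 -> W3).
Hypothesis bB : bounded_bilinear B.

Lemma smooth_bil F G : smooth M W1 F -> smooth M W2 G -> smooth M W3 (fun m => B (F m) (G m)).
Proof. by move=> sF sG c; exact: (smooth_on_bil bB (relopen_cimg c) (sF c) (sG c)). Qed.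

Lemma bil0l v : B 0 v = 0.
Proof. by have := bilZl bB 0 0 v; rewrite !scale0r. Qed.

Lemma bil0r u : B u 0 = 0.
Proof. by have := bilZr bB 0 u 0; rewrite !scale0r. Qed.

Lemma dform_bil F G c i m : smooth M W1 F -> smooth M W2 G ->
  dform (fun m => B (F m) (G m)) c i m = B (dform F c i m) (G m) + B (F m) (dform G c i m).
Proof.
move=> sF sG; have [cm|cm] := pselect (cdom c m); last first.
  by rewrite !dform_out// bil0l bil0r addr0.
rewrite !dform_in//.
have := pderiv_bil bB i (relopen_cimg c) (sF c) (sG c) (cmap_cimg cm).
by rewrite /= cmapK.
Qed.

Lemma one_form_bil F w : smooth M W1 F -> one_form M W2 w ->
  one_form M W3 (fun c i m => B (F m) (w c i m)).
Proof.
move=> sF [w1 w2 w3]; split.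
- by move=> c i m cm; rewrite w1// bil0r.
- by move=> c i; exact: (smooth_on_bil bB (relopen_cimg c) (sF c) (w2 c i)).
- move=> c c' i m cm c'm; rewrite (w3 c c')//.
  have Bsum (r : seq 'I_n) (f : 'I_n -> W2) u : B u (\sum_(j <- r) f j) = \sum_(j <- r) B u (f j).
    by elim: r => [|j r IH]; rewrite ?big_nil ?bil0r// !big_cons (bilDr bB) IH.
  by rewrite Bsum; apply: eq_bigr => j _; rewrite (bilZr bB).
Qed.

End Products.

End Manifold.

(** * Vector fields with a prescribed value at a point *)

Section RealDerivatives.
Variables (R : realType) (n : nat).
Local Notation rV := 'rV[R]_n.

Lemma nrm_Im (z : R[i]^o) : `|complex.Im (z : R[i])| <= nrm z.
Proof.
rewrite /nrm normc_def /= -sqrtr_sqr; apply: ler_wsqrtr.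
by rewrite lerDr sqr_ge0.
Qed.

(** Real difference quotients have real limits.  Jacobians are therefore real, as
    the coefficients of vector fields must be, although [jacobian] has complex
    values. *)
Lemma real_pd (V : set rV) i (u : rV -> R) x (l : R[i]^o) : relopen V -> V x ->
  has_pd V i (fun x => (u x)%:C%C : R[i]^o) x l -> (complex.Re (l : R[i]))%:C%C = l.
Proof.
move=> oV Vx H.
suff I0 : complex.Im (l : R[i]) = 0 by case: l I0 {H} => a b /= ->.
apply/eqP; rewrite -normr_le0; apply: (@le0_eq0_eps _ _ 1) => e e0; rewrite mulr1.
have PF := increments_proper i oV Vx.
have N : \forall h \near increments V i x, h != 0 /\ nrm ((u (x + h *: delta_mx 0 i))%:C%C -
    (u x)%:C%C - h%:C%C *: l : R[i]^o) <= e * `|h|.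
  have N0 : \forall h \near (0 : R), h != 0 -> V (x + h *: delta_mx 0 i) -> h != 0 /\
    nrm ((u (x + h *: delta_mx 0 i))%:C%C - (u x)%:C%C - h%:C%C *: l : R[i]^o) <= e * `|h|.
    by apply: filterS (H e e0) => h a h0 Vh; split=> //; exact: a.
  exact: N0.
have [h [h0 Hh]] := filter_ex N.
have := le_trans (nrm_Im _) Hh.
have -> : complex.Im ((u (x + h *: delta_mx 0 i))%:C%C - (u x)%:C%C - h%:C%C *: l : R[i]) =
    - (h * complex.Im (l : R[i])).
  by case: (l) => a b /=; ring.
by rewrite normrN normrM mulrC ler_pM2r ?normr_gt0.
Qed.

End RealDerivatives.

Section Jacobians.
Variables (R : realType) (n : nat) (M : smoothManifold R n).
Local Notation rV := 'rV[R]_n.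
Implicit Types (c : atlas M) (m : M) (x : rV) (i j : 'I_n).

Lemma smooth_jacobian c c' i j : smooth_on (cmap c @` (cdom c `&` cdom c'))
  (fun x => jacobian c c' (cinv c x) i j : R[i]^o).
Proof.
apply: (smooth_on_eq (relopen_overlap c c')
  (f := pderiv (cmap c @` (cdom c `&` cdom c')) i
     (fun x => (cmap c' (cinv c x) 0 j)%:C%C : R[i]^o))).
  by move=> x [m [a b] <-]; rewrite /jacobian !cmapK.
exact: (smooth_on_ipderiv [:: i] (transition_smooth c c' j)).
Qed.

Lemma jacobian_real c c' m i j : cdom c m -> cdom c' m ->
  (complex.Re (jacobian c c' m i j))%:C%C = jacobian c c' m i j.
Proof.
move=> a b; have oV := relopen_overlap c c'.
have Vm : (cmap c @` (cdom c `&` cdom c')) (cmap c m) by exists m.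
exact: (real_pd oV Vm (smooth_on_pd [::] i oV (transition_smooth c c' j) Vm)).
Qed.

Lemma jacobian_id c m i j : cdom c m -> jacobian c c m i j = (j == i)%:R.
Proof.
move=> a; have oV := relopen_overlap c c.
have Vm : (cmap c @` (cdom c `&` cdom c)) (cmap c m) by exists m.
rewrite /jacobian.
rewrite (pderiv_near (g := fun x => (x 0 j)%:C%C : R[i]^o) i oV oV Vm Vm).
  exact: pderiv_coord.
by near=> y => -[m' [b _] <-]; rewrite cmapK.
Unshelve. all: by end_near. Qed.

Lemma jacobian_cocycle c c' c'' m i j : cdom c m -> cdom c' m -> cdom c'' m ->
  jacobian c c'' m i j = \sum_k jacobian c c' m i k * jacobian c' c'' m k j.
Proof.
move=> a a' a''.
have oV := relopen_overlap c c''; have oV1 := relopen_overlap c c'.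
have oV2 := relopen_overlap c' c''.
pose O := [set m' | cdom c' m' /\ cdom c'' m'].
have oO : open O by apply: openI; exact: cdom_open.
have oU := relopen_pre c oO; pose U := [set x | cimg c x /\ O (cinv c x)].
have Um : U (cmap c m) by rewrite /U /= cmapK//; split=> //; exact: cmap_cimg.
have Vm : (cmap c @` (cdom c `&` cdom c'')) (cmap c m) by exists m.
pose g := fun y => (cmap c'' (cinv c' y) 0 j)%:C%C : R[i]^o.
rewrite {1}/jacobian (pderiv_near (V' := U) (g := g \o (cmap c' \o cinv c)) i oV oU Vm Um); last first.
  by near=> y => -[Cy [y1 y2]]; rewrite /g /= cmapK.
have tV z : U z -> (cmap c' @` (cdom c' `&` cdom c'')) ((cmap c' \o cinv c) z).
  by move=> [y1 [y2 y3]] /=; exists (cinv c z).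
have ts k : smooth_on U (fun z => ((cmap c' \o cinv c) z 0 k)%:C%C : R[i]^o).
  apply: (@smooth_transition _ _ M c c' _ k oU).
  by move=> y [y1 [y2 _]].
rewrite (pderiv_comp oU oV2 tV ts i (transition_smooth c' c'' j) Um).
apply: eq_bigr => k _; rewrite /= cmapK//; congr (_ * _).
have V1m : (cmap c @` (cdom c `&` cdom c')) (cmap c m) by exists m.
rewrite /jacobian (pderiv_near (g := fun x => (cmap c' (cinv c x) 0 k)%:C%C : R[i]^o) i oU oV1 Um V1m)//; near=> y.
Unshelve. all: by end_near. Qed.

End Jacobians.

Section ChartBox.
Variables (R : realType) (n : nat).
Local Notation rV := 'rV[R]_n.

(** The lower face of the box in direction 0 is cut at 0, where the half-space
    ends.  [V] is a relatively open cube around the box in which a coordinate may be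
    replaced by any value that the box allows. *)
Lemma box_exists (V0 : set rV) (p : rV) : relopen V0 -> V0 p ->
  exists (V : set rV) (lo hi : 'I_n -> R) (d : R),
  [/\ relopen V /\ V `<=` V0, forall i, lo i < hi i, box lo hi `<=` V,
      forall i t x, V x -> lo i <= t <= hi i -> V (upd i t x) &
      0 < d /\ forall x, V0 x -> close d p x -> box lo hi x].
Proof.
move=> [sV0 oV0] V0p; have [r r0 rP] := iffLR (nbhs_closeP _ _) (oV0 p V0p).
have hp := sV0 _ V0p.
pose d := r / 2; have d0 : 0 < d by rewrite divr_gt0.
have dr : d < r by rewrite /d; lra.
pose lo (i : 'I_n) := if (i : nat) == 0%N then Num.max 0 (p 0 i - d) else p 0 i - d.
pose hi (i : 'I_n) := p 0 i + d.
have lo1 i : p 0 i - d <= lo i by rewrite /lo; case: ifP => // _; rewrite le_max lexx orbT.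
exists ([set x | halfspace x /\ close r p x]), lo, hi, d; split.
- split; last by move=> x [hx xp]; exact: rP.
  by apply: relopen_close; split=> // x _; near=> y.
- move=> i; rewrite /lo /hi; case: ifP => [/eqP i0|_]; last by lra.
  by rewrite gt_max; have := hp i i0; lra.
- move=> x bx; split.
    move=> i i0; have /andP[h _] := bx i; apply: le_trans h.
    by rewrite /lo i0 eqxx le_max lexx.
  move=> j; have /andP[h1 h2] := bx j; apply: le_lt_trans dr.
  rewrite ler_norml; apply/andP; split; last by rewrite lerBlDl.
  by have := le_trans (lo1 j) h1; lra.
- move=> i t x [hx xp] /andP[h1 h2]; split=> j; rewrite updE; case: eqP => [->|_] //.
  + by move=> i0; apply: le_trans h1; rewrite /lo i0 eqxx le_max lexx.
  + exact: hx.
  + apply: le_lt_trans dr; rewrite ler_norml; apply/andP; split; last by rewrite lerBlDl.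
    by have := le_trans (lo1 i) h1; lra.
- split=> // x V0x xp j; have := xp j; rewrite ltr_norml => /andP[h1 h2].
  apply/andP; split; last by rewrite /hi; lra.
  rewrite /lo; case: ifP => [/eqP j0|_]; last by lra.
  by rewrite ge_max (sV0 _ V0x j j0) /=; lra.
Unshelve. all: by end_near. Qed.

End ChartBox.

Section VectorFields.
Variables (R : realType) (n : nat) (M : smoothManifold R n).
Local Notation rV := 'rV[R]_n.
Implicit Types (c : atlas M) (m : M) (x : rV) (i j : 'I_n).

(** The coordinate field [d/dx_i0] of [c], multiplied by a plateau function at
    [m0] supported in the chart and extended by 0. *)
Lemma vector_field_exists c m0 i0 : cdom c m0 ->
  exists nu : vectorField M, forall j, vcoef nu c j m0 = (j == i0)%:R.
Proof.
move=> cm0; have oc := relopen_cimg c.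
have [V [lo [hi [d [[oV VC] lohi bV _ [d0 dbox]]]]]] := box_exists oc (cmap_cimg cm0).
have [phi [sphi [d' d'0 phi1] phi0]] := bump_exists (cmap c m0) d0.
have bC : box lo hi `<=` cimg c by move=> x /bV/VC.
have cb : compact (box lo hi) by exact: box_compact.
have oK : open (~` (cinv c @` box lo hi)) := open_setC_cinv (fun x (h : cimg c x) => h) bC cb.
pose coef c' j m : R := if `[< cdom c m /\ cdom c' m >] then
  phi (cmap c m) * complex.Re (jacobian c c' m i0 j) else 0.
have coefE c' j m : cdom c m -> cdom c' m ->
    (coef c' j m)%:C%C = (phi (cmap c m))%:C%C * jacobian c c' m i0 j.
  by move=> a b; rewrite /coef asboolT// rmorphM /= jacobian_real.
have coef_smooth c' j : smooth_on (cimg c') (fun x => (coef c' j (cinv c' x))%:C%C : R[i]^o).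
  apply: smooth_on_local; first exact: relopen_cimg.
  move=> x Cx; have [cx|ncx] := pselect (cdom c (cinv c' x)).
    pose U := [set x | cimg c' x /\ cdom c (cinv c' x)].
    have oU : relopen U by exact: (relopen_pre c' (cdom_open c)).
    exists U; split=> //; first by move=> y [].
    have oV1 := relopen_overlap c c'.
    apply: (smooth_on_eq oU (f := (fun y => (phi y)%:C%C * jacobian c c' (cinv c y) i0 j : R[i]^o)
      \o (cmap c \o cinv c'))).
      move=> y [y1 y2] /=; rewrite coefE ?cmapK//; exact: (cimg_cinv y1).1.
    apply: (smooth_on_comp oU oV1).
    - by move=> y [y1 y2]; exists (cinv c' y) => //; split=> //; exact: (cimg_cinv y1).1.
    - by move=> k; apply: (@smooth_transition _ _ M c' c _ k oU).
    - exact: (smooth_onM oV1 (sphi _ oV1) (smooth_jacobian c c' i0 j)).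
  pose U := [set x | cimg c' x /\ (~` (cinv c @` box lo hi)) (cinv c' x)].
  have oU : relopen U by exact: (relopen_pre c' oK).
  exists U; split=> //.
  - split=> // -[y by_ e]; apply: ncx; rewrite -e.
    exact: (cimg_cinv (bC _ by_)).1.
  - by move=> y [].
  apply: (smooth_on_eq oU (f := fun=> 0)); last exact: smooth_on_cst oU.
  move=> y [y1 y2]; rewrite /coef; case: asboolP => // -[a b].
  have [->|pn] := eqVneq (phi (cmap c (cinv c' y))) 0; first by rewrite mul0r.
  exfalso; apply: y2; exists (cmap c (cinv c' y)); last by rewrite cmapK.
  by apply: dbox; [exact: cmap_cimg|exact: phi0].
have aux (a b z : R[i]) : a * (b * z) = b * (z * a) by ring.
have coef_change c1 c2 j m : cdom c1 m -> cdom c2 m ->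
    (coef c2 j m)%:C%C = \sum_i jacobian c1 c2 m i j * (coef c1 i m)%:C%C.
  move=> a b; have [cm|cm] := pselect (cdom c m).
    have E1 := coefE c2 j m cm b.
    have E2 := jacobian_cocycle i0 j cm a b.
    apply: (etrans E1); apply: (etrans (congr1 ( *%R _) E2)).
    rewrite mulr_sumr; apply: eq_bigr => i _.
    have E3 := coefE c1 i m cm a.
    apply: esym; apply: (etrans (congr1 ( *%R _) E3)).
    exact: aux.
  have z c' k : coef c' k m = 0 by rewrite /coef asboolF// => -[].
  by rewrite z big1// => i _; rewrite z mulr0.
exists (VectorField coef_smooth coef_change) => j /=.
rewrite /coef asboolT// phi1 ?mul1r ?jacobian_id//; last by move=> k; rewrite subrr normr0.
by case: eqP.
Qed.

End VectorFields.

(** * The derivation attached to a smooth action *)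

Section Action.
Variables (R : realType) (n : nat) (M : smoothManifold R n) (Q : compactQuantumGroup R).
Variable alpha : (M -> R[i]^o) -> (M -> Q).
Hypothesis act : smooth_action alpha.
Local Notation C := (R[i]^o).
Local Notation rV := 'rV[R]_n.
Implicit Types (c : atlas M) (m : M) (i j : 'I_n) (f g : M -> C).

Lemma alphaM f g m : smooth M C f -> smooth M C g ->
  alpha (fun m => f m * g m : C) m = alpha f m * alpha g m.
Proof. by move=> sf sg; rewrite -[LHS]/(alpha (f \* g) m) (actM act sf sg). Qed.

Lemma alphaD f g : smooth M C f -> smooth M C g ->
  alpha (fun m => f m + g m) = fun m => alpha f m + alpha g m.
Proof.
move=> sf sg; have := act_linear act 1 sf sg; rewrite !scale1r; exact.
Qed.

Lemma alpha0 : alpha (fun=> 0) = fun=> 0.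
Proof.
have s0 := smooth_cst (M := M) (0 : C).
apply/funext => m; have := alphaD s0 s0.
have -> : (fun m : M => (fun=> 0) m + (fun=> 0) m : C) = fun=> 0.
  by apply/funext => m'; rewrite addr0.
move=> /(congr1 (fun F => F m)) /= h; apply: (addrI (alpha (fun=> 0) m)).
by rewrite addr0; exact: esym h.
Qed.

Lemma alphaZ (k : C) f : smooth M C f ->
  alpha (fun m => k * f m : C) = fun m => (k : R[i]) *: alpha f m.
Proof.
move=> sf; have s0 := smooth_cst (M := M) (0 : C).
have := act_linear act k sf s0.
have -> : (k : R[i]) *: f + (fun=> 0) = (fun m => k * f m : C).
  by apply/funext => m; rewrite -[LHS]/(k * f m + 0) addr0.
by move=> ->; apply/funext => m; rewrite -[LHS]/(_ *: alpha f m + alpha (fun=> 0) m) alpha0 addr0.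
Qed.

Lemma alphaMl f g : smooth M C f -> smooth M C g ->
  alpha (fun m => f m * g m : C) = fun m => alpha f m * alpha g m.
Proof. by move=> sf sg; apply/funext => m; exact: (alphaM m sf sg). Qed.

(** [u = alpha 1 (m)] satisfies [u * alpha f (m) q = alpha f (m) q].  By density
    some linear combination of the [alpha f (m) q] is close to 1, hence so is [u]. *)
Lemma alpha1 m : alpha (fun=> 1) m = 1.
Proof.
have s1 := smooth_cst (M := M) (1 : C).
set u := alpha _ m.
have [c cm] := cdom_cover m.
apply/eqP; rewrite -subr_eq0; apply/eqP/nrm_eq0/eqP; rewrite eq_le nrm_ge0 andbT.
apply: (@le0_eq0_eps _ _ (nrm u + 1)) => e e0.
have cK : chart_compact c [set cmap c m].
  by split; [exact: compact_set1|move=> _ ->; exact: cmap_cimg].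
have D1 := act_dense act (smooth_cst (M := M) (1 : Q)).
have FF : Filter (nbhs ((fun=> 1) : Cinf M Q)) by exact: nbhs_filter.
have /(cvg_CinfP (fun=> 1 : Q)) H : nbhs ((fun=> 1) : Cinf M Q) --> ((fun=> 1) : Cinf M Q) by [].
have {H} := D1 _ (H c [::] _ cK e e0).
case=> G [[k [b [w [Hw ->]]]]].
move=> /(_ (cmap c m) erefl) /=.
rewrite cmapK//; set G1 := (X in X m).
have uG : u * G1 m = G1 m.
  have -> : G1 m = \sum_(i < k) b i *: w i m.
    by rewrite /G1; elim/big_rec2: _ => [//|i y z _ <-].
  rewrite mulr_sumr; apply: eq_bigr => i _.
  rewrite (bilZr (qmul_bil Q)); congr (_ *: _).
  have [f [q [sf ->]]] := Hw i.
  have E : u * alpha f m = alpha f m.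
    rewrite /u -(alphaM m s1 sf); congr (alpha _ m).
    by apply/funext => m'; rewrite mul1r.
  by rewrite /= mulrA E.
move=> Ge.
(* G1 m is close to 1 and u * G1 m = G1 m. *)
have -> : u - 1 = (G1 m - 1) - u * (G1 m - 1).
  by rewrite mulrBr mulr1 uG opprB [RHS]addrC [RHS]addrA subrK.
apply: le_trans (nrmB _ _) _.
have -> : e * (nrm u + 1) = e + e * nrm u by rewrite mulrDr mulr1 addrC.
apply: lerD; first exact: ltW.
apply: le_trans (bil_bound (qmul_bil Q) _ _) _.
by rewrite mulrC ler_wpM2r ?nrm_ge0// ltW.
Qed.

Section Derivation.
Variables (c1 : atlas M) (i1 : 'I_n) (m1 : M).
Hypothesis cm1 : cdom c1 m1.
Local Notation a f := (alpha f m1).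
Local Notation D f := (dform (alpha f) c1 i1 m1).
Hypothesis comm : forall f g, smooth M C f -> smooth M C g ->
  dform (alpha f) c1 i1 m1 * alpha g m1 = alpha g m1 * dform (alpha f) c1 i1 m1.

Lemma dform_alphaD f g : smooth M C f -> smooth M C g -> D (fun m => f m + g m) = D f + D g.
Proof.
move=> sf sg; rewrite (alphaD sf sg) !dform_in//.
exact: (ipderivD [:: i1] (relopen_cimg c1) (act_smooth act sf c1) (act_smooth act sg c1) (cmap_cimg cm1)).
Qed.

Lemma dform_alphaM f g : smooth M C f -> smooth M C g ->
  D (fun m => f m * g m : C) = a f * D g + a g * D f.
Proof.
move=> sf sg; rewrite (alphaMl sf sg).
rewrite (dform_bil (qmul_bil Q) c1 i1 m1 (act_smooth act sf) (act_smooth act sg)).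
exact: (etrans (addrC _ _) (congr1 ( +%R _) (comm sf sg))).
Qed.

Lemma dform_alphaZ (k : C) f : smooth M C f -> D (fun m => k * f m : C) = (k : R[i]) *: D f.
Proof.
move=> sf; rewrite (alphaZ k sf).
have := dform_bil (scale_bil Q) c1 i1 m1 (smooth_cst (M := M) k) (act_smooth act sf).
rewrite (_ : dform (fun=> k) c1 i1 m1 = 0) ?scale0r ?add0r//.
rewrite dform_in//; exact: (pderiv_cst (relopen_cimg c1) i1 k (cmap_cimg cm1)).
Qed.

End Derivation.

End Action.

(** * The chain rule for continuous derivations *)

(** The Leibniz rule for the chain defect, with X, Y, Z the values of [D] at two
    functions and their product, w, z, y those of [a] at their partial derivatives,
    and d those of [D] at the coordinates.  The rules for Z and y are available only
    after localisation by the factor p. *)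
Lemma leibniz_defect (Q : pzRingType) (I : finType) (p u v X Y Z : Q) (w z y d : I -> Q) :
  p * Z = u * (p * Y) + v * (p * X) ->
  (forall j, p * y j = u * (p * z j) + v * (p * w j)) ->
  p * (X - \sum_j w j * d j) = 0 -> p * (Y - \sum_j z j * d j) = 0 ->
  p * (Z - \sum_j y j * d j) = 0.
Proof.
move=> pZ py; rewrite !mulrBr => /eqP; rewrite subr_eq0 => /eqP pX.
move=> /eqP; rewrite subr_eq0 => /eqP pY; apply/eqP; rewrite subr_eq0; apply/eqP.
rewrite pZ pX pY !mulr_sumr -big_split; apply: eq_bigr => j _ /=.
by rewrite [RHS]mulrA py mulrDl !mulrA.
Qed.

Section LocalChainRule.
Variables (R : realType) (n : nat) (M : smoothManifold R n) (Q : cstarType R).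
Local Notation C := (R[i]^o).
Local Notation rV := 'rV[R]_n.
Variables (a D : (M -> C) -> Q).
Hypothesis aD : forall f g, smooth M C f -> smooth M C g ->
  a (fun m => f m + g m) = a f + a g.
Hypothesis aM : forall f g, smooth M C f -> smooth M C g ->
  a (fun m => f m * g m : C) = a f * a g.
Hypothesis DD : forall f g, smooth M C f -> smooth M C g ->
  D (fun m => f m + g m) = D f + D g.
Hypothesis DZ : forall (k : C) f, smooth M C f ->
  D (fun m => k * f m : C) = (k : R[i]) *: D f.
Hypothesis DM : forall f g, smooth M C f -> smooth M C g ->
  D (fun m => f m * g m : C) = a f * D g + a g * D f.
Hypothesis aDcont : forall F : nat -> M -> C, (forall k, smooth M C (F k)) ->
  F @ \oo --> ((fun=> 0) : Cinf M C) ->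
  forall e : R, 0 < e -> \forall k \near \oo, nrm (a (F k)) < e /\ nrm (D (F k)) < e.

Variables (c : atlas M) (V : set rV) (lo hi : 'I_n -> R).
Hypotheses (oV : relopen V) (VC : V `<=` cimg c).
Hypothesis lohi : forall i, lo i < hi i.
Local Notation box := (box lo hi).
Hypothesis boxV : box `<=` V.
Hypothesis updV : forall i t x, V x -> lo i <= t <= hi i -> V (upd i t x).
(* theta0 brings functions on V to M; it is 1 where psi is not 0, and psi is 1
   where chi is not 0. *)
Variable theta0 : rV -> R.
Hypothesis theta0_smooth : smooth_on V (fun x => (theta0 x)%:C%C : C).
Hypothesis theta0_supp : forall x, V x -> theta0 x != 0 -> box x.
Variables (chi psi : M -> C).
Hypotheses (chi_smooth : smooth M C chi) (psi_smooth : smooth M C psi).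
Hypothesis chi_psi : forall m, chi m * psi m = chi m.
Hypothesis psi_supp : forall m, psi m != 0 ->
  [/\ cdom c m, V (cmap c m) & theta0 (cmap c m) = 1].
Implicit Types (m : M) (x : rV) (i j : 'I_n) (f g : rV -> C) (F G : M -> C).

Definition cutoff g : M -> C := ext0 c V (fun x => (theta0 x)%:C%C * g x : C).
Local Notation T := cutoff.
Local Notation coord j := (fun x : rV => (x 0 j)%:C%C : C).

Lemma cutoff_smooth g : smooth_on V g -> smooth M C (T g).
Proof.
move=> sg.
apply: (smooth_ext0 oV VC boxV _ (smooth_onM oV theta0_smooth sg)); first exact: box_compact.
move=> x Vx bx; have [->|t0] := eqVneq (theta0 x) 0; first by rewrite mul0r.
by case: bx; exact: theta0_supp.
Qed.

Lemma cutoff_eq f g : (forall x, V x -> f x = g x) -> T f = T g.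
Proof.
move=> fg; apply/funext => m; rewrite /cutoff /ext0; case: asboolP => // -[_ Vm].
by rewrite fg.
Qed.

Lemma cutoff_at g m : psi m != 0 -> T g m = g (cmap c m).
Proof. by move=> /psi_supp[cm Vm t1]; rewrite /cutoff ext0_in// t1 mul1r. Qed.

Lemma chi_eq F G : (forall m, psi m != 0 -> F m = G m) ->
  (fun m => chi m * F m : C) = (fun m => chi m * G m : C).
Proof.
move=> FG; apply/funext => m; have [p0|/FG->//] := eqVneq (psi m) 0.
by rewrite -chi_psi p0 mulr0 !mul0r.
Qed.

Let theta := T (fun=> 1).
Let theta_smooth : smooth M C theta := cutoff_smooth (smooth_on_cst (1 : C) oV).

Lemma cutoffM_theta f g : (fun m => T (fun x => f x * g x : C) m * theta m : C) =
  (fun m => T f m * T g m : C).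
Proof.
have aux (t u v : R[i]) : t * (u * v) * (t * 1) = t * u * (t * v) by ring.
apply/funext => m; rewrite /theta /cutoff /ext0; case: asboolP => _; last by rewrite mul0r.
exact: aux.
Qed.

Lemma aC F G : smooth M C F -> smooth M C G -> a F * a G = a G * a F.
Proof.
move=> sF sG; rewrite -(aM sF sG) -(aM sG sF); congr a.
by apply/funext => m; rewrite mulrC.
Qed.

Lemma achi_theta : a chi * a theta = a chi.
Proof.
rewrite -(aM chi_smooth theta_smooth) (@chi_eq theta (fun=> 1)).
  by under eq_fun do rewrite mulr1.
by move=> m pm; rewrite /theta cutoff_at.
Qed.

(** Derivations are local by the Leibniz rule: since [psi theta = psi], one has
    [a psi * D theta = D psi - a theta * D psi], which is killed by [a chi] because
    [chi theta = chi]. *)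
Lemma achi_Dtheta : a chi * D theta = 0.
Proof.
have pt : (fun m => psi m * theta m : C) = psi.
  apply/funext => m; have [->|pm] := eqVneq (psi m) 0; first by rewrite mul0r.
  by rewrite /theta cutoff_at// mulr1.
have cp : a chi = a chi * a psi.
  by rewrite -(aM chi_smooth psi_smooth); congr a; apply/funext => m; rewrite chi_psi.
have h := DM psi_smooth theta_smooth; rewrite pt in h.
have {}h : a psi * D theta = D psi - a theta * D psi by rewrite {1}h addrK.
by rewrite cp -mulrA h mulrBr mulrA achi_theta subrr.
Qed.

Lemma achi_cutoff F : smooth M C F -> a chi * D (fun m => F m * theta m : C) = a chi * D F.
Proof.
move=> sF; rewrite (DM sF theta_smooth) mulrDr !mulrA (aC chi_smooth sF).
by rewrite -mulrA achi_Dtheta mulr0 add0r achi_theta.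
Qed.

(** The failure of the chain rule at [g], localised by [chi]. *)
Definition chain_defect g : Q :=
  a chi * (D (T g) - \sum_j a (T (pderiv V j g)) * D (T (coord j))).
Local Notation E := chain_defect.

Let sT g : smooth_on V g -> smooth M C (T g) := @cutoff_smooth g.
Let sdT g j : smooth_on V g -> smooth M C (T (pderiv V j g)) :=
  fun sg => cutoff_smooth (smooth_on_ipderiv [:: j] sg).

Lemma cutoffD f g : T (fun x => f x + g x) = (fun m => T f m + T g m).
Proof.
apply/funext => m; rewrite /cutoff /ext0; case: asboolP => _; last by rewrite addr0.
exact: mulrDr.
Qed.

Lemma chain_defectD f g : smooth_on V f -> smooth_on V g ->
  E (fun x => f x + g x) = E f + E g.
Proof.
move=> sf sg; rewrite /chain_defect -mulrDr; congr (_ * _).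
rewrite cutoffD (DD (sT sf) (sT sg)) addrACA -opprD; congr (_ - _).
rewrite -big_split; apply: eq_bigr => j _ /=.
rewrite -mulrDl -(aD (sdT j sf) (sdT j sg)) -cutoffD; congr (a _ * _).
by apply: cutoff_eq => x Vx; exact: (pderivD oV j sf sg Vx).
Qed.

(** [chi] absorbs [theta], so that [T (f g)] may be replaced by [T f * T g]. *)
Lemma chain_defectM f g : smooth_on V f -> smooth_on V g -> E f = 0 -> E g = 0 ->
  E (fun x => f x * g x : C) = 0.
Proof.
move=> sf sg; have sfg := smooth_onM oV sf sg.
have pZ : a chi * D (T (fun x => f x * g x : C)) =
    a (T f) * (a chi * D (T g)) + a (T g) * (a chi * D (T f)).
  rewrite -(achi_cutoff (sT sfg)) cutoffM_theta (DM (sT sf) (sT sg)) mulrDr !mulrA.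
  by rewrite (aC chi_smooth (sT sf)) (aC chi_smooth (sT sg)).
have py j : a chi * a (T (pderiv V j (fun x => f x * g x : C))) =
    a (T f) * (a chi * a (T (pderiv V j g))) + a (T g) * (a chi * a (T (pderiv V j f))).
  have s1 := sdT j sf; have s2 := sdT j sg; have sF := sT sf; have sG := sT sg.
  rewrite !mulrA -(aC chi_smooth sF) -(aC chi_smooth sG) -!mulrA -mulrDr.
  have s12 := smooth_bil (cmul_bil R) sF s2; have s21 := smooth_bil (cmul_bil R) sG s1.
  rewrite -(aM sF s2) -(aM sG s1) -(aD s12 s21).
  rewrite -(aM chi_smooth (sdT j sfg)) -(aM chi_smooth (smoothD s12 s21)); congr a.
  apply: chi_eq => m pm; have [cm Vm _] := psi_supp pm.
  have aux (p q r t : R[i]) : p * q + r * t = r * t + q * p by ring.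
  apply: (etrans (cutoff_at _ pm)); apply: (etrans (pderivM oV j sf sg Vm)).
  apply: (etrans (aux _ _ _ _)); apply: esym; apply: congr2.
    exact: (congr2 *%R (cutoff_at f pm) (cutoff_at _ pm)).
  exact: (congr2 *%R (cutoff_at g pm) (cutoff_at _ pm)).
exact: (leibniz_defect pZ py).
Qed.

Lemma a_zero : a (fun=> 0) = 0.
Proof.
have s0 := smooth_cst (M := M) (0 : C).
have := aD s0 s0; under eq_fun do rewrite addr0.
by move=> h; apply: (addrI (a (fun=> 0))); rewrite addr0 -h.
Qed.

Lemma cutoff_zero : T (fun=> 0) = fun=> 0.
Proof. by apply/funext => m; rewrite /cutoff /ext0 mulr0; case: ifP. Qed.

Lemma chain_defect_cst (k : C) : E (fun=> k) = 0.
Proof.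
rewrite /chain_defect big1 ?subr0.
  have -> : T (fun=> k) = fun m => k * theta m.
    by apply/funext => m; rewrite /theta /cutoff /ext0; case: asboolP => _; rewrite ?mulr0// mulr1 mulrC.
  by rewrite (DZ k theta_smooth) (bilZr (qmul_bil Q)) achi_Dtheta scaler0.
move=> j _; rewrite (@cutoff_eq _ (fun=> 0)) ?cutoff_zero ?a_zero ?mul0r// => x Vx.
exact: (pderiv_cst oV j k Vx).
Qed.

Lemma chain_defect_coord i : E (coord i) = 0.
Proof.
have sc := smooth_coord i oV.
rewrite /chain_defect (bigD1 i)//= big1 ?addr0.
  rewrite (@cutoff_eq (pderiv V i (coord i)) (fun=> 1)).
    by rewrite mulrBr mulrA achi_theta subrr.
  by move=> x Vx; rewrite (pderiv_coord i i oV Vx) eqxx.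
move=> j ji; rewrite (@cutoff_eq _ (fun=> 0)) ?cutoff_zero ?a_zero ?mul0r// => x Vx.
by rewrite (pderiv_coord j i oV Vx) eq_sym (negbTE ji).
Qed.

Lemma cutoff_cvg0 (g : nat -> rV -> C) : (forall k, smooth_on V (g k)) ->
  (forall N (d : R), 0 < d -> \forall k \near \oo, forall s, (size s <= N)%N ->
     forall x, box x -> nrm (ipderiv V s (g k) x) <= d) ->
  (fun k => T (g k)) @ \oo --> ((fun=> 0) : Cinf M C).
Proof.
move=> sg Hg.
have cb : compact box by exact: box_compact.
apply/cvg_CinfP => c' s K' cK' e e0.
have [B B0 HB] := ext0_jet_bound C oV VC boxV cb s cK'.
have e2 : 0 < e / 2 by rewrite divr_gt0.
have d0 := divC_gt0 e2 B0; set d := e / 2 / (B + 1) in d0.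
have Bd : B * d <= e / 2 by rewrite mulrC; exact: divC_le.
have [d' d'0 Hd'] := bil_small (size s) (cmul_bil R) oV theta0_smooth cb boxV d0.
have N := Hg (size s) d' d'0.
suff: \forall k \near \oo, forall x, K' x -> nrm (ipderiv (cimg c') s (T (g k) \o cinv c') x -
  ipderiv (cimg c') s ((fun=> 0 : C) \o cinv c') x) < e by [].
near=> k => x K'x; have Cx := cK'.2 _ K'x.
have -> : ipderiv (cimg c') s ((fun=> 0) \o cinv c') x = 0 :> C.
  exact: (ipderiv0 C s (relopen_cimg c') Cx).
rewrite subr0.
have sk := smooth_onM oV theta0_smooth (sg k).
have supp : supported V box (fun x => (theta0 x)%:C%C * g k x : C).
  move=> y Vy by_; have [->|t0] := eqVneq (theta0 y) 0; first by rewrite mul0r.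
  by case: by_; exact: theta0_supp.
apply: (@le_lt_trans _ _ (B * d)); last by apply: le_lt_trans Bd _; lra.
have Jk : forall t, (size t <= size s)%N -> forall y, box y -> nrm (ipderiv V t (g k) y) <= d'.
  by near: k.
exact: (HB _ d (ltW d0) sk supp (Hd' _ (sg k) Jk) x K'x).
Unshelve. all: by end_near. Qed.

(** Otherwise there are functions [F k] with jets of order at most [k] bounded by
    1/(k+1) on the box and defects bounded from below, although their cut-offs and
    those of their derivatives tend to 0. *)
Lemma chain_defect_cont (e : R) : 0 < e -> exists L, exists2 d : R, 0 < d &
  forall f, smooth_on V f ->
    (forall s, (size s <= L)%N -> forall x, box x -> nrm (ipderiv V s f x) <= d) ->
    nrm (E f) <= e.
Proof.
move=> e0; apply: contrapT => H.
have /choice[F HF] : forall k : nat, exists f : rV -> C, [/\ smooth_on V f,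
    forall s, (size s <= k)%N -> forall x, box x -> nrm (ipderiv V s f x) <= k.+1%:R^-1 &
    e < nrm (E f)].
  move=> k; apply: contrapT => Hk; apply: H; exists k, k.+1%:R^-1; first by rewrite invr_gt0.
  move=> f sf Hf; rewrite leNgt; apply/negP => Ef; apply: Hk; by exists f.
have sF k : smooth_on V (F k) by case: (HF k).
have null N (d : R) : 0 < d -> \forall k \near \oo, forall s, (size s <= N)%N ->
     forall x, box x -> nrm (ipderiv V s (F k) x) <= d.
  move=> d0; near=> k => s sN x bx; have [_ h _] := HF k.
  have Nk : (N <= k)%N by near: k; exact: nbhs_infty_ge.
  apply: le_trans (h s (leq_trans sN Nk) x bx) _.
  rewrite -[d]invrK lef_pV2 ?posrE ?invr_gt0//.
  have dk : d^-1 <= k%:R by near: k; exact: nbhs_infty_ger.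
  by apply: le_trans dk _; rewrite ler_nat.
have nullj j N (d : R) : 0 < d -> \forall k \near \oo, forall s, (size s <= N)%N ->
     forall x, box x -> nrm (ipderiv V s (pderiv V j (F k)) x) <= d.
  move=> d0; apply: filterS (null N.+1 d d0) => k h s sN x bx.
  have := h (s ++ [:: j]); rewrite size_cat addn1 ltnS => /(_ sN x bx).
  by rewrite ipderiv_cat.
pose A := nrm (a chi); pose S := \sum_j nrm (D (T (coord j))).
have A0 : 0 <= A by exact: nrm_ge0.
have S0 : 0 <= S by apply: sumr_ge0 => j _; exact: nrm_ge0.
have AS0 : 0 <= A * (1 + S) by rewrite mulr_ge0// addr_ge0.
have e'0 := divC_gt0 e0 AS0; set e' := e / _ in e'0.
have N1 := aDcont (fun k => sT (sF k)) (cutoff_cvg0 sF null) e'0.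
have N2 : \forall k \near \oo, forall j, nrm (a (T (pderiv V j (F k)))) < e'.
  apply: (@filter_forall _ _ (fun j k => nrm (a (T (pderiv V j (F k)))) < e') \oo) => j.
  apply: filterS (aDcont (fun k => sdT j (sF k))
    (cutoff_cvg0 (fun k => smooth_on_ipderiv [:: j] (sF k)) (nullj j)) e'0) => k [].
  by [].
have [k [[_ k1] k2]] := filter_ex (filterI N1 N2).
have [_ _] := HF k; apply/negP; rewrite -leNgt.
apply: le_trans (bil_bound (qmul_bil Q) _ _) _.
apply: (@le_trans _ _ (A * ((1 + S) * e'))).
  rewrite ler_wpM2l// mulrDl mul1r; apply: le_trans (nrmB _ _) _.
  apply: lerD; first exact: ltW.
  apply: le_trans (nrm_sum _ _ _) _; rewrite /S mulr_suml; apply: ler_sum => j _.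
  apply: le_trans (bil_bound (qmul_bil Q) _ _) _.
  by rewrite mulrC ler_wpM2l ?nrm_ge0// ltW.
by rewrite mulrA mulrC; exact: divC_le.
Unshelve. all: by end_near. Qed.

(** The defect is a continuous derivation that kills the coordinates, hence
    vanishes.  Off the support of [psi] cutting off makes a difference, but [chi]
    hides it. *)
Lemma local_chain_rule F : smooth M C F ->
  a chi * D F = \sum_j a (fun m => chi m * dform F c j m : C) * D (T (coord j)).
Proof.
move=> sF; have oc := relopen_cimg c.
pose g : rV -> C := F \o cinv c.
have sg : smooth_on V g by exact: (smooth_on_sub oc oV VC (sF c)).
have : E g = 0.
  exact: (derivation_eq0 oV lohi boxV updV chain_defectD chain_defectM
    chain_defect_cst chain_defect_coord chain_defect_cont sg).
rewrite /chain_defect mulrBr mulr_sumr => /eqP; rewrite subr_eq0 => /eqP h.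
have Tg : T g = (fun m => F m * theta m : C).
  apply/funext => m; rewrite /theta /cutoff /ext0; case: asboolP => [[cm Vm]|_]; last by rewrite mulr0.
  by rewrite mulr1 mulrC /g /= cmapK.
rewrite -(achi_cutoff sF) -Tg h; apply: eq_bigr => j _; rewrite mulrA; congr (_ * _).
rewrite -(aM chi_smooth (sdT j sg)); congr a; apply: chi_eq => m pm.
have [cm Vm _] := psi_supp pm.
apply: (etrans (cutoff_at _ pm)); apply: esym; apply: (etrans (dform_in F j cm)).
have Cm := cmap_cimg cm.
apply: (pderiv_near j oc oV Cm Vm); near=> y; done.
Unshelve. all: by end_near. Qed.

End LocalChainRule.

(** * Continuity of the operations that make up the bimodule map *)

Section CutForms.
Variables (R : realType) (n : nat) (M : smoothManifold R n).
Local Notation C := (R[i]^o).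
Local Notation rV := 'rV[R]_n.
Variables (c : atlas M) (K : set rV) (chi : M -> C).
Hypotheses (cK : compact K) (KC : K `<=` cimg c) (chi_smooth : smooth M C chi).
Hypothesis chi_supp : forall m, chi m != 0 -> cdom c m /\ K (cmap c m).

Lemma cut_ext0 (g : M -> C) : (fun m => chi m * g m : C) =
  ext0 c (cimg c) ((fun x => chi (cinv c x) * g (cinv c x) : C)).
Proof.
apply/funext => m; rewrite /ext0; case: asboolP => [[cm _]|nm]; first by rewrite cmapK.
have [->|/chi_supp[cm _]] := eqVneq (chi m) 0; first by rewrite mul0r.
by case: nm; split=> //; exact: cmap_cimg.
Qed.

Lemma cut_supported (g : M -> C) :
  supported (cimg c) K (fun x => chi (cinv c x) * g (cinv c x) : C).
Proof.
move=> x Cx Kx; have [->|/chi_supp[_]] := eqVneq (chi (cinv c x)) 0; first by rewrite mul0r.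
by rewrite (cimg_cinv Cx).2.
Qed.

Lemma smooth_cut (w : form_family M C) j : one_form M C w ->
  smooth M C (fun m => chi m * w c j m : C).
Proof.
move=> [_ sw _]; rewrite cut_ext0.
have oc := relopen_cimg c.
exact: (smooth_ext0 oc (fun x (h : cimg c x) => h) KC cK
  (smooth_onM oc (chi_smooth c) (sw c j)) (@cut_supported (w c j))).
Qed.

(** [chi w_j] is an extension by zero from the chart [c]: [ext0_jet_bound] controls
    its jets in all charts by its jets on [K], and [bil_small] these by those of
    [w_j]. *)
Lemma cvg_cut (w0 : form_family M C) j (F : set_system (form_family M C)) : Filter F ->
  one_form M C w0 -> (\forall w \near F, one_form M C w) -> F --> (w0 : Omega1 M C) ->
  (fun w m => chi m * w c j m : C) @ F --> ((fun m => chi m * w0 c j m) : Cinf M C).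
Proof.
move=> FF ow0 oF /cvg_Omega1P Fw0; apply/cvg_CinfP => c' s K' cK' e e0.
have oc := relopen_cimg c; have oc' := relopen_cimg c'.
have [B B0 HB] := ext0_jet_bound C oc (fun x (h : cimg c x) => h) KC cK s cK'.
have e2 : 0 < e / 2 by rewrite divr_gt0.
have d0 := divC_gt0 e2 B0; set d := e / 2 / (B + 1) in d0.
have Bd : B * d <= e / 2 by rewrite mulrC; exact: divC_le.
have [d' d'0 Hd'] := bil_small (size s) (cmul_bil R) oc (chi_smooth c) cK KC d0.
have N : \forall w \near F, forall t : (size s).-bseq 'I_n, forall x, K x ->
    nrm (ipderiv (cimg c) t (w c j \o cinv c) x - ipderiv (cimg c) t (w0 c j \o cinv c) x) < d'.
  apply: (@filter_forall (form_family M C) _ (fun (t : (size s).-bseq 'I_n) (w : form_family M C) =>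
    forall x, K x ->
    nrm (ipderiv (cimg c) t (w c j \o cinv c) x - ipderiv (cimg c) t (w0 c j \o cinv c) x) < d') F FF) => t.
  exact: (Fw0 c j t K (conj cK KC) d' d'0).
suff: \forall w \near F, forall x, K' x ->
   nrm (ipderiv (cimg c') s ((fun m => chi m * w c j m : C) \o cinv c') x -
        ipderiv (cimg c') s ((fun m => chi m * w0 c j m : C) \o cinv c') x) < e by [].
apply: filterS (filterI oF N) => w [ow Hw] x K'x.
have Cx := cK'.2 _ K'x.
have sw := smooth_cut j ow; have sw0 := smooth_cut j ow0.
have [_ swc _] := ow; have [_ sw0c _] := ow0.
pose u : M -> C := fun m => w c j m - w0 c j m.
have su : smooth_on (cimg c) (u \o cinv c) by exact: (smooth_onB oc (swc c j) (sw0c c j)).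
have E := ipderivB s oc' (sw c') (sw0 c') Cx.
apply: (@le_lt_trans _ _ (B * d)); last by apply: le_lt_trans Bd _; lra.
have -> : ipderiv (cimg c') s ((fun m => chi m * w c j m : C) \o cinv c') x -
        ipderiv (cimg c') s ((fun m => chi m * w0 c j m : C) \o cinv c') x =
   ipderiv (cimg c') s (ext0 c (cimg c) (fun x => chi (cinv c x) * u (cinv c x) : C) \o cinv c') x.
  apply: (etrans (esym E)); congr (ipderiv _ _ _ _); rewrite -(cut_ext0 u).
  by apply/funext => y; rewrite /= -mulrBr.
apply: (HB _ d (ltW d0) (smooth_onM oc (chi_smooth c) su) (@cut_supported u) _ x K'x).
apply: (Hd' (u \o cinv c) su) => t ts y Ky.
have Et := ipderivB t oc (swc c j) (sw0c c j) (KC Ky).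
apply: (@le_trans _ _ (nrm (ipderiv (cimg c) t (w c j \o cinv c) y - ipderiv (cimg c) t (w0 c j \o cinv c) y))).
  by rewrite -[X in _ <= nrm X]Et.
exact: (ltW (Hw (Bseq ts) y Ky)).
Qed.

End CutForms.

Section FormConvergence.
Variables (R : realType) (n : nat) (M : smoothManifold R n).
Variables (W1 W2 W3 : normedModType R[i]) (B : W1 -> W2 -> W3).
Hypothesis bB : bounded_bilinear B.
Variables (T : Type) (F : set_system T).
Hypothesis FF : Filter F.

Lemma cvg_bil_form (G : T -> M -> W1) (G0 : M -> W1) (w : form_family M W2) :
  (\forall t \near F, smooth M W1 (G t)) -> smooth M W1 G0 -> one_form M W2 w ->
  G @ F --> (G0 : Cinf M W1) ->
  (fun t c i m => B (G t m) (w c i m)) @ F --> ((fun c i m => B (G0 m) (w c i m)) : Omega1 M W3).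
Proof.
move=> sG sG0 [_ sw _] /cvg_CinfP HG; apply/cvg_Omega1P => c i s K cK e e0.
have oc := relopen_cimg c.
have e2 : 0 < e / 2 by rewrite divr_gt0.
have [d d0 Hd] := bil_small (size s) (bil_flip bB) oc (sw c i) cK.1 cK.2 e2.
have N : \forall t \near F, forall u : (size s).-bseq 'I_n, forall x, K x ->
    nrm (ipderiv (cimg c) u (G t \o cinv c) x - ipderiv (cimg c) u (G0 \o cinv c) x) < d.
  apply: (@filter_forall _ _ (fun (u : (size s).-bseq 'I_n) t => forall x, K x ->
    nrm (ipderiv (cimg c) u (G t \o cinv c) x - ipderiv (cimg c) u (G0 \o cinv c) x) < d) F FF) => u.
  exact: (HG c u K cK d d0).
suff: \forall t \near F, forall x, K x ->
   nrm (ipderiv (cimg c) s ((fun m => B (G t m) (w c i m)) \o cinv c) x -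
        ipderiv (cimg c) s ((fun m => B (G0 m) (w c i m)) \o cinv c) x) < e by [].
apply: filterS (filterI sG N) => t [sGt Ht] x Kx; have Cx := cK.2 _ Kx.
have s1 := smooth_on_bil bB oc (sGt c) (sw c i).
have s2 := smooth_on_bil bB oc (sG0 c) (sw c i).
have E := ipderivB s oc s1 s2 Cx.
pose u m := G t m - G0 m.
have su := smooth_onB oc (sGt c) (sG0 c).
apply: (@le_lt_trans _ _ (e / 2)); last by lra.
rewrite -[X in nrm X]E.
have -> : (fun x => B ((G t \o cinv c) x) ((w c i \o cinv c) x) -
    B ((G0 \o cinv c) x) ((w c i \o cinv c) x)) =
   (fun x => B ((u \o cinv c) x) ((w c i \o cinv c) x)).
  by apply/funext => y; rewrite /u /= (bilBl bB).
apply: (Hd (u \o cinv c) su _ s (leqnn _) x Kx) => r rs y Ky.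
have Er := ipderivB r oc (sGt c) (sG0 c) (cK.2 _ Ky).
apply: (@le_trans _ _ (nrm (ipderiv (cimg c) r (G t \o cinv c) y - ipderiv (cimg c) r (G0 \o cinv c) y))).
  by rewrite -[X in _ <= nrm X]Er.
exact: (ltW (Ht (Bseq rs) y Ky)).
Qed.

End FormConvergence.

Lemma cvg_sum_form (R : realType) (n : nat) (M : smoothManifold R n) (W : normedModType R[i])
    (T : Type) (F : set_system T) (FF : Filter F) (I : finType)
    (w : I -> T -> form_family M W) (w0 : I -> form_family M W) :
  (forall p, \forall t \near F, one_form M W (w p t)) -> (forall p, one_form M W (w0 p)) ->
  (forall p, w p @ F --> (w0 p : Omega1 M W)) ->
  (fun t c i m => \sum_p w p t c i m) @ F --> ((fun c i m => \sum_p w0 p c i m) : Omega1 M W).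
Proof.
move=> ow ow0 H; apply/cvg_Omega1P => c i s K cK e e0.
have oc := relopen_cimg c.
pose N0 : R := #|I|%:R; have N00 : 0 <= N0 by rewrite ler0n.
have d0 := divC_gt0 e0 N00.
have NH : \forall t \near F, forall p : I, one_form M W (w p t) /\ forall x, K x ->
    nrm (ipderiv (cimg c) s (w p t c i \o cinv c) x - ipderiv (cimg c) s (w0 p c i \o cinv c) x)
      < e / (N0 + 1).
  apply: (@filter_forall _ _ (fun (p : I) t => one_form M W (w p t) /\ forall x, K x ->
    nrm (ipderiv (cimg c) s (w p t c i \o cinv c) x - ipderiv (cimg c) s (w0 p c i \o cinv c) x)
      < e / (N0 + 1)) F FF) => p.
  by apply: filterI; [exact: ow|have /cvg_Omega1P := H p; move=> /(_ c i s K cK _ d0)].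
suff: \forall t \near F, forall x, K x ->
   nrm (ipderiv (cimg c) s ((fun m => \sum_p w p t c i m) \o cinv c) x -
        ipderiv (cimg c) s ((fun m => \sum_p w0 p c i m) \o cinv c) x) < e by [].
apply: filterS NH => t Ht x Kx; have Cx := cK.2 _ Kx.
have E1 := ipderiv_sum (F := fun p => w p t c i \o cinv c) (r := index_enum I) s oc
  (fun p _ => let: And3 _ a _ := (Ht p).1 in a c i) Cx.
have E2 := ipderiv_sum (F := fun p => w0 p c i \o cinv c) (r := index_enum I) s oc
  (fun p _ => let: And3 _ a _ := ow0 p in a c i) Cx.
apply: (@le_lt_trans _ _ (nrm (\sum_p ipderiv (cimg c) s (w p t c i \o cinv c) x -
   \sum_p ipderiv (cimg c) s (w0 p c i \o cinv c) x))).
  by rewrite -[X in _ <= nrm (X - _)]E1 -[X in _ <= nrm (_ - X)]E2.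
rewrite -sumrB; apply: le_lt_trans (nrm_sum _ _ _) _.
apply: (@le_lt_trans _ _ (\sum_(p : I) e / (N0 + 1))).
  by apply: ler_sum => p _; apply/ltW/(Ht p).2.
have N1 : 0 < N0 + 1 by rewrite ltr_wpDl.
rewrite sumr_const -[X in X < _]mulr_natl -/N0 mulrA ltr_pdivrMr// mulrC ltr_pM2l//; lra.
Qed.

(** * Cut-off coordinates in which the chain rule holds *)

Section Beta.
Variables (R : realType) (n : nat) (M : smoothManifold R n) (Q : compactQuantumGroup R).
Variable alpha : (M -> R[i]^o) -> (M -> Q).
Hypothesis act : smooth_action alpha.
Local Notation C := (R[i]^o).
Local Notation rV := 'rV[R]_n.
Implicit Types (c : atlas M) (m : M) (i j : 'I_n) (f g : M -> C).

Hypothesis comm : forall f g c i m, smooth M C f -> smooth M C g ->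
  dform (alpha f) c i m * alpha g m = alpha g m * dform (alpha f) c i m.

Lemma alpha_cvg (T : Type) (F : set_system T) (G : T -> M -> C) (g0 : M -> C) : Filter F ->
  (\forall t \near F, smooth M C (G t)) -> smooth M C g0 -> G @ F --> (g0 : Cinf M C) ->
  (fun t => alpha (G t)) @ F --> (alpha g0 : Cinf M Q).
Proof.
move=> FF sG sg0 HG.
have /subspace_continuousP H := act_continuous act.
move=> A HA.
have N : \forall g \near (g0 : Cinf M C), smooth M C g -> A (alpha g).
  exact: (H g0 sg0 A HA).
have N' : \forall t \near F, smooth M C (G t) -> A (alpha (G t)) by exact: (HG _ N).
by apply: filterS (filterI sG N') => t [a b]; exact: b.
Qed.

Lemma alpha_jet_cvg0 c1 i1 m1 : cdom c1 m1 -> forall F : nat -> M -> C,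
  (forall k, smooth M C (F k)) -> F @ \oo --> ((fun=> 0) : Cinf M C) ->
  forall e : R, 0 < e -> \forall k \near \oo,
    nrm (alpha (F k) m1) < e /\ nrm (dform (alpha (F k)) c1 i1 m1) < e.
Proof.
move=> cm1 F sF HF e e0.
have H : (fun k => alpha (F k)) @ \oo --> (alpha (fun=> 0) : Cinf M Q).
  have sN : \forall k \near \oo, smooth M C (F k) by near=> k; exact: sF.
  exact: (@alpha_cvg nat \oo F (fun=> 0) _ sN (smooth_cst (M := M) (0 : C)) HF).
have cK : chart_compact c1 [set cmap c1 m1].
  by split; [exact: compact_set1|move=> _ ->; exact: cmap_cimg].
move/cvg_CinfP: H => H.
have z s : ipderiv (cimg c1) s (alpha (fun=> 0) \o cinv c1) (cmap c1 m1) = 0.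
  by rewrite (alpha0 act); exact: (ipderiv0 Q s (relopen_cimg c1) (cmap_cimg cm1)).
have Hs s : \forall k \near \oo, forall x, [set cmap c1 m1] x ->
    nrm (ipderiv (cimg c1) s (alpha (F k) \o cinv c1) x -
         ipderiv (cimg c1) s (alpha (fun=> 0) \o cinv c1) x) < e.
  exact: (H c1 s _ cK e e0).
suff: \forall k \near \oo,
    nrm (alpha (F k) m1) < e /\ nrm (dform (alpha (F k)) c1 i1 m1) < e by [].
apply: filterS (filterI (Hs [::]) (Hs [:: i1])) => k [/(_ _ erefl) h0 /(_ _ erefl) h1].
split.
  by move: h0; rewrite z subr0 /= cmapK.
by move: h1; rewrite z subr0 dform_in.
Unshelve. all: by end_near. Qed.

(** Coordinates of [c] cut off to functions [xt] on M.  The chain rule is required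
    for every [chi] on whose support [psi] is 1, and not for [phi] alone, because
    the members of the partition of unity will be multiples of [phi]. *)
Record patch (c : atlas M) (K : set rV) (xt : 'I_n -> M -> C) (phi psi : M -> C)
    (U : set M) : Prop := Patch {
  patch_open : open U;
  patch_phi1 : forall m, U m -> phi m = 1;
  patch_phi : smooth M C phi;
  patch_psi : smooth M C psi;
  patch_phi_psi : forall m, phi m * psi m = phi m;
  patch_K : compact K;
  patch_KC : K `<=` cimg c;
  patch_supp : forall m, psi m != 0 -> cdom c m /\ K (cmap c m);
  patch_xt : forall j, smooth M C (xt j);
  patch_chain : forall chi f c1 i1 m1, smooth M C chi -> (forall m, chi m * psi m = chi m) ->
    smooth M C f -> cdom c1 m1 ->
    alpha chi m1 * dform (alpha f) c1 i1 m1 =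
      \sum_j alpha (fun m => chi m * dform f c j m : C) m1 * dform (alpha (xt j)) c1 i1 m1
}.

(** Four radii [d > d1 > d2 > d3], where the plateau function of each radius is 1 at
    the points where the next one does not vanish: [theta0] cuts off the
    coordinates, [psi] is 1 where [phi] is not 0, and [phi] is 1 near [m0]. *)
Lemma patch_exists m0 : exists c K xt phi psi U, U m0 /\ patch c K xt phi psi U.
Proof.
have [c cm0] := cdom_cover m0; have oc := relopen_cimg c.
have [V [lo [hi [d [[oV VC] lohi bV updV [d0 dbox]]]]]] := box_exists oc (cmap_cimg cm0).
set p := cmap c m0 in dbox.
have [theta0 [stheta [d1 d10 theta1] thetad]] := bump_exists p d0.
have [psi0 [spsi [d2 d20 psi1] psid]] := bump_exists p d10.
have [phi0 [sphi [d3 d30 phi1] phid]] := bump_exists p d20.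
have cb : compact (box lo hi) by exact: box_compact.
have bC : box lo hi `<=` cimg c by move=> x /bV/VC.
have Vp : V p by apply: bV; apply: dbox; [exact: cmap_cimg|move=> k; rewrite subrr normr0].
have psi_theta x : psi0 x != 0 -> theta0 x = 1 by move/psid/theta1.
have phi_psi x : phi0 x != 0 -> psi0 x = 1 by move/phid/psi1.
have theta_box x : V x -> theta0 x != 0 -> box lo hi x.
  by move=> /VC Cx /thetad; exact: dbox.
have psi_box x : V x -> psi0 x != 0 -> box lo hi x.
  by move=> Vx /psi_theta t1; apply: theta_box => //; rewrite t1 oner_eq0.
have phi_box x : V x -> phi0 x != 0 -> box lo hi x.
  by move=> Vx /phi_psi t1; apply: psi_box => //; rewrite t1 oner_eq0.
have ext_smooth (u : rV -> R) : (forall V', relopen V' -> smooth_on V' (fun x => (u x)%:C%C : C)) ->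
    (forall x, V x -> u x != 0 -> box lo hi x) ->
    smooth M C (ext0 c V (fun x => (u x)%:C%C : C)).
  move=> su ubox; apply: (smooth_ext0 oV VC bV cb (su V oV)) => x Vx bx.
  by have [->//|ux] := eqVneq (u x) 0; case: bx; exact: ubox.
pose phi := ext0 c V (fun x => (phi0 x)%:C%C : C).
pose psi := ext0 c V (fun x => (psi0 x)%:C%C : C).
pose V3 := [set x | V x /\ close d3 p x].
have oV3 : relopen V3 by exact: relopen_close.
have psi_supp m : psi m != 0 -> [/\ cdom c m, V (cmap c m) & theta0 (cmap c m) = 1].
  rewrite /psi /ext0; case: asboolP => [[cm Vm]|_]; last by rewrite eqxx.
  move=> pn; split=> //; apply: psi_theta; apply: contra_neq pn => ->; exact: rmorph0.
have spsiM : smooth M C psi by exact: (ext_smooth psi0 spsi psi_box).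
exists c, (box lo hi), (fun j => cutoff c V theta0 (fun x => (x 0 j)%:C%C)), phi, psi,
  [set m | cdom c m /\ V3 (cmap c m)]; split.
  by split=> //; split=> // k; rewrite subrr normr0.
split.
- exact: (open_dom c oV3).
- by move=> m [cm [Vm mp]]; rewrite /phi ext0_in// phi1.
- exact: (ext_smooth phi0 sphi phi_box).
- exact: spsiM.
- move=> m; rewrite /phi /psi /ext0; case: asboolP => _; last by rewrite mul0r.
  have [->|/phi_psi->] := eqVneq (phi0 (cmap c m)) 0; first by rewrite mul0r.
  by rewrite mulr1.
- exact: cb.
- exact: bC.
- move=> m; rewrite /psi /ext0; case: asboolP => [[cm Vm]|_]; last by rewrite eqxx.
  move=> pn; split=> //; apply: psi_box => //; apply: contra_neq pn => ->; exact: rmorph0.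
- move=> j.
  exact: (cutoff_smooth oV VC bV (stheta V oV) theta_box (smooth_coord j oV)).
move=> chi f c1 i1 m1 schi chipsi sf cm1.
have aD f1 g1 (h1 : smooth M C f1) (h2 : smooth M C g1) :
   alpha (fun m => f1 m + g1 m) m1 = alpha f1 m1 + alpha g1 m1 by rewrite (alphaD act h1 h2).
have key := (local_chain_rule (a := fun f => alpha f m1) (D := fun f => dform (alpha f) c1 i1 m1)
  aD (fun f1 g1 => @alphaM _ _ _ _ _ act f1 g1 m1)
  (dform_alphaD act i1 cm1) (dform_alphaZ act i1 cm1)
  (dform_alphaM act (fun f1 g1 => @comm f1 g1 c1 i1 m1))
  (@alpha_jet_cvg0 c1 i1 m1 cm1)
  oV VC lohi bV updV (stheta V oV) theta_box schi spsiM chipsi psi_supp sf).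
exact: key.
Qed.

End Beta.

(** * The partition of unity and the bimodule map *)

Section Partition.
Variables (R : realType) (n : nat) (M : smoothManifold R n).
Local Notation C := (R[i]^o).
Variable phi : nat -> M -> C.
Hypothesis phi_smooth : forall k, smooth M C (phi k).

(** The sum of these functions telescopes and equals 1 wherever some [phi k] does;
    no division is involved. *)
Definition bump_part (k : nat) : M -> C := fun m => phi k m * \prod_(j < k) (1 - phi j m).

Lemma smooth_bump_part k : smooth M C (bump_part k).
Proof.
apply: (smooth_bil (cmul_bil R) (phi_smooth k)).
elim: k => [|k IH].
  by under eq_fun do rewrite big_ord0; exact: (smooth_cst (M := M) (1 : C)).
under eq_fun do rewrite big_ord_recr.
exact: (smooth_bil (cmul_bil R) IH (smoothB (smooth_cst (M := M) (1 : C)) (phi_smooth k))).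
Qed.

Lemma sum_bump_part N m : \sum_(k < N) bump_part k m = 1 - \prod_(k < N) (1 - phi k m).
Proof.
elim: N => [|N IH]; first by rewrite !big_ord0 subrr.
rewrite !big_ord_recr /= IH /bump_part.
set p := \prod_(j < N) _; set q := phi N m.
by change (1 - p + q * p = 1 - p * (1 - q) :> R[i]); ring.
Qed.

Lemma sum_bump_part1 N m k : (k < N)%N -> phi k m = 1 -> \sum_(k < N) bump_part k m = 1.
Proof.
move=> kN pk; rewrite sum_bump_part (bigD1 (Ordinal kN))//= pk subrr.
by rewrite [X in _ - X](_ : _ = 0) ?subr0//; exact: mul0r.
Qed.

End Partition.

(** Index the near-covering property by finite sequences ordered by inclusion. *)
Lemma finite_subcover (T : topologicalType) (U : T -> set T) : compact [set: T] ->
  (forall x, open (U x)) -> (forall x, U x x) ->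
  exists s : seq T, forall x, exists2 y, y \in s & U y x.
Proof.
move=> cT oU Ux.
pose F := filter_from [set: seq T] (fun s0 => [set s : seq T | {subset s0 <= s}]).
have FF : Filter F.
  apply: filter_from_filter; first by exists [::].
  move=> s t _ _; exists (s ++ t) => // r str.
  by split=> x xs; apply: str; rewrite mem_cat xs ?orbT.
have H : \forall s \near F, [set: T] `<=` [set x | exists2 y, y \in s & U y x].
  apply: (iffLR (compact_near_coveringP _) cT (seq T) F
    (fun s x => exists2 y, y \in s & U y x) FF) => x _.
  exists (U x, [set s : seq T | x \in s]).
    split; first exact: (open_nbhs_nbhs (conj (oU x) (Ux x))).
    by exists [:: x] => // s; apply; rewrite mem_head.
  by move=> [y s] /= [Uy xs]; exists x.
have [s _ Hs] := H; exists s => x; exact: (Hs s (fun _ h => h) x I).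
Qed.

Section BimoduleMap.
Variables (R : realType) (n : nat) (M : smoothManifold R n) (Q : compactQuantumGroup R).
Hypothesis M_compact : compact [set: M].
Variable alpha : (M -> R[i]^o) -> (M -> Q).
Hypothesis act : smooth_action alpha.
Local Notation C := (R[i]^o).
Hypothesis comm : forall f g c i m, smooth M C f -> smooth M C g ->
  dform (alpha f) c i m * alpha g m = alpha g m * dform (alpha f) c i m.

(** A partition of unity subordinate to finitely many patches, reduced to what
    the construction of the bimodule map relies on. *)
Record chain_partition (I : finType) (c : I -> atlas M) (K : I -> set 'rV[R]_n)
    (chi : I -> M -> C) (xt : I -> 'I_n -> M -> C) : Prop := ChainPartition {
  part_K : forall k, compact (K k);
  part_KC : forall k, K k `<=` cimg (c k);
  part_chi : forall k, smooth M C (chi k);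
  part_supp : forall k m, chi k m != 0 -> cdom (c k) m /\ K k (cmap (c k) m);
  part_xt : forall k j, smooth M C (xt k j);
  part_sum : forall m, \sum_k chi k m = 1;
  part_chain : forall k f c1 i1 m1, smooth M C f -> cdom c1 m1 ->
    alpha (chi k) m1 * dform (alpha f) c1 i1 m1 =
      \sum_j alpha (fun m => chi k m * dform f (c k) j m : C) m1 *
             dform (alpha (xt k j)) c1 i1 m1
}.

Lemma chain_partition_exists : exists (N : nat) (c : 'I_N -> atlas M)
    (K : 'I_N -> set 'rV[R]_n) (chi : 'I_N -> M -> C) (xt : 'I_N -> 'I_n -> M -> C),
  chain_partition c K chi xt.
Proof.
have /choice[c /choice[K /choice[xt /choice[phi /choice[psi /choice[U HU]]]]]] :=
  patch_exists act comm.
have [s Hs] := finite_subcover M_compact (fun m => patch_open (HU m).2) (fun m => (HU m).1).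
pose pt (k : 'I_(size s)) := tnth (in_tuple s) k.
pose phiN (k : nat) : M -> C := oapp (fun k => phi (pt k)) (fun=> 0) (insub k).
have phiNE (k : 'I_(size s)) : phiN k = phi (pt k) by rewrite /phiN valK.
have sphi k : smooth M C (phiN k).
  rewrite /phiN; case: insub => [j|] /=; last exact: (smooth_cst (M := M) (0 : C)).
  exact: (patch_phi (HU (pt j)).2).
have chi_psi (k : 'I_(size s)) m : bump_part phiN k m * psi (pt k) m = bump_part phiN k m.
  rewrite /bump_part mulrAC; congr (_ * _).
  by rewrite phiNE (patch_phi_psi (HU (pt k)).2).
exists (size s), (c \o pt), (K \o pt), (fun k => bump_part phiN k), (xt \o pt).
split.
- by move=> k; exact: (patch_K (HU (pt k)).2).
- by move=> k; exact: (patch_KC (HU (pt k)).2).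
- by move=> k; exact: smooth_bump_part.
- move=> k m chi0; apply: (patch_supp (HU (pt k)).2).
  by apply: contra_neq chi0 => psi0; rewrite -chi_psi psi0 mulr0.
- by move=> k j; exact: (patch_xt (HU (pt k)).2).
- move=> m; have [y ys Uy] := Hs m.
  have [k yk] := tnthP (in_tuple s) y ys.
  apply: (sum_bump_part1 (k := k)) => //.
  by rewrite phiNE /pt -yk (patch_phi1 (HU y).2).
- move=> k f c1 i1 m1 sf cm1.
  exact: (patch_chain (HU (pt k)).2 i1 (smooth_bump_part sphi k) (chi_psi k) sf cm1).
Qed.

Section Construction.
Variables (I : finType) (c : I -> atlas M) (K : I -> set 'rV[R]_n).
Variables (chi : I -> M -> C) (xt : I -> 'I_n -> M -> C).
Hypothesis part : chain_partition c K chi xt.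

Definition cut_coef (w : form_family M C) (p : I * 'I_n) : M -> C :=
  fun m => chi p.1 m * w (c p.1) p.2 m.

(** The only candidate: [w] is the sum of the forms [chi_k w_j dx_j], and a map
    that is linear over [alpha] and compatible with d sends [h dx_j] to
    [alpha(h) d(alpha x_j)]. *)
Definition bimodule_map (w : form_family M C) : form_family M Q :=
  fun c1 i1 m1 => \sum_(p : I * 'I_n)
    alpha (cut_coef w p) m1 * dform (alpha (xt p.1 p.2)) c1 i1 m1.

Lemma smooth_cut_coef w p : one_form M C w -> smooth M C (cut_coef w p).
Proof.
move=> ow; exact: (smooth_cut (part_K part (k := p.1)) (part_KC part (k := p.1)) (part_chi part p.1)
  (part_supp part (k := p.1)) p.2 ow).
Qed.

Lemma one_form_coord p : one_form M Q (dform (alpha (xt p.1 p.2))).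
Proof. exact: (one_form_dform (act_smooth act (part_xt part p.1 p.2))). Qed.

Lemma one_form_term w p : one_form M C w ->
  one_form M Q (fun c1 i1 m1 => alpha (cut_coef w p) m1 * dform (alpha (xt p.1 p.2)) c1 i1 m1).
Proof.
move=> ow.
exact: (one_form_bil (qmul_bil Q) (act_smooth act (smooth_cut_coef p ow)) (one_form_coord p)).
Qed.

Lemma bimodule_map_form w : one_form M C w -> one_form M Q (bimodule_map w).
Proof. by move=> ow; exact: (one_form_sum (fun p _ => one_form_term p ow)). Qed.

Lemma bimodule_map_linear (a : R[i]) w w' : one_form M C w -> one_form M C w' ->
  bimodule_map (a *: w + w') = a *: bimodule_map w + bimodule_map w'.
Proof.
move=> ow ow'; apply/funext => c1; apply/funext => i1; apply/funext => m1.
rewrite -[RHS]/(a *: (\sum_p _) + \sum_p _) scaler_sumr -big_split /=.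
apply: eq_bigr => p _.
have sw := smooth_cut_coef p ow; have sw' := smooth_cut_coef p ow'.
have -> : cut_coef (a *: w + w') p = a *: cut_coef w p + cut_coef w' p.
  apply/funext => m; rewrite /cut_coef.
  set x := chi p.1 m; set y := w (c p.1) p.2 m; set z := w' (c p.1) p.2 m.
  by change (x * (a * y + z) = a * (x * y) + x * z :> R[i]); ring.
rewrite (act_linear act a sw sw') -(bilZl (qmul_bil Q)) -mulrDl; exact: erefl.
Qed.

Lemma bimodule_map_continuous :
  {within (one_form M C : set (Omega1 M C)), continuous (bimodule_map : Omega1 M C -> Omega1 M Q)}.
Proof.
apply/subspace_continuousP => w0 ow0.
set F := within _ _.
have FF : Filter F by exact: within_filter.
have oF : \forall w \near F, one_form M C w by rewrite /F; apply: withinT.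
have Fw0 : F --> (w0 : Omega1 M C) by exact: cvg_within.
have sF p : \forall w \near F, smooth M C (cut_coef w p).
  by apply: filterS oF => w; exact: smooth_cut_coef.
have aF p : \forall w \near F, smooth M Q (alpha (cut_coef w p)).
  by apply: filterS (sF p) => w sw; exact: (act_smooth act sw).
have tF p : \forall w \near F, one_form M Q
    (fun c1 i1 m1 => alpha (cut_coef w p) m1 * dform (alpha (xt p.1 p.2)) c1 i1 m1).
  by apply: filterS oF => w ow; exact: one_form_term.
apply: (@cvg_sum_form R n M Q _ F FF _ _ _ tF (fun p => one_form_term p ow0)) => p.
apply: (@cvg_bil_form R n M _ _ _ _ (qmul_bil Q) _ F FF _ _ _ (aF p)
  (act_smooth act (smooth_cut_coef p ow0)) (one_form_coord p)).
apply: (@alpha_cvg _ _ _ _ _ act _ F _ _ FF (sF p) (smooth_cut_coef p ow0)).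
exact: (@cvg_cut R n M (c p.1) (K p.1) (chi p.1) (part_K part (k := p.1)) (part_KC part (k := p.1))
  (part_chi part p.1) (part_supp part (k := p.1)) w0 p.2 F FF ow0 oF Fw0).
Qed.

Lemma bimodule_map_lmulf f w : smooth M C f -> one_form M C w ->
  bimodule_map (lmulf f w) = lmulf (alpha f) (bimodule_map w).
Proof.
move=> sf ow; apply/funext => c1; apply/funext => i1; apply/funext => m1.
rewrite /lmulf /bimodule_map mulr_sumr; apply: eq_bigr => p _.
rewrite mulrA; congr (_ * _); rewrite -(alphaM act m1 sf (smooth_cut_coef p ow)).
by congr (alpha _ m1); apply/funext => m; exact: mulrCA.
Qed.

(** [alpha f] passes the forms [d(alpha x_j)] by the commutation hypothesis. *)
Lemma bimodule_map_rmulf f w : smooth M C f -> one_form M C w ->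
  bimodule_map (rmulf w f) = rmulf (bimodule_map w) (alpha f).
Proof.
move=> sf ow; apply/funext => c1; apply/funext => i1; apply/funext => m1.
rewrite /rmulf /bimodule_map mulr_suml; apply: eq_bigr => p _.
rewrite -[RHS]mulrA (comm c1 i1 m1 (part_xt part p.1 p.2) sf) mulrA; congr (_ * _).
rewrite -(alphaM act m1 (smooth_cut_coef p ow) sf).
by congr (alpha _ m1); apply/funext => m; exact: mulrA.
Qed.

Lemma alpha_part_sum m : \sum_k alpha (chi k) m = 1.
Proof.
rewrite -[RHS](alpha1 act m).
have [E _] : alpha (fun m => \sum_k chi k m) = (fun m => \sum_k alpha (chi k) m) /\
    smooth M C (fun m => \sum_k chi k m).
  elim: (index_enum I) => [|k r [IH1 IH2]].
    split; last by under eq_fun do rewrite big_nil; exact: (smooth_cst (M := M) (0 : C)).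
    under eq_fun do rewrite big_nil; rewrite (alpha0 act).
    by apply/funext => m'; rewrite big_nil.
  split; last first.
    by under eq_fun do rewrite big_cons; exact: (smoothD (part_chi part k) IH2).
  under eq_fun do rewrite big_cons.
  rewrite (alphaD act (part_chi part k) IH2) IH1.
  by apply/funext => m'; rewrite big_cons.
rewrite -[LHS](congr1 (fun F => F m) E); congr (alpha _ m).
by apply/funext => m'; exact: (part_sum part m').
Qed.

(** The chain rule for each [chi k], and [sum_k alpha(chi_k) = alpha 1 = 1]. *)
Lemma bimodule_map_dform f : smooth M C f -> bimodule_map (dform f) = dform (alpha f).
Proof.
move=> sf; apply/funext => c1; apply/funext => i1; apply/funext => m1.
rewrite /bimodule_map; have [cm|cm] := pselect (cdom c1 m1); last first.
  by rewrite (dform_out _ _ cm) big1// => p _; rewrite (dform_out _ _ cm) mulr0.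
rewrite -[RHS]mul1r -(alpha_part_sum m1) mulr_suml.
rewrite -(pair_bigA _ (fun k j => alpha (cut_coef (dform f) (k, j)) m1 *
  dform (alpha (xt k j)) c1 i1 m1)) /=.
by apply: eq_bigr => k _; rewrite (part_chain part k i1 sf cm).
Qed.

End Construction.

End BimoduleMap.

(** * The equivalence *)

Section Commutation.
Variables (R : realType) (n : nat) (M : smoothManifold R n) (Q : compactQuantumGroup R).
Variable alpha : (M -> R[i]^o) -> (M -> Q).
Hypothesis act : smooth_action alpha.
Local Notation C := (R[i]^o).

Lemma commute_chart f g (c c' : atlas M) m : smooth M C f -> cdom c' m ->
  (forall i, dform (alpha f) c' i m * alpha g m = alpha g m * dform (alpha f) c' i m) ->
  forall i, dform (alpha f) c i m * alpha g m = alpha g m * dform (alpha f) c i m.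
Proof.
move=> sf c'm H i; have [cm|cm] := pselect (cdom c m); last first.
  by rewrite dform_out// mul0r mulr0.
rewrite (dform_change i (act_smooth act sf) cm c'm) mulr_suml mulr_sumr.
by apply: eq_bigr => j _; rewrite (bilZl (qmul_bil Q)) (bilZr (qmul_bil Q)) H.
Qed.

(** Some vector field has the components of a given coordinate direction at a
    given point; the Jacobian carries commutation from one chart to the others. *)
Lemma vder_commutation :
  (forall (f g : M -> C) (nu : vectorField M), smooth M C f -> smooth M C g ->
     vder nu (alpha f) \* alpha g = alpha g \* vder nu (alpha f)) <->
  (forall f g (c : atlas M) i m, smooth M C f -> smooth M C g ->
     dform (alpha f) c i m * alpha g m = alpha g m * dform (alpha f) c i m).
Proof.
split=> [H f g c i m sf sg | H f g nu sf sg].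
  have cm : cdom (chart_at m) m by exact: (projT2 (cid (cdom_cover m))).
  apply: (commute_chart c sf cm) => {}i.
  have [nu Hnu] := vector_field_exists i cm.
  have E : vder nu (alpha f) m = dform (alpha f) (chart_at m) i m.
    rewrite /vder (bigD1 i)//= big1 ?addr0; last first.
      by move=> j ji; rewrite Hnu (negbTE ji) scale0r.
    by rewrite Hnu eqxx scale1r.
  have := congr1 (fun F => F m) (H f g nu sf sg).
  by rewrite /= E.
apply/funext => m; rewrite /= /vder mulr_suml mulr_sumr; apply: eq_bigr => j _.
by rewrite (bilZl (qmul_bil Q)) (bilZr (qmul_bil Q)) H.
Qed.

End Commutation.

Theorem theorem3p8 (R : realType) (n : nat) (M : smoothManifold R n)
    (M_compact : compact [set: M]) (Q : compactQuantumGroup R)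
    (alpha : (M -> R[i]^o) -> (M -> Q)) (alpha_action : smooth_action alpha) :
  (exists beta : form_family M R[i]^o -> form_family M Q,
     (forall w, one_form M R[i]^o w -> one_form M Q (beta w)) /\
     (forall (a : R[i]) w w', one_form M R[i]^o w -> one_form M R[i]^o w' ->
        beta (a *: w + w') = a *: beta w + beta w') /\
     {within (one_form M R[i]^o : set (Omega1 M R[i]^o)),
       continuous (beta : Omega1 M R[i]^o -> Omega1 M Q)} /\
     (forall f w, smooth M R[i]^o f -> one_form M R[i]^o w ->
        beta (lmulf f w) = lmulf (alpha f) (beta w)) /\
     (forall f w, smooth M R[i]^o f -> one_form M R[i]^o w ->
        beta (rmulf w f) = rmulf (beta w) (alpha f)) /\
     (forall f, smooth M R[i]^o f -> beta (dform f) = dform (alpha f)))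
  <->
  (forall (f g : M -> R[i]^o) (nu : vectorField M),
     smooth M R[i]^o f -> smooth M R[i]^o g ->
     vder nu (alpha f) \* alpha g = alpha g \* vder nu (alpha f)).
Proof.
split.
  move=> [beta [_ [_ [_ [Hl [Hr Hd]]]]]].
  apply/(vder_commutation alpha_action) => f g c i m sf sg.
  have odf := one_form_dform sf.
  have E : rmulf (dform f) g = lmulf g (dform f).
    by apply/funext => c'; apply/funext => j; apply/funext => m'; exact: mulrC.
  have := Hr g _ sg odf; rewrite E (Hl g _ sg odf) (Hd f sf).
  by move=> /(congr1 (fun w => w c i m)) /esym.
move/(vder_commutation alpha_action) => comm.
have [N [c [K [chi [xt part]]]]] := chain_partition_exists M_compact alpha_action comm.
exists (bimodule_map alpha c chi xt).
split; [exact: (bimodule_map_form alpha_action part)|].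
split; [exact: (bimodule_map_linear alpha_action part)|].
split; [exact: (bimodule_map_continuous alpha_action part)|].
split; [exact: (bimodule_map_lmulf alpha_action part)|].
split; [exact: (bimodule_map_rmulf alpha_action comm part)|].
exact: (bimodule_map_dform alpha_action part).
Qed.
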